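(* Let $T>0$, $\gamma>1$, $\varepsilon\in(0,1]$, $\eta>0$ be fixed and $Q=(0,T)\times\Omega$. Let $(\mathcal M^{(m)},\mathcal E^{(m)})_{m\in\mathbb N}$ be a sequence of MAC grids of $\Omega$ and $\delta t^{(m)}=T/N^{(m)}$ a sequence of time-steps such that $\lim_{m\to\infty}\delta t^{(m)}=0$ and $\lim_{m\to\infty}h^{(m)}=0$, where $h^{(m)}=\max_{K\in\mathcal M^{(m)}}\mathrm{diam}(K)$. Let $(\rho^{(m)},\boldsymbol u^{(m)},\theta^{(m)})_{m\in\mathbb N}$ be the corresponding sequence of discrete solutions, i.e. for each $m$ the solution (with initial values obtained by cell averages of the initial datum $(\rho_0,\boldsymbol u_0,\theta_0)\in L^\infty(\Omega)^{d+2}$) on the grid $(\mathcal M^{(m)},\mathcal E^{(m)})$ with time-step $\delta t=\delta t^{(m)}$ of the scheme, $0\le n\le N^{(m)}-1$, $$\frac{1}{\delta t}(\rho_K^{n+1}-\rho_K^n)+\frac1{|K|}\sum_{\sigma\in\mathcal E(K)}F_{\sigma,K}(\rho^n,\boldsymbol u^n)=0,\quad \forall K\in\mathcal M,$$ $$\frac1{\delta t}(\rho^{n+1}_{D_\sigma}u^{n+1}_\sigma-\rho^n_{D_\sigma}u^n_\sigma)+\frac1{|D_\sigma|}\sum_{\epsilon\in\tilde{\mathcal E}(D_\sigma)}F_{\epsilon,\sigma}(\rho^n,\boldsymbol u^n)u^n_{\epsilon,\mathrm{up}}+\frac1{\varepsilon^2}(\partial^{(i)}_{\mathcal E}p^{n+1})_\sigma=0,\quad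 1\le i\le d,\ \forall\sigma\in\mathcal E^{(i)}_{\mathrm{int}},$$ $$\frac1{\delta t}(\rho^{n+1}_K\theta^{n+1}_K-\rho^n_K\theta^n_K)+\frac1{|K|}\sum_{\sigma\in\mathcal E(K)}F_{\sigma,K}(\rho^{n+1}\theta^{n+1},\boldsymbol v^{n+1})=0,\quad\forall K\in\mathcal M,$$ where $p^{n+1}_K=(\rho_K^{n+1}\theta_K^{n+1})^\gamma$. Assume that: (i) the sequence is uniformly bounded: there are constants $\underline C,\bar C,C>0$, independent of $m$, such that for all $m\in\mathbb N$ and $0\le n\le N^{(m)}$, $$\underline C<(\rho^{(m)})^n_K\le\bar C,\quad \underline C<(\theta^{(m)})^n_K\le\bar C\quad\forall K\in\mathcal M^{(m)},\qquad |(u^{(m)})^n_\sigma|\le C\quad\forall\sigma\in\mathcal E^{(m)};$$ (ii) $(\rho^{(m)},\boldsymbol u^{(m)},\theta^{(m)})_{m\in\mathbb N}$ converges to some $(\rho,\boldsymbol u,\theta)\in L^\infty(0,T;L^\infty(\Omega)^{1+d+1})$ in $L^r(Q)^{1+d+1}$ for $1\le r<\infty$; (iii) there is $\mu>0$, independent of $m$, such that for all $m\in\mathbb N$ $$\frac{\delta t^{(m)}}{\min_{K\in\mathcal M^{(m)}}\mathrm{diam}(K)}\le\mu,\qquad \max_{K\in\mathcal M^{(m)}}\frac{\mathrm{diam}(K)^2}{|K|}\le\mu .$$ Then $(\rho,\boldsymbol u,\theta)$ is a weak solution of $$\partial_t\rho+\mathrm{div}(\rho\boldsymbol u)=0,\quad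 \partial_t(\rho\boldsymbol u)+\mathrm{div}(\rho\boldsymbol u\otimes\boldsymbol u)+\frac1{\varepsilon^2}\nabla(\rho\theta)^\gamma=0,\quad \partial_t(\rho\theta)+\mathrm{div}(\rho\theta\boldsymbol u)=0$$ in $Q$ with initial data $(\rho,\boldsymbol u,\theta)|_{t=0}=(\rho_0,\boldsymbol u_0,\theta_0)$.
   Context: Weak solution. $(\rho,\boldsymbol u,\theta)\in L^\infty(Q)^{d+2}$ is a weak solution if for all scalar $\varphi$ and $\mathbb R^d$-valued $\boldsymbol\varphi$ in $C_c^\infty([0,T)\times\Omega)$ ($\Omega$ the torus): $\int_Q(\rho\,\partial_t\varphi+\rho\boldsymbol u\cdot\nabla\varphi)\,dx\,dt=-\int_\Omega\rho_0\varphi(0,\cdot)\,dx$; $\int_Q(\rho\boldsymbol u\cdot\partial_t\boldsymbol\varphi+(\rho\boldsymbol u\otimes\boldsymbol u):\nabla\boldsymbol\varphi+\frac1{\varepsilon^2}(\rho\theta)^\gamma\,\mathrm{div}\,\boldsymbol\varphi)\,dx\,dt=-\int_\Omega\rho_0\boldsymbol u_0\cdot\boldsymbol\varphi(0,\cdot)\,dx$; $\int_Q(\rho\theta\,\partial_t\varphi+\rho\theta\boldsymbol u\cdot\nabla\varphi)\,dx\,dt=-\int_\Omega\rho_0\theta_0\varphi(0,\cdot)\,dx$. Discrete initial data and functions. $\rho^0_K=\frac1{|K|}\int_K\rho_0$, $\theta^0_K=\frac1{|K|}\int_K\theta_0$ for $K\in\mathcal M$, and $u^0_\sigma=\frac1{|D_\sigma|}\int_{D_\sigma}(\boldsymbol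 u_0)_i$ for $\sigma\in\mathcal E^{(i)}_{\mathrm{int}}$. With $t^n=n\,\delta t$, discrete solutions are identified with functions on $Q$: $\rho^{(m)}=\rho^n_K$ and $\theta^{(m)}=\theta^n_K$ on $[t^n,t^{n+1})\times K$, and the $i$-th component of $\boldsymbol u^{(m)}$ equals $u^n_\sigma$ on $[t^n,t^{n+1})\times D_\sigma$, $\sigma\in\mathcal E^{(i)}$. Grid. $\Omega$ is a $d$-dimensional box, $d\in\{1,2,3\}$, with periodic boundary conditions (i.e. identified with the torus $\mathbb T^d$). A MAC grid $(\mathcal M,\mathcal E)$ consists of a primal mesh $\mathcal M$: a conforming, structured, possibly non-uniform partition of $\bar\Omega$ into closed axis-parallel boxes $K$ (primal cells), and the set $\mathcal E$ of their faces $\sigma$. $\mathcal E^{(i)}$ is the set of faces orthogonal to the $i$-th unit vector $\boldsymbol e^{(i)}$; $\mathcal E(K)$ is the set of faces of $K$. Because of periodicity every face is internal, $\mathcal E_{\mathrm{int}}=\mathcal E$, $\mathcal E^{(i)}_{\mathrm{int}}=\mathcal E^{(i)}$, and each face is $\sigma=K|L$, the common face of two cells $K\ne L$. $|K|$ and $|\sigma|$ denote $d$- and $(d-1)$-dimensional measures ($|\sigma|=1$ if $d=1$). The dual cell $D_\sigma$ of $\sigma=K|L$ is the union of the halves of $K$ and $L$ adjacent to $\sigma$, so $|D_\sigma|=\frac12(|K|+|L|)$; $\tilde{\mathcal E}(D_\sigma)$ is the set of faces $\epsilon$ of $D_\sigma$, and $\epsilon=D_\sigma|D_{\sigma'}$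 is the face shared by the dual cells of $\sigma,\sigma'\in\mathcal E^{(i)}$. Notation. $a^+=\max\{a,0\}$, $a^-=\min\{a,0\}$. $\boldsymbol\nu_{\sigma,K}$ is the unit normal to $\sigma$ outward to $K$, and $u_{\sigma,K}=u_\sigma\,\boldsymbol e^{(i)}\cdot\boldsymbol\nu_{\sigma,K}$ for $\sigma\in\mathcal E^{(i)}\cap\mathcal E(K)$. For $\sigma=K|L\in\mathcal E^{(i)}$, $(\partial^{(i)}_{\mathcal E}q)_\sigma=\frac{|\sigma|}{|D_\sigma|}(q_L-q_K)\,\boldsymbol e^{(i)}\cdot\boldsymbol\nu_{\sigma,K}$. Mass flux ($\sigma=K|L$): $F_{\sigma,K}(\rho,\boldsymbol u)=|\sigma|\{\rho_K u_{\sigma,K}^++\rho_L u_{\sigma,K}^-\}$. Dual density: $|D_\sigma|\rho_{D_\sigma}=\frac12|K|\rho_K+\frac12|L|\rho_L$. Dual mass fluxes, for $\sigma=K|L\in\mathcal E^{(i)}$, with $F_{\sigma,K}=F_{\sigma,K}(\rho,\boldsymbol u)$: if $\epsilon\subset K$ is orthogonal to $\boldsymbol e^{(i)}$ and $\sigma'$ is the face of $K$ opposite to $\sigma$, $F_{\epsilon,\sigma}=\frac12(F_{\sigma',K}-F_{\sigma,K})$ (similarly in $L$); if $\epsilon$ is not orthogonal to $\boldsymbol e^{(i)}$, it is the union of a half of a face $\tau\in\mathcal E(K)$ and a half of a face $\tau'\in\mathcal E(L)$, and $F_{\epsilon,\sigma}=\frac12(F_{\tau,K}+F_{\tau',L})$.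 Upwind value: for $\epsilon=D_\sigma|D_{\sigma'}$, $u_{\epsilon,\mathrm{up}}=u_\sigma$ if $F_{\epsilon,\sigma}\ge0$ and $u_{\epsilon,\mathrm{up}}=u_{\sigma'}$ otherwise. Stabilised velocity and temperature flux: $v^{n+1}_\sigma=u^n_\sigma-\delta u^{n+1}_\sigma$ with $\delta u_\sigma^{n+1}=\frac{\eta\,\delta t}{\varepsilon^2}(\partial_{\mathcal E}^{(i)}p^{n+1})_\sigma$ for $\sigma\in\mathcal E^{(i)}_{\mathrm{int}}$; with $\delta u_{\sigma,K}=\delta u_\sigma\boldsymbol e^{(i)}\cdot\boldsymbol\nu_{\sigma,K}$, set $(v^{n+1}_{\sigma,K})_+=(u^n_{\sigma,K})^+-(\delta u^{n+1}_{\sigma,K})^-$ and $(v^{n+1}_{\sigma,K})_-=(u^n_{\sigma,K})^--(\delta u^{n+1}_{\sigma,K})^+$; then, for $\sigma=K|L$, $$F_{\sigma,K}(\rho^{n+1}\theta^{n+1},\boldsymbol v^{n+1})=|\sigma|\{\rho^{n+1}_K\theta^{n+1}_K(v^{n+1}_{\sigma,K})_++\rho^{n+1}_L\theta^{n+1}_L(v^{n+1}_{\sigma,K})_-\}.$$ *)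

(* Defs.v *)
From HB Require Import structures.
From mathcomp Require Import all_boot all_order all_algebra.
From mathcomp Require Import all_classical all_reals all_analysis.
Set Implicit Arguments. Unset Strict Implicit. Unset Printing Implicit Defensive.
Import Order.TTheory GRing.Theory Num.Theory.
Import numFieldNormedType.Exports.
Local Open Scope classical_set_scope.
Local Open Scope ring_scope.

(* 'rV[T]_n carries the product sigma-algebra (for T = R, the Borel sets of
   R^n), as the library does for n.-tuple T. *)
Definition measure_rV_display : measure_display -> measure_display.
Proof. exact. Qed.

Section measurable_rV.
Context {d : measure_display} {T : sigmaRingType d} (n : nat).

Definition rV_coord (i : 'I_n) (x : 'rV[T]_n) : T := x ord0 i.

Let rV_set0 : g_sigma_preimage rV_coord set0.
Proof. exact: sigma_algebra0. Qed.

Let rV_setC A : g_sigma_preimage rV_coord A -> g_sigma_preimage rV_coord (~` A).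
Proof. exact: sigma_algebraC. Qed.

Let rV_bigcup (F : _^nat) : (forall i, g_sigma_preimage rV_coord (F i)) ->
  g_sigma_preimage rV_coord (\bigcup_i (F i)).
Proof. exact: sigma_algebra_bigcup. Qed.

HB.instance Definition _ := @isMeasurable.Build (measure_rV_display d)
  'rV[T]_n (g_sigma_preimage rV_coord) rV_set0 rV_setC rV_bigcup.

Lemma measurable_rV_coord (i : 'I_n) : measurable_fun [set: 'rV[T]_n] (rV_coord i).
Proof.
move=> _ Y mY; rewrite setTI; apply: sub_sigma_algebra => /=.
rewrite -bigcup_seq/=; exists i => /=; first by rewrite mem_index_enum.
by exists Y => //; rewrite setTI.
Qed.

End measurable_rV.

Lemma measurable_fun_rVP d1 d2 (T1 : measurableType d1) (T2 : measurableType d2)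
    (n : nat) (f : T1 -> 'rV[T2]_n) :
  measurable_fun [set: T1] f <->
  forall i, measurable_fun [set: T1] (fun x => f x ord0 i).
Proof.
split=> [mf i|mf].
  by apply: (measurableT_comp (measurable_rV_coord i)).
move=> _ Y mY; rewrite setTI.
have: (g_sigma_preimage (@rV_coord _ T2 n)) `<=` [set Y | measurable (f @^-1` Y)].
  apply: smallest_sub.
    split => /=; first by rewrite preimage_set0.
      by move=> A mA; rewrite setTD preimage_setC; exact: measurableC.
    by move=> F mF; rewrite preimage_bigcup; exact: bigcup_measurable.
  rewrite -bigcup_seq => A [/= i _ [B mB <-]].
  by rewrite setTI -[X in measurable X]setTI; exact: mf.
by apply.
Qed.


Section lebesgue_rV.
Context {R : realType}.

Definition rV_cons (n : nat) (x : R * 'rV[R]_n) : 'rV[R]_n.+1 :=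
  \row_i if unlift ord0 i is Some j then x.2 ord0 j else x.1.

Definition rV_uncons (n : nat) (y : 'rV[R]_n.+1) : R * 'rV[R]_n :=
  (y ord0 ord0, \row_i y ord0 (lift ord0 i)).

Lemma rV_consK n : cancel (@rV_cons n) (@rV_uncons n).
Proof.
case=> s x; rewrite /rV_uncons /rV_cons mxE unlift_none; congr pair.
by apply/rowP => i; rewrite !mxE liftK.
Qed.

Lemma rV_unconsK n : cancel (@rV_uncons n) (@rV_cons n).
Proof.
move=> y; apply/rowP => i; rewrite !mxE /=.
by case: unliftP => [j ->|->] //=; rewrite mxE.
Qed.

Lemma measurable_rV_cons n :
  measurable_fun [set: R * 'rV[R]_n] (@rV_cons n).
Proof.
apply/measurable_fun_rVP => i; rewrite /rV_cons.
case: (unliftP ord0 i) => [j ij|i0].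
  rewrite [X in measurable_fun _ X](_ : _ = rV_coord j \o snd).
    exact: measurableT_comp (measurable_rV_coord j) measurable_snd.
  by apply/funext => x; rewrite !mxE ij liftK.
rewrite [X in measurable_fun _ X](_ : _ = fst); first exact: measurable_fst.
by apply/funext => x; rewrite !mxE i0 unlift_none.
Qed.

Lemma measurable_rV_uncons n :
  measurable_fun [set: 'rV[R]_n.+1] (@rV_uncons n).
Proof.
apply: measurable_fun_pair; first exact: measurable_rV_coord.
apply/measurable_fun_rVP => i.
rewrite [X in measurable_fun _ X](_ : _ = rV_coord (lift ord0 i)).
  exact: measurable_rV_coord.
by apply/funext => y; rewrite !mxE.
Qed.


Section lebesgue_step.
Variables (n : nat) (m : {sigma_finite_measure set 'rV[R]_n -> \bar R}).

Definition lebesgue_step : set 'rV[R]_n.+1 -> \bar R :=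
  pushforward (lebesgue_measure \x m)%E (@rV_cons n).

Let mcons (A : set 'rV[R]_n.+1) : measurable A -> measurable (@rV_cons n @^-1` A).
Proof.
by move=> mA; rewrite -[X in measurable X]setTI; exact: measurable_rV_cons.
Qed.

Let step0 : lebesgue_step set0 = 0%E.
Proof. by rewrite /lebesgue_step /pushforward preimage_set0 measure0. Qed.

Let step_ge0 A : (0 <= lebesgue_step A)%E.
Proof. by rewrite /lebesgue_step /pushforward; exact: measure_ge0. Qed.

Let step_sigma_additive : semi_sigma_additive lebesgue_step.
Proof.
move=> F mF tF mUF; rewrite /lebesgue_step /pushforward preimage_bigcup.
apply: measure_semi_sigma_additive.
- by move=> k; exact: mcons.
- apply/trivIsetP => /= i j _ _ ij; rewrite -preimage_setI.
  by move/trivIsetP : tF => /(_ _ _ _ _ ij) ->//; rewrite preimage_set0.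
- by rewrite -preimage_bigcup; exact: mcons.
Qed.

HB.instance Definition _ := isMeasure.Build _ _ _ lebesgue_step
  step0 step_ge0 step_sigma_additive.

Let step_sigma_finite : sigma_finite setT lebesgue_step.
Proof.
have /sigma_finiteP[F [TF ndF Foo]] := sigma_finiteT (@lebesgue_measure R).
have /sigma_finiteP[G [TG ndG Goo]] := sigma_finiteT m.
have E k : @rV_cons n @^-1` (@rV_uncons n @^-1` (F k `*` G k)) = F k `*` G k.
  by apply/funext => x; rewrite /preimage/mkset rV_consK.
exists (fun k => @rV_uncons n @^-1` (F k `*` G k)).
  rewrite -preimage_bigcup (_ : \bigcup_k _ = setT) ?preimage_setT//.
  rewrite -subTset => -[s x] _.
  have : setT s by []. rewrite TF => -[i _ Fis].
  have : setT x by []. rewrite TG => -[j _ Gjx].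
  exists (maxn i j) => //; split.
  - by move: s Fis; exact/subsetPset/ndF/leq_maxl.
  - by move: x Gjx; exact/subsetPset/ndG/leq_maxr.
move=> k; have [mF Fk] := Foo k; have [mG Gk] := Goo k; split.
  rewrite -[X in measurable X]setTI; apply: measurable_rV_uncons => //.
  exact: measurableX.
rewrite /lebesgue_step /pushforward E product_measure1E//.
by rewrite lte_mul_pinfty// ge0_fin_numE.
Qed.

HB.instance Definition _ := Measure_isSigmaFinite.Build _ _ _ lebesgue_step
  step_sigma_finite.

End lebesgue_step.

(* Lebesgue measure on R^n: the image of the product of the Lebesgue measures
   on R and R^(n-1) under rV_cons. *)
Fixpoint lebesgue_rV n : {sigma_finite_measure set 'rV[R]_n -> \bar R} :=
  if n is n'.+1 then lebesgue_step (lebesgue_rV n') else \d_(0 : 'rV[R]_0).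

Lemma lebesgue_rV_box n (l h : 'I_n -> R) : (forall i, l i <= h i) ->
  lebesgue_rV n [set x | forall i, l i <= x ord0 i < h i] =
  (\prod_i (h i - l i))%:E.
Proof.
elim: n l h => [|n IH] l h lh.
  by rewrite big_ord0 /= diracE mem_set// => -[].
pose A := [set x : 'rV[R]_n | forall i,
  l (lift ord0 i) <= x ord0 i < h (lift ord0 i)].
have mA : measurable A.
  rewrite (_ : A = \bigcap_(i in [set: 'I_n])
    (@rV_coord _ R n i @^-1` `[l (lift ord0 i), h (lift ord0 i)[%classic)).
    apply: fin_bigcap_measurable => // i _.
    rewrite -[X in measurable X]setTI.
    by apply: measurable_rV_coord => //; exact: measurable_itv.
  apply/seteqP; split => x /= H i; first by move=> _ /=; rewrite in_itv/=; exact: H.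
  by have /= := H i Logic.I; rewrite in_itv.
have E : @rV_cons n @^-1` [set x | forall i, l i <= x ord0 i < h i] =
    `[l ord0, h ord0[%classic `*` A.
  apply/seteqP; split => -[s x] /=.
    move=> H; split; first by have := H ord0; rewrite mxE unlift_none in_itv.
    by move=> i; have := H (lift ord0 i); rewrite mxE liftK.
  case=> H0 H i; rewrite mxE; case: unliftP => [j ->|->] //.
transitivity ((lebesgue_measure \x lebesgue_rV n)%E (`[l ord0, h ord0[%classic `*` A)).
  by rewrite -E.
rewrite product_measure1E//.
rewrite [X in (X * _)%E](lebesgue_measure_itv `[l ord0, h ord0[)/= lte_fin IH; last by move=> i; exact: lh.
rewrite big_ord_recl; have := lh ord0; rewrite le_eqVlt => /orP[/eqP->|->].
  by rewrite ltxx subrr mul0r mul0e.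
by rewrite EFinM EFinB.
Qed.

End lebesgue_rV.

Section domain.
Context {R : realType} {d : nat}.
Implicit Types (a b : 'I_d -> R) (T : R).

Definition e_ (i : 'I_d) : 'rV[R]_d := delta_mx ord0 i.

(* The torus R^d / prod_i (b_i - a_i) Z is represented by its fundamental
   domain, the half-open box; functions on the torus are functions on this box,
   and the smooth ones are the restrictions of periodic functions on R^d. *)
Definition Omega a b : set 'rV[R]_d :=
  [set x | forall i, a i <= x ord0 i < b i].

Definition Qset T a b : set (R * 'rV[R]_d) := `]0, T[%classic `*` Omega a b.

Definition Linfty_Omega a b (f : 'rV[R]_d -> R) : Prop :=
  f \_ (Omega a b) \in Lfun (lebesgue_rV d) +oo%E.

Definition Linfty_Q T a b (f : R * 'rV[R]_d -> R) : Prop :=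
  f \_ (Qset T a b) \in Lfun (lebesgue_measure \x lebesgue_rV d)%E +oo%E.

Definition LrQ_norm T a b (r : R) (f : R * 'rV[R]_d -> R) : \bar R :=
  'N[(lebesgue_measure \x lebesgue_rV d)%E]_(r%:E)[EFin \o (f \_ (Qset T a b))].

Definition int_Omega a b (f : 'rV[R]_d -> R) : R :=
  \int[lebesgue_rV d]_(x in Omega a b) f x.

Definition int_Q T a b (f : R * 'rV[R]_d -> R) : R :=
  \int[(lebesgue_measure \x lebesgue_rV d)%E]_(z in Qset T a b) f z.

Definition dt_ (f : R * 'rV[R]_d -> R) : R * 'rV[R]_d -> R := 'D_(1, 0) f.

Definition dx_ (i : 'I_d) (f : R * 'rV[R]_d -> R) : R * 'rV[R]_d -> R :=
  'D_(0, e_ i) f.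

Fixpoint Ck (k : nat) (f : R * 'rV[R]_d -> R) : Prop :=
  continuous f /\
  if k is k'.+1 then
    forall v, (forall z, derivable f z v) /\ Ck k' ('D_v f)
  else True.

(* C_c^oo([0,T) x torus): restrictions to t >= 0 of smooth functions on
   R x torus that vanish for t >= T' for some T' < T; they need not vanish at
   t = 0. *)
Definition test_function T a b (phi : R * 'rV[R]_d -> R) : Prop :=
  [/\ forall k, Ck k phi,
      forall i t x, phi (t, x + (b i - a i) *: e_ i) = phi (t, x)
    & exists2 T', T' < T & forall t x, T' <= t -> phi (t, x) = 0].

(* Vector fields are given by their components. *)
Definition weak_solution T a b (gamma eps : R)
    (rho0 : 'rV[R]_d -> R) (u0 : 'I_d -> 'rV[R]_d -> R) (theta0 : 'rV[R]_d -> R)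
    (rho : R * 'rV[R]_d -> R) (u : 'I_d -> R * 'rV[R]_d -> R)
    (theta : R * 'rV[R]_d -> R) : Prop :=
  [/\ [/\ Linfty_Q T a b rho, forall i, Linfty_Q T a b (u i)
        & Linfty_Q T a b theta],
      forall phi, test_function T a b phi ->
        int_Q T a b (fun z => rho z * dt_ phi z
          + \sum_i rho z * u i z * dx_ i phi z)
        = - int_Omega a b (fun x => rho0 x * phi (0, x)),
      forall phi : 'I_d -> R * 'rV[R]_d -> R,
        (forall i, test_function T a b (phi i)) ->
        int_Q T a b (fun z => (\sum_i rho z * u i z * dt_ (phi i) z)
          + (\sum_i \sum_j rho z * u i z * u j z * dx_ j (phi i) z)
          + (eps ^+ 2)^-1 * (rho z * theta z) `^ gamma
            * (\sum_i dx_ i (phi i) z))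
        = - int_Omega a b (fun x => \sum_i rho0 x * u0 i x * phi i (0, x))
    & forall phi, test_function T a b phi ->
        int_Q T a b (fun z => rho z * theta z * dt_ phi z
          + \sum_i rho z * theta z * u i z * dx_ i phi z)
        = - int_Omega a b (fun x => rho0 x * theta0 x * phi (0, x))].

End domain.

(* A structured conforming partition of the box into axis-parallel boxes is the
   product of d one-dimensional partitions
   a_i = node i 0 < ... < node i (ncell i) = b_i.  Under periodicity every face
   separates two distinct cells, whence at least two cells per direction. *)
Record mac_grid (R : realType) (d : nat) (a b : 'I_d -> R) := MacGrid {
  ncell : 'I_d -> nat ;
  node : 'I_d -> nat -> R ;
  ncell_gt1 : forall i, (1 < ncell i)%N ;
  node_first : forall i, node i 0%N = a i ;
  node_last : forall i, node i (ncell i) = b i ;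
  node_lt : forall i k, (k < ncell i)%N -> node i k < node i k.+1 }.

Section grid.
Context {R : realType} {d : nat} {a b : 'I_d -> R} (g : mac_grid a b).

Definition cell : finType := {dffun forall i : 'I_d, 'I_(ncell g i)}.

(* (i, K) is the face of K orthogonal to the i-th unit vector on its upper
   side; by periodicity each face is the upper face of exactly one cell. *)
Definition face : finType := ('I_d * cell)%type.

Implicit Types (K : cell) (s : face) (i j : 'I_d) (up : bool).

(* The cell next to K in direction +e_i (up = true) or -e_i (up = false). *)
Definition neighbor up i K : cell :=
  [ffun j : 'I_d => if j == i then (if up then ordS (K j) else ord_pred (K j))
                    else K j].

Definition lo K i : R := node g i (K i).
Definition hi K i : R := node g i (K i).+1.
Definition side K i : R := hi K i - lo K i.

(* The measure (see lebesgue_cell_set) and the Euclidean diameter of the box. *)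
Definition vol K : R := \prod_i side K i.
Definition diam K : R := Num.sqrt (\sum_i side K i ^+ 2).

(* The set of cells is finite and nonempty: these are max and min. *)
Definition mesh_size : R := sup (range diam).
Definition min_diam : R := inf (range diam).
Definition max_ratio : R := sup (range (fun K => diam K ^+ 2 / vol K)).

(* s = K|L with K = lower s and L = upper s. *)
Definition lower s : cell := s.2.
Definition upper s : cell := neighbor true s.1 s.2.

Definition faces K : {set face} := [set s | (lower s == K) || (upper s == K)].

(* For s in faces K: the cell across s, and e^(i) . nu_{s,K}. *)
Definition across s K : cell := if lower s == K then upper s else lower s.
Definition normal s K : R := if lower s == K then 1 else -1.

Definition area s : R := \prod_(j | j != s.1) side s.2 j.
Definition dual_vol s : R := (vol (lower s) + vol (upper s)) / 2.

(* Half-open representatives of the closed cells and dual cells, which they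
   equal up to null sets. *)
Definition cell_set K : set 'rV[R]_d :=
  [set x | forall j, lo K j <= x ord0 j < hi K j].

Lemma lebesgue_cell_set K : lebesgue_rV d (cell_set K) = (vol K)%:E.
Proof. by apply: lebesgue_rV_box => i; apply/ltW/node_lt/ltn_ord. Qed.

Definition half_cell up i K : set 'rV[R]_d :=
  let mid := (lo K i + hi K i) / 2 in
  cell_set K `&` [set x | if up then mid <= x ord0 i else x ord0 i < mid].

Definition dual_set s : set 'rV[R]_d :=
  half_cell true s.1 (lower s) `|` half_cell false s.1 (upper s).

Definition dif (q : cell -> R) s : R :=
  area s / dual_vol s * (q (upper s) - q (lower s)) * normal s (lower s).

Definition pos (x : R) : R := Num.max x 0.
Definition neg (x : R) : R := Num.min x 0.

Definition mass_flux (rho : cell -> R) (u : face -> R) s K : R :=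
  let usK := u s * normal s K in
  area s * (rho K * pos usK + rho (across s K) * neg usK).

Definition dual_density (rho : cell -> R) s : R :=
  (vol (lower s) * rho (lower s) / 2 + vol (upper s) * rho (upper s) / 2)
  / dual_vol s.

(* The face of K orthogonal to e_j, on the upper or lower side. *)
Definition face_of up j K : face := (j, if up then K else neighbor false j K).

(* The faces of the dual cell of s = K|L are indexed by a direction j and a
   side up; the dual cell beyond such a face is that of the face (i, K') with
   K' the neighbor of K. *)
Definition dual_neighbor s j up : face := (s.1, neighbor up j s.2).

Definition dual_flux (rho : cell -> R) (u : face -> R) s j up : R :=
  if j == s.1 then
    let C := if up then upper s else lower s in
    (mass_flux rho u (face_of up j C) C - mass_flux rho u s C) / 2
  else
    (mass_flux rho u (face_of up j (lower s)) (lower s)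
     + mass_flux rho u (face_of up j (upper s)) (upper s)) / 2.

Definition upwind (rho : cell -> R) (u : face -> R) s j up : R :=
  if 0 <= dual_flux rho u s j up then u s else u (dual_neighbor s j up).

(* F_{s,K}(q, v) with q = rho theta and v = u - du, for the split signs of v. *)
Definition temp_flux (q : cell -> R) (u du : face -> R) s K : R :=
  let usK := u s * normal s K in
  let dusK := du s * normal s K in
  area s * (q K * (pos usK - neg dusK) + q (across s K) * (neg usK - pos dusK)).

Record state := State {
  rho_ : cell -> R ; u_ : face -> R ; theta_ : cell -> R }.

Definition rhotheta (w : state) K : R := rho_ w K * theta_ w K.
Definition pressure (gamma : R) (w : state) K : R := rhotheta w K `^ gamma.

Definition initial_state (rho0 : 'rV[R]_d -> R) (u0 : 'I_d -> 'rV[R]_d -> R)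
    (theta0 : 'rV[R]_d -> R) : state :=
  State
    (fun K => (vol K)^-1 * \int[lebesgue_rV d]_(x in cell_set K) rho0 x)
    (fun s => (dual_vol s)^-1
              * \int[lebesgue_rV d]_(x in dual_set s) u0 s.1 x)
    (fun K => (vol K)^-1 * \int[lebesgue_rV d]_(x in cell_set K) theta0 x).

(* One step of the scheme, from w = (.)^n to w' = (.)^{n+1}. *)
Definition scheme_step (gamma eps eta dt : R) (w w' : state) : Prop :=
  let p := pressure gamma w' in
  let du := fun s => eta * dt / eps ^+ 2 * dif p s in
  [/\ forall K,
        dt^-1 * (rho_ w' K - rho_ w K)
        + (vol K)^-1 * \sum_(s in faces K) mass_flux (rho_ w) (u_ w) s K = 0,
      forall s,
        dt^-1 * (dual_density (rho_ w') s * u_ w' s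
                 - dual_density (rho_ w) s * u_ w s)
        + (dual_vol s)^-1 * (\sum_(j : 'I_d) \sum_(up : bool)
            dual_flux (rho_ w) (u_ w) s j up * upwind (rho_ w) (u_ w) s j up)
        + (eps ^+ 2)^-1 * dif p s = 0
    & forall K,
        dt^-1 * (rhotheta w' K - rhotheta w K)
        + (vol K)^-1 * \sum_(s in faces K)
            temp_flux (rhotheta w') (u_ w) du s K = 0].

Definition discrete_solution (gamma eps eta dt : R) (N : nat)
    (rho0 : 'rV[R]_d -> R) (u0 : 'I_d -> 'rV[R]_d -> R) (theta0 : 'rV[R]_d -> R)
    (w : nat -> state) : Prop :=
  w 0%N = initial_state rho0 u0 theta0 /\
  forall n, (n < N)%N -> scheme_step gamma eps eta dt (w n) (w n.+1).

(* The function equal to q n k on [n dt, (n+1) dt) x A k. *)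
Definition piecewise (I : finType) (A : I -> set 'rV[R]_d) (dt : R) (N : nat)
    (q : nat -> I -> R) (z : R * 'rV[R]_d) : R :=
  \sum_(n < N) \sum_k
    q n k * \1_(`[n%:R * dt, n.+1%:R * dt[%classic `*` A k) z.

Definition rho_fun dt N (w : nat -> state) :=
  piecewise cell_set dt N (fun n => rho_ (w n)).

Definition theta_fun dt N (w : nat -> state) :=
  piecewise cell_set dt N (fun n => theta_ (w n)).

Definition u_fun i dt N (w : nat -> state) :=
  piecewise (fun K => dual_set (i, K)) dt N (fun n K => u_ (w n) (i, K)).

End grid.

(* Main.v *)
(* The three discrete equations are conservation laws on the (dual) cells.
   Summed against the values of a smooth test function at the cell corners, by
   parts in space and time, they become sums of flux * side * derivative, up to
   an error O(dt + h).  These sums converge because upwinding only changes the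
   sampling point: replacing the velocity, or its sign, by a Lipschitz function
   that is L^1-close to it makes all the other factors either converge weakly or
   be evaluated at neighboring points.

   On a non-uniform mesh the shift of a cell average to the next cell leaves the
   terms F_(K|L) (side L - side K).  They vanish by the scheme itself, tested
   with side K times a Lipschitz function: this function is O(h), and the jumps
   of side are the only part of its differences that is not O(h^2).  The
   stabilisation term is eta dt / eps^2 times a jump of the pressure, and
   pressure jumps vanish in L^1 by strong convergence.

   The bounds (i) hold for the limits almost everywhere, so the limits may be
   replaced by their truncations, which are bounded everywhere. *)
Require Import Defs.
From HB Require Import structures.
From mathcomp Require Import all_boot all_order all_algebra.
From mathcomp Require Import all_classical all_reals all_analysis.
From mathcomp Require Import measurable_realfun ess_sup_inf ring lra.
Set Implicit Arguments. Unset Strict Implicit. Unset Printing Implicit Defensive.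
Import Order.TTheory GRing.Theory Num.Theory.
Import numFieldNormedType.Exports.
Local Open Scope classical_set_scope.
Local Open Scope ring_scope.

(** * Bounded measurable functions *)

(** Lipschitz functions serve as the test class for two reasons. Sampling one at the cell corners
    costs [L * (dt + k * h)] uniformly, and, being bounded on the slab, they form an algebra, which
    reduces their density in L^1 to approximating indicators of half spaces. The convergence of the
    velocities is recorded as convergence of their L^1 distances to each Lipschitz function. An
    approximation of the limit can then be fixed before the mesh is refined, and the remaining error
    is that of this approximation. This replaces estimates on translates of the discrete functions.
    The cell quantities inside the fluxes only enter weakly. In dimension one the mesh conditions do
    not compare adjacent sides. Error terms are therefore weighted by [vol K + vol (nb i K)], whose
    sum over all cells and steps is twice the measure of the cylinder. With a second direction,
    cells adjacent along [e_j] share a transverse side, and the bound on [diam ^ 2 / vol] makes them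
    comparable. This is used where an upwind velocity belongs to the next row of dual cells. *)

Section bounded_measurable.
Context {disp : measure_display} {X : measurableType disp} {R : realType}.
Variable mu : {measure set X -> \bar R}.
Variable D : set X.
Hypothesis mD : measurable D.
Hypothesis muD : (mu D < +oo)%E.
Implicit Types f g : X -> R.

(** Boundedness is asked at every point of [D], not almost everywhere. As [D] has finite measure,
    these functions form an algebra of integrable functions, and no integrability condition has to
    be carried along. *)
Definition bm f := measurable_fun D f /\ exists M, forall x, D x -> `|f x| <= M.

Definition tot : R := fine (mu D).

Lemma bm_meas f : bm f -> measurable_fun D f. Proof. by case. Qed.

Lemma bm_bound f : bm f -> exists2 M, 0 <= M & forall x, D x -> `|f x| <= M.
Proof.
case=> _ [M hM]; exists `|M| => // x Dx.
exact: le_trans (hM x Dx) (ler_norm M).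
Qed.

Lemma bm_cst c : bm (fun=> c).
Proof. by split; [exact: measurable_cst|exists `|c|]. Qed.

Lemma bmD f g : bm f -> bm g -> bm (fun x => f x + g x).
Proof.
move=> [mf [M hM]] [mg [M' hM']]; split; first exact: measurable_funD.
exists (M + M') => x Dx.
by rewrite (le_trans (ler_normD _ _))// lerD ?hM ?hM'.
Qed.

Lemma bmM f g : bm f -> bm g -> bm (fun x => f x * g x).
Proof.
move=> bf bg; have [M M0 hM] := bm_bound bf; have [M' M0' hM'] := bm_bound bg.
split; first by apply: measurable_funM; exact: bm_meas.
by exists (M * M') => x Dx; rewrite normrM ler_pM ?hM ?hM'.
Qed.

Lemma bmZ c f : bm f -> bm (fun x => c * f x).
Proof. by move=> bf; apply: bmM => //; exact: bm_cst. Qed.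

Lemma bmN f : bm f -> bm (fun x => - f x).
Proof.
move=> bf; have := bmZ (-1) bf; congr bm; apply/funext => x.
by rewrite mulN1r.
Qed.

Lemma bmB f g : bm f -> bm g -> bm (fun x => f x - g x).
Proof. by move=> bf bg; exact: bmD bf (bmN bg). Qed.

Lemma bm_norm f : bm f -> bm (fun x => `|f x|).
Proof.
move=> [mf [M hM]]; split; first exact: measurableT_comp.
by exists M => x Dx; rewrite normr_id hM.
Qed.

Lemma bm_sum (I : Type) (r : seq I) (P : pred I) (F : I -> X -> R) :
  (forall i, bm (F i)) -> bm (fun x => \sum_(i <- r | P i) F i x).
Proof.
move=> bF; elim: r => [|i r IH].
  by under eq_fun do rewrite big_nil; exact: bm_cst.
under eq_fun do rewrite big_cons.
by case: (P i) => //; exact: bmD.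
Qed.

Lemma bm_indic A : measurable A -> bm (\1_A).
Proof.
move=> mA; split; first exact: measurable_indic.
by exists 1 => x _; rewrite indicE; case: (_ \in _); rewrite ?normr1 ?normr0.
Qed.

Lemma bm_powR f (r : R) : 0 <= r -> (forall x, D x -> 0 <= f x) -> bm f ->
  bm (fun x => f x `^ r).
Proof.
move=> r0 f0 bf; have [M M0 hM] := bm_bound bf; split.
  by apply: (measurableT_comp (measurable_powR r)); exact: bm_meas.
exists (M `^ r) => x Dx; rewrite ger0_norm ?powR_ge0//; apply: ge0_ler_powR => //.
- by rewrite nnegrE f0.
- by rewrite -(ger0_norm (f0 x Dx)) hM.
Qed.

Lemma bm_int f : bm f -> mu.-integrable D (EFin \o f).
Proof.
move=> bf; have [M M0 hM] := bm_bound bf.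
apply: measurable_bounded_integrable => //; first exact: bm_meas.
exists M; split; first exact: num_real.
by move=> y My x Dx /=; rewrite (le_trans (hM x Dx))// ltW.
Qed.

Local Notation I f := (Rintegral mu D f).

Lemma intD f g : bm f -> bm g -> I (fun x => f x + g x) = I f + I g.
Proof. by move=> bf bg; apply: RintegralD => //; exact: bm_int. Qed.

Lemma intB f g : bm f -> bm g -> I (fun x => f x - g x) = I f - I g.
Proof. by move=> bf bg; apply: RintegralB => //; exact: bm_int. Qed.

Lemma intZ c f : bm f -> I (fun x => c * f x) = c * I f.
Proof. by move=> bf; apply: RintegralZl => //; exact: bm_int. Qed.

Lemma int_sum (J : Type) (r : seq J) (P : pred J) (F : J -> X -> R) :
  (forall i, bm (F i)) ->
  I (fun x => \sum_(i <- r | P i) F i x) = \sum_(i <- r | P i) I (F i).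
Proof.
move=> bF; elim: r => [|i r IH].
  under eq_fun do rewrite big_nil.
  by rewrite big_nil Rintegral_cst// mul0r.
under eq_fun do rewrite big_cons.
rewrite big_cons; case: (P i) => //.
by rewrite intD ?IH//; exact: bm_sum.
Qed.

Lemma int_le f g : bm f -> bm g -> (forall x, D x -> f x <= g x) -> I f <= I g.
Proof. by move=> bf bg fg; apply: le_Rintegral => //; exact: bm_int. Qed.

Lemma int_norm f : bm f -> `|I f| <= I (fun x => `|f x|).
Proof. by move=> bf; apply: le_normr_Rintegral => //; exact: bm_int. Qed.

Lemma int_le_cst f c : bm f -> (forall x, D x -> f x <= c) -> I f <= c * tot.
Proof.
move=> bf hf; rewrite -Rintegral_cst//.
by apply: int_le => //; exact: bm_cst.
Qed.

Lemma int_dist f g : bm f -> bm g ->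
  `|I f - I g| <= I (fun x => `|f x - g x|).
Proof. by move=> bf bg; rewrite -intB//; apply: int_norm; exact: bmB. Qed.

Lemma int_L1_triangle f g h : bm f -> bm g -> bm h ->
  I (fun x => `|f x - h x|) <= I (fun x => `|f x - g x|) + I (fun x => `|g x - h x|).
Proof.
move=> bf bg bh; have fg := bm_norm (bmB bf bg); have gh := bm_norm (bmB bg bh).
rewrite -intD//; apply: int_le; [exact/bm_norm/bmB|exact: bmD|].
by move=> x _; rewrite ler_distD.
Qed.

Import HBSimple.

(** * Density in L^1 of an algebra of bounded functions *)

Section density.
Variable L : set (X -> R).
Hypothesis L_bm : forall f, L f -> bm f.
Hypothesis L_cst : forall c, L (fun=> c).
Hypothesis L_D : forall f g, L f -> L g -> L (fun x => f x + g x).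
Hypothesis L_M : forall f g, L f -> L g -> L (fun x => f x * g x).

Definition approximable f :=
  forall e, 0 < e -> exists2 c, L c & I (fun x => `|f x - c x|) <= e.

Lemma approximable_cst c : approximable (fun=> c).
Proof.
move=> e e0; exists (fun=> c) => //.
under eq_fun do rewrite subrr normr0.
by rewrite Rintegral_cst// mul0r ltW.
Qed.

Lemma approximableD f g : bm f -> bm g -> approximable f -> approximable g ->
  approximable (fun x => f x + g x).
Proof.
move=> bf bg af ag e e0.
have [c Lc hc] := af (e / 2) ltac:(by rewrite divr_gt0).
have [c' Lc' hc'] := ag (e / 2) ltac:(by rewrite divr_gt0).
exists (fun x => c x + c' x); first exact: L_D.
have bc := L_bm Lc; have bc' := L_bm Lc'.
have b1 := bm_norm (bmB bf bc); have b2 := bm_norm (bmB bg bc').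
apply: (@le_trans _ _ (I (fun x => `|f x - c x| + `|g x - c' x|))).
  apply: int_le; [by apply/bm_norm/bmB; exact: bmD|exact: bmD|] => x _.
  by rewrite opprD addrACA ler_normD.
by rewrite intD// [e]splitr lerD.
Qed.

Lemma approximableM f g : bm f -> bm g -> approximable f -> approximable g ->
  approximable (fun x => f x * g x).
Proof.
move=> bf bg af ag e e0.
have [Mg Mg0 hMg] := bm_bound bg.
have [c Lc hc] := af (e / 2 / (Mg + 1)) ltac:(rewrite !divr_gt0//; lra).
have bc := L_bm Lc; have [Mc Mc0 hMc] := bm_bound bc.
(* The tolerance for [g] depends on the bound [Mc] of [c], so [f] has to be approximated first. The
   added 1 keeps the divisors positive. *)
have [c' Lc' hc'] := ag (e / 2 / (Mc + 1)) ltac:(rewrite !divr_gt0//; lra).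
have bc' := L_bm Lc'.
exists (fun x => c x * c' x); first exact: L_M.
have b1 := bm_norm (bmB bf bc); have b2 := bm_norm (bmB bg bc').
apply: (@le_trans _ _ (I (fun x => (Mg + 1) * `|f x - c x| + (Mc + 1) * `|g x - c' x|))).
  apply: int_le; [by apply/bm_norm/bmB; exact: bmM|by apply: bmD; exact: bmZ|].
  move=> x Dx.
  have -> : f x * g x - c x * c' x = g x * (f x - c x) + c x * (g x - c' x) by ring.
  rewrite (le_trans (ler_normD _ _))// !normrM lerD// ler_wpM2r//.
    by rewrite (le_trans (hMg x Dx))// lerDl.
  by rewrite (le_trans (hMc x Dx))// lerDl.
rewrite intD ?intZ//; [|exact: bmZ|exact: bmZ].
rewrite [e]splitr lerD//.
  by rewrite mulrC -ler_pdivlMr//; lra.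
by rewrite mulrC -ler_pdivlMr//; lra.
Qed.

Lemma approximable_lim f : bm f ->
  (forall e, 0 < e -> exists g, [/\ bm g, approximable g &
     I (fun x => `|f x - g x|) <= e]) -> approximable f.
Proof.
move=> bf hf e e0.
have [g [bg ag fg]] := hf (e / 2) ltac:(by rewrite divr_gt0).
have [c Lc hc] := ag (e / 2) ltac:(by rewrite divr_gt0).
exists c => //; rewrite (le_trans (int_L1_triangle bf bg (L_bm Lc)))//.
by rewrite [e]splitr lerD.
Qed.

Lemma approximable_sum (J : Type) (r : seq J) (F : J -> X -> R) :
  (forall i, bm (F i)) -> (forall i, approximable (F i)) ->
  approximable (fun x => \sum_(i <- r) F i x).
Proof.
move=> bF aF; elim: r => [|i r IH].
  by under eq_fun do rewrite big_nil; exact: approximable_cst.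
under eq_fun do rewrite big_cons.
by apply: approximableD => //; exact: bm_sum.
Qed.

(** Indicators turn intersections into products and complements into [1 - \1_A]. Since [L] is an
    algebra, these sets form a sigma-algebra, and density has to be checked on generators only. *)
Definition approximable_set A := measurable A /\ approximable (\1_A).

Lemma approximable_setI A B :
  approximable_set A -> approximable_set B -> approximable_set (A `&` B).
Proof.
move=> [mA aA] [mB aB]; split; first exact: measurableI.
rewrite indicI; apply: approximableM => //; exact: bm_indic.
Qed.

Lemma approximable_setC A : approximable_set A -> approximable_set (~` A).
Proof.
move=> [mA aA]; split; first exact: measurableC.
rewrite (_ : \1_(~` A) = (fun x => 1 + -1 * \1_A x)); last first.
  by apply/funext => x; rewrite !indicE in_setC; case: (_ \in _) => /=; ring.
apply: (approximableD (bm_cst 1) (bmZ (-1) (bm_indic mA)) (approximable_cst 1)).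
exact: approximableM (bm_cst _) (bm_indic mA) (approximable_cst _) aA.
Qed.

Lemma int_indic_diff A B : measurable A -> measurable B -> B `<=` A ->
  I (fun x => `|\1_A x - \1_B x|) = fine (mu (D `&` A)) - fine (mu (D `&` B)).
Proof.
move=> mA mB BA.
have fin C : measurable C -> mu (D `&` C) \is a fin_num.
  move=> mC; rewrite ge0_fin_numE//; apply: le_lt_trans muD.
  by apply: le_measure; rewrite ?inE//; exact: measurableI.
have intind C : measurable C -> I (\1_C) = fine (mu (D `&` C)).
  by move=> mC; rewrite /Rintegral integral_indic// setIC.
rewrite -!intind// -intB; [|exact: bm_indic|exact: bm_indic].
congr (Rintegral mu D _); apply/funext => x.
rewrite ger0_norm// subr_ge0 !indicE.
case: (boolP (x \in B)) => // xB; rewrite mem_set//; apply: BA; exact: set_mem.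
Qed.

(** Finite unions are complements of finite intersections. The countable union follows by continuity
    of the measure from below; as [mu D] is finite, the L^1 distance of nested indicators is a
    difference of two measures. *)
Lemma approximable_set_bigcup (F : nat -> set X) :
  (forall n, approximable_set (F n)) -> approximable_set (\bigcup_n F n).
Proof.
move=> aF; pose G n := \bigcup_(k in `I_n) F k.
have mF n : measurable (F n) by case: (aF n).
have mG n : measurable (G n) by apply: bigcup_measurable => k _.
have mU : measurable (\bigcup_n F n) by exact: bigcupT_measurable.
have aG n : approximable_set (G n).
  elim: n => [|n IH].
    rewrite /G II0 bigcup_set0; split; first exact: measurable0.
    by rewrite indic0; exact: approximable_cst.
  rewrite (_ : G n.+1 = ~` (~` G n `&` ~` F n)).
    by apply/approximable_setC/approximable_setI; exact: approximable_setC.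
  by rewrite setCI !setCK /G IIS bigcup_setU bigcup_set1.
have UG : \bigcup_n F n = \bigcup_n G n.
  apply/seteqP; split => x [n _ Fx].
    by exists n.+1 => //; exists n => //=.
  by case: Fx => k _ Fk; exists k.
have ndG : nondecreasing_seq (fun n => D `&` G n).
  move=> n m nm; apply/subsetPset => x [Dx [k /= kn Fx]]; split => //.
  by exists k => //=; exact: leq_trans nm.
have mDG n : measurable (D `&` G n) by exact: measurableI.
have cv : mu (D `&` G n) @[n --> \oo] --> mu (D `&` \bigcup_n F n).
  rewrite UG setI_bigcupr; apply: nondecreasing_cvg_mu => //.
  by apply: bigcupT_measurable.
have fin C : measurable C -> mu (D `&` C) \is a fin_num.
  move=> mC; rewrite ge0_fin_numE//; apply: le_lt_trans muD.
  by apply: le_measure; rewrite ?inE//; exact: measurableI.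
split => //; apply: approximable_lim; first exact: bm_indic.
move=> e e0.
have /fine_cvg/cvgrPdist_le/(_ e e0)[n _ hn] :
    mu (D `&` G n) @[n --> \oo] --> (fine (mu (D `&` \bigcup_n F n)))%:E.
  by rewrite fineK ?fin.
exists (\1_(G n)); split; [exact: bm_indic|by case: (aG n)|].
rewrite int_indic_diff//; last by rewrite UG => x Gx; exists n.
by apply: le_trans (hn n (leqnn n)); rewrite ler_norm.
Qed.

Lemma approximable_sigma_algebra : sigma_algebra setT approximable_set.
Proof.
split.
- split; first exact: measurable0.
  by rewrite indic0; exact: approximable_cst.
- by move=> A aA; rewrite setTD; exact: approximable_setC.
- exact: approximable_set_bigcup.
Qed.

(** Simple functions are dense in L^1 and are finite sums of multiples of indicators. *)
Theorem approximable_bm : (forall A, measurable A -> approximable_set A) ->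
  forall f, bm f -> approximable f.
Proof.
move=> aA f bf; apply: approximable_lim => // e e0.
have [g [ig _ gf]] := approximation_sfun_integrable mD (bm_int bf).
have bg n : bm (g n).
  split; first exact: measurable_funTS.
  have [M [_ hM]] : bounded_fun (g n) by exact: simple_bounded.
  by exists (M + 1) => x _; apply: hM => //; rewrite ltrDl.
have /fine_cvg/cvgrPdist_le/(_ e e0)[n _ hn] :
    (\int[mu]_(z in D) `|(EFin \o f) z - (g n z)%:E|)%E @[n --> \oo] --> (0 : R)%:E.
  exact: gf.
exists (g n); split => //.
  have E := fimfunEord (g n); rewrite /= in E; rewrite (funext E).
  have mA y : measurable (g n @^-1` [set y]) by exact: measurable_sfunP.
  apply: approximable_sum => i; first exact/bmZ/bm_indic.
  set y := nth _ _ _; have [_ apA] := aA _ (mA y).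
  exact: (approximableM (bm_cst y) (bm_indic (mA y)) (approximable_cst y) apA).
have := hn n (leqnn n); rewrite /= sub0r normrN; apply: le_trans.
by rewrite /Rintegral ler_norm.
Qed.

End density.
End bounded_measurable.

(** * MAC grids *)

Section grid_facts.
Context {R : realType} {d : nat} {a b : 'I_d -> R} (g : mac_grid a b).
Implicit Types (K : cell g) (i j : 'I_d) (up : bool) (s : face g).

Lemma ncell_gt0 i : (0 < ncell g i)%N.
Proof. exact: ltn_trans (ncell_gt1 g i). Qed.

Lemma neighborK up i : cancel (@neighbor _ _ _ _ g up i) (neighbor (~~ up) i).
Proof.
move=> K; apply/ffunP => j; rewrite !ffunE; case: eqP => // _.
by case: up; rewrite /= ?ordSK ?ord_predK.
Qed.

Lemma neighborC up up' i j K :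
  neighbor up i (neighbor up' j K) = neighbor up' j (neighbor up i K).
Proof.
apply/ffunP => l; rewrite !ffunE.
case: eqP => // li; case: eqP => // lj.
by case: up; case: up'; rewrite /= ?ordSK ?ord_predK.
Qed.

(** With at least two cells per direction the cyclic successor moves every index: the last index
    goes to 0, which is not the last. *)
Lemma neighbor_neq up i K : neighbor up i K != K.
Proof.
have tneq (L : cell g) : neighbor true i L != L.
  apply/eqP => /ffunP/(_ i); rewrite ffunE eqxx => /(congr1 (@nat_of_ord _)) /= E.
  have := ltn_ord (L i); rewrite leq_eqVlt => /orP[/eqP LN|LN].
    by move: E; rewrite LN modnn => E; have := ncell_gt1 g i; rewrite -LN -E.
  by move: E; rewrite modn_small// => /eqP; rewrite -[X in _ == X]addn0 -addn1 eqn_add2l.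
case: up => //; apply/eqP => E; have := tneq (neighbor false i K).
by rewrite (neighborK false) eq_sym E eqxx.
Qed.

Lemma sum_neighbor up i (f : cell g -> R) :
  \sum_K f (neighbor up i K) = \sum_K f K.
Proof.
rewrite [RHS](reindex_inj (can_inj (neighborK up i))).
by apply: eq_bigr.
Qed.

Lemma side_gt0 K i : 0 < side K i.
Proof. by rewrite subr_gt0 node_lt. Qed.

Lemma side_ge0 K i : 0 <= side K i. Proof. exact/ltW/side_gt0. Qed.

Lemma vol_gt0 K : 0 < vol K.
Proof. by apply: prodr_gt0 => i _; exact: side_gt0. Qed.

Lemma vol_ge0 K : 0 <= vol K. Proof. exact/ltW/vol_gt0. Qed.

Lemma area_gt0 s : 0 < area s.
Proof. by apply: prodr_gt0 => i _; exact: side_gt0. Qed.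

Lemma area_ge0 s : 0 <= area s. Proof. exact/ltW/area_gt0. Qed.

Lemma dual_vol_gt0 s : 0 < dual_vol s.
Proof. by rewrite divr_gt0// addr_gt0// vol_gt0. Qed.

Lemma dual_vol_ge0 s : 0 <= dual_vol s. Proof. exact/ltW/dual_vol_gt0. Qed.

Lemma dual_volE i K : dual_vol (i, K) = (vol K + vol (neighbor true i K)) / 2.
Proof. by []. Qed.

Lemma side_neighbor up i j K : j != i -> side (neighbor up i K) j = side K j.
Proof. by move=> /negPf ji; rewrite /side /hi /lo !ffunE ji. Qed.

Lemma vol_area i K : vol K = area (i, K) * side K i.
Proof. by rewrite /vol /area (bigD1 i)//= mulrC. Qed.

Lemma area_neighbor up i K : area (i, neighbor up i K) = area (i, K).
Proof. by apply: eq_bigr => j ji; rewrite side_neighbor. Qed.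

Lemma area_side_neighbor up i K :
  area (i, K) * side (neighbor up i K) i = vol (neighbor up i K).
Proof. by rewrite (vol_area i) area_neighbor. Qed.

Lemma lower_neq_upper s : (lower s == upper s) = false.
Proof. by apply/negbTE; rewrite eq_sym neighbor_neq. Qed.

(** In each direction a cell has its own upper face and that of its lower neighbor. They are never
    counted twice, because the two cells of a face differ. *)
Lemma sum_faces K (f : face g -> R) :
  \sum_(s in faces K) f s = \sum_i (f (i, K) + f (i, neighbor false i K)).
Proof.
transitivity (\sum_(s | lower s == K) f s + \sum_(s | upper s == K) f s).
  rewrite big_mkcond [in RHS]big_mkcond/= [X in _ = _ + X]big_mkcond/= -big_split/=.
  apply: eq_bigr => s _; rewrite inE.
  case: (eqVneq (lower s) K) => [sK|_] /=; last by rewrite add0r.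
  by rewrite ifF ?addr0// -sK eq_sym lower_neq_upper.
rewrite big_split/=; congr (_ + _).
- rewrite (reindex_onto (fun i => (i, K)) (fun s => s.1)) /=; last first.
    by move=> [i L] /eqP/= ->.
  by apply: eq_bigl => i; rewrite /lower/= !eqxx.
- rewrite (reindex_onto (fun i => (i, neighbor false i K)) (fun s => s.1)) /=; last first.
    by move=> [i L]; rewrite /upper/= => /eqP <-; rewrite (neighborK true).
  by apply: eq_bigl => i; rewrite /upper/= (neighborK false) !eqxx.
Qed.

Lemma normal_lower s : normal s (lower s) = 1.
Proof. by rewrite /normal eqxx. Qed.

Lemma normal_upper s : normal s (upper s) = -1.
Proof. by rewrite /normal lower_neq_upper. Qed.

Lemma across_lower s : across s (lower s) = upper s.
Proof. by rewrite /across eqxx. Qed.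

Lemma across_upper s : across s (upper s) = lower s.
Proof. by rewrite /across lower_neq_upper. Qed.

Lemma posN (x : R) : pos (- x) = - neg x.
Proof. by rewrite /pos /neg oppr_min oppr0. Qed.

Lemma negN (x : R) : neg (- x) = - pos x.
Proof. by rewrite -[x in RHS]opprK posN opprK. Qed.

(** The flux through the upper face of [K], oriented along [+e_i]. With one orientation for all
    faces, the sum over the faces of a cell becomes a difference between [K] and its lower neighbor,
    ready for summation by parts. *)
Definition upflux (rho : cell g -> R) (u : face g -> R) i K : R :=
  area (i, K) * (rho K * pos (u (i, K)) + rho (neighbor true i K) * neg (u (i, K))).

Lemma mass_flux_lower rho u i K : mass_flux rho u (i, K) K = upflux rho u i K.
Proof.
by rewrite /mass_flux -{2 3 5 7}[K]/(lower (i, K)) normal_lower across_lower mulr1.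
Qed.

Lemma mass_flux_upper rho u i K :
  mass_flux rho u (i, K) (neighbor true i K) = - upflux rho u i K.
Proof.
rewrite /mass_flux -[neighbor true i K]/(upper (i, K)) normal_upper across_upper.
by rewrite mulrN1 posN negN /upflux /upper/lower/=; ring.
Qed.

Definition tempflux (q : cell g -> R) (u du : face g -> R) i K : R :=
  area (i, K) * (q K * (pos (u (i, K)) - neg (du (i, K)))
                 + q (neighbor true i K) * (neg (u (i, K)) - pos (du (i, K)))).

Lemma temp_flux_lower q u du i K : temp_flux q u du (i, K) K = tempflux q u du i K.
Proof.
by rewrite /temp_flux -{2 3 4 6 7 8}[K]/(lower (i, K)) normal_lower across_lower !mulr1.
Qed.

Lemma temp_flux_upper q u du i K :
  temp_flux q u du (i, K) (neighbor true i K) = - tempflux q u du i K.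
Proof.
rewrite /temp_flux -[neighbor true i K]/(upper (i, K)) normal_upper across_upper.
by rewrite !mulrN1 !posN !negN /tempflux /upper/lower/=; ring.
Qed.

(** The common shape of the three equations after multiplication by [dt] and by the primal or dual
    volume. Summation by parts and consistency are proved once for this shape. *)
Definition conserved (dt : R) (V : cell g -> R) (q q' : cell g -> R)
    (G : 'I_d -> cell g -> R) :=
  forall K, V K * (q' K - q K)
    + dt * \sum_j (G j K - G j (neighbor false j K)) = 0.

(** The flux along [+e_j] from the dual cell of [(i, K)] to that of [(i, neighbor true j K)]. For
    [j = i] it is the mean over the two faces of the upper cell orthogonal to [e_i]; otherwise it is
    the sum over two half faces. *)
Definition dualflux (rho : cell g -> R) (u : face g -> R) i j K : R :=
  (if j == i then upflux rho u i K + upflux rho u i (neighbor true i K)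
   else upflux rho u j K + upflux rho u j (neighbor true i K)) / 2.

Lemma dual_flux_up rho u i j K :
  dual_flux rho u (i, K) j true = dualflux rho u i j K.
Proof.
rewrite /dual_flux /dualflux /=; case: eqP => [->|_]; last first.
  by rewrite /face_of /upper /lower /= !mass_flux_lower.
by rewrite /face_of /upper /= mass_flux_lower mass_flux_upper opprK addrC.
Qed.

Lemma dual_flux_down rho u i j K :
  dual_flux rho u (i, K) j false = - dualflux rho u i j (neighbor false j K).
Proof.
rewrite /dual_flux /dualflux /=; case: eqP => [->|_].
  rewrite /face_of /lower /=.
  have := mass_flux_upper rho u i (neighbor false i K).
  by rewrite (neighborK false) /= mass_flux_lower => ->; field.
rewrite /face_of /upper /lower /=.
have := mass_flux_upper rho u j (neighbor false j K).
rewrite (neighborK false) => ->.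
have := mass_flux_upper rho u j (neighbor false j (neighbor true i K)).
by rewrite (neighborK false) => ->; rewrite (neighborC true false); field.
Qed.

Definition upval (rho : cell g -> R) (u : face g -> R) i j K : R :=
  if 0 <= dualflux rho u i j K then u (i, K) else u (i, neighbor true j K).

Lemma upwind_up rho u i j K : upwind rho u (i, K) j true = upval rho u i j K.
Proof. by rewrite /upwind /upval dual_flux_up. Qed.

(** At zero flux the two adjacent dual cells select different upwind values. The products still
    agree, since the flux factor vanishes. *)
Lemma upwind_flux_down rho u i j K :
  dual_flux rho u (i, K) j false * upwind rho u (i, K) j false =
  - (dualflux rho u i j (neighbor false j K) * upval rho u i j (neighbor false j K)).
Proof.
rewrite /upwind /upval dual_flux_down /dual_neighbor /= (neighborK false).
rewrite oppr_ge0; move: (dualflux _ _ _ _ _) => D.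
by case: (ltgtP 0 D) => [D0|D0|<-]; rewrite mulNr// !mul0r.
Qed.

(** The pressure gradient is put in divergence form: the dual face beyond [(i, K)] along [e_i] lies
    inside the upper cell and carries the pressure of that cell. As [area] is constant along [e_i],
    the difference of these terms is [dual_vol] times the discrete gradient. *)
Definition momflux (gamma eps : R) (w w' : state g) i j K : R :=
  dualflux (rho_ w) (u_ w) i j K * upval (rho_ w) (u_ w) i j K
  + (if j == i then (eps ^+ 2)^-1 * area (i, K) * pressure gamma w' (neighbor true i K)
     else 0).

Lemma scheme_conserved (gamma eps eta dt : R) (w w' : state g) : dt != 0 ->
  scheme_step gamma eps eta dt w w' ->
  [/\ conserved dt (@vol _ _ _ _ g) (rho_ w) (rho_ w') (upflux (rho_ w) (u_ w)),
     forall i, conserved dt (fun K => dual_vol (i, K))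
       (fun K => dual_density (rho_ w) (i, K) * u_ w (i, K))
       (fun K => dual_density (rho_ w') (i, K) * u_ w' (i, K))
       (momflux gamma eps w w' i)
   & conserved dt (@vol _ _ _ _ g) (rhotheta w) (rhotheta w')
       (tempflux (rhotheta w') (u_ w)
         (fun s => eta * dt / eps ^+ 2 * dif (pressure gamma w') s))].
Proof.
move=> dt0 [hm hu ht]; split.
- move=> K; have := hm K; rewrite sum_faces.
  under eq_bigr => i _.
    have := mass_flux_upper (rho_ w) (u_ w) i (neighbor false i K).
    rewrite (neighborK false) => ->; rewrite mass_flux_lower; over.
  move=> /(congr1 (fun x => dt * vol K * x)); rewrite mulr0 => H; apply: etrans H.
  by field; rewrite dt0 gt_eqF ?vol_gt0.
- move=> i K; have := hu (i, K).
  under eq_bigr do rewrite big_bool/= upwind_flux_down upwind_up dual_flux_up.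
  move=> /(congr1 (fun x => dt * dual_vol (i, K) * x)); rewrite mulr0.
  have -> : \sum_j (momflux gamma eps w w' i j K
      - momflux gamma eps w w' i j (neighbor false j K)) =
    \sum_j (dualflux (rho_ w) (u_ w) i j K * upval (rho_ w) (u_ w) i j K -
      dualflux (rho_ w) (u_ w) i j (neighbor false j K) *
      upval (rho_ w) (u_ w) i j (neighbor false j K))
    + (eps ^+ 2)^-1 * area (i, K) * (pressure gamma w' (neighbor true i K)
       - pressure gamma w' K).
    rewrite (bigD1 i)//= [in RHS](bigD1 i)//= /momflux eqxx.
    rewrite (neighborK false) (area_neighbor false).
    rewrite [X in _ + X = _](eq_bigr (fun j =>
      dualflux (rho_ w) (u_ w) i j K * upval (rho_ w) (u_ w) i j K -
      dualflux (rho_ w) (u_ w) i j (neighbor false j K) *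
      upval (rho_ w) (u_ w) i j (neighbor false j K))); first by ring.
    by move=> j /negPf ->; rewrite !addr0.
  have v0 : dual_vol (i, K) != 0 by rewrite gt_eqF// dual_vol_gt0.
  have -> : dif (pressure gamma w') (i, K) = area (i, K) / dual_vol (i, K)
      * (pressure gamma w' (neighbor true i K) - pressure gamma w' K).
    by rewrite /dif normal_lower mulr1.
  move=> H; apply: etrans H; set S := \sum_j _; set e := (eps ^+ 2)^-1.
  by field; rewrite dt0 v0.
- move=> K; have := ht K; rewrite sum_faces.
  set du := fun s => _.
  under eq_bigr => i _.
    have := temp_flux_upper (rhotheta w') (u_ w) du i (neighbor false i K).
    rewrite (neighborK false) => ->; rewrite temp_flux_lower; over.
  move=> /(congr1 (fun x => dt * vol K * x)); rewrite mulr0 => H; apply: etrans H.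
  by field; rewrite dt0 gt_eqF ?vol_gt0.
Qed.

End grid_facts.

(** * Sizes of cells; cells and dual cells as partitions of the box *)

Section mesh_facts.
Context {R : realType} {d : nat} {a b : 'I_d -> R} (g : mac_grid a b).
Implicit Types (K : cell g) (i j : 'I_d) (up : bool).

Lemma node_le i k l : (k <= l <= ncell g i)%N -> node g i k <= node g i l.
Proof.
elim: l => [|l IH]; first by rewrite leqn0 => /andP[/eqP ->].
rewrite leq_eqVlt ltnS => /andP[/orP[/eqP -> //|kl] ln].
by rewrite (le_trans (IH _))// ?kl ?(ltnW ln)// ltW// node_lt.
Qed.

Lemma lo_ge K i : a i <= lo K i.
Proof. by rewrite -(node_first g i) node_le//= ltnW. Qed.

Lemma hi_le K i : hi K i <= b i.
Proof. by rewrite -(node_last g i) node_le//= ltn_ord leqnn. Qed.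

Lemma lo_lt_hi K i : lo K i < hi K i.
Proof. exact: node_lt. Qed.

Lemma side_le_box K i : side K i <= b i - a i.
Proof. by rewrite lerB ?hi_le ?lo_ge. Qed.

Lemma side_le_diam K i : side K i <= diam K.
Proof.
rewrite -[leLHS]ger0_norm ?side_ge0// -sqrtr_sqr ler_wsqrtr//.
by rewrite (bigD1 i)//= lerDl sumr_ge0// => j _; rewrite sqr_ge0.
Qed.

Lemma has_ubound_cell (f : cell g -> R) : has_ubound (range f).
Proof.
exists (\sum_K `|f K|) => _ [K _ <-].
by rewrite (le_trans (ler_norm _))// (bigD1 K)//= lerDl sumr_ge0.
Qed.

Lemma diam_le_mesh K : diam K <= mesh_size g.
Proof. by apply: ub_le_sup; [exact: has_ubound_cell|exists K]. Qed.

Lemma diam_ge0 K : 0 <= diam K. Proof. exact: sqrtr_ge0. Qed.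

Lemma side_le_mesh K i : side K i <= mesh_size g.
Proof. exact: le_trans (side_le_diam K i) (diam_le_mesh K). Qed.

Definition cell0 : cell g := [ffun i => Ordinal (ncell_gt0 g i)].

Lemma mesh_ge0 : 0 <= mesh_size g.
Proof. exact: le_trans (diam_ge0 cell0) (diam_le_mesh cell0). Qed.

Lemma min_diam_le K : min_diam g <= diam K.
Proof.
by apply: ge_inf; [exists 0 => _ [L _ <-]; exact: diam_ge0|exists K].
Qed.

Lemma diam_gt0 i K : 0 < diam K.
Proof. exact: lt_le_trans (side_gt0 K i) (side_le_diam K i). Qed.

Lemma min_diam_gt0 i : 0 < min_diam g.
Proof.
have [K _ hK] := @Order.TotalTheory.arg_minP _ _ _ cell0 xpredT (@diam _ _ _ _ g) isT.
apply: lt_le_trans (diam_gt0 i K) _.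
by apply: lb_le_inf; [exists (diam K); exists K|move=> _ [L _ <-]; exact: hK].
Qed.

(* With [B] the base of the power, [vol K <= side K i * diam K * B ^+ d] if
   [2 <= d], so that [diam K ^+ 2 <= mu * vol K] bounds [diam K / side K i];
   the maximum with 1 covers [d = 1]. *)
Definition aspect (mu : R) : R := Num.max 1 (mu * (1 + \sum_i (b i - a i)) ^+ d).

Lemma aspect_ge1 mu : 1 <= aspect mu. Proof. by rewrite le_max lexx. Qed.

Lemma aspect_ge0 mu : 0 <= aspect mu.
Proof. exact: le_trans ler01 (aspect_ge1 mu). Qed.

Lemma diam_le_side mu K i : max_ratio g <= mu -> diam K <= aspect mu * side K i.
Proof.
move=> hmu; have [/existsP[j ij]|all_i] := boolP [exists j, j != i]; last first.
  have E : diam K = side K i.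
    rewrite /diam (bigD1 i)//= big1 => [|j ji]; last first.
      by move: all_i; rewrite negb_exists => /forallP/(_ j); rewrite ji.
    by rewrite addr0 sqrtr_sqr ger0_norm// side_ge0.
  by rewrite E ler_peMl ?side_ge0// aspect_ge1.
have d0 := diam_gt0 i K.
set B := 1 + \sum_i (b i - a i).
have sB l : side K l <= B.
  rewrite /B (bigD1 l)//= addrCA (le_trans (side_le_box K l))// lerDl addr_ge0//.
  by apply: sumr_ge0 => k _; apply: le_trans (side_le_box K k); exact: side_ge0.
have B1 : 1 <= B.
  rewrite lerDl sumr_ge0// => k _.
  by apply: le_trans (side_le_box K k); exact: side_ge0.
have hr : diam K ^+ 2 / vol K <= mu.
  by apply: le_trans hmu; apply: ub_le_sup; [exact: has_ubound_cell|exists K].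
have mu0 : 0 <= mu.
  by apply: le_trans hr; rewrite divr_ge0 ?sqr_ge0 ?vol_ge0.
rewrite ler_pdivrMr ?vol_gt0// in hr.
have hv : vol K <= side K i * (diam K * B ^+ d).
  rewrite /vol (bigD1 i)//= ler_wpM2l ?side_ge0//.
  rewrite (bigD1 j)//= ler_pM ?side_ge0 ?side_le_diam//.
    by apply: prodr_ge0 => l _; exact: side_ge0.
  apply: (@le_trans _ _ (\prod_(l | (l != i) && (l != j)) B)).
    by apply: ler_prod => l _; rewrite side_ge0 sB.
  (* At most [d] factors remain, and since [1 <= B] the exponent may be raised to [d]. *)
  rewrite prodr_const ler_weXn2l//.
  by rewrite (leq_trans (max_card _))// card_ord.
have : diam K * diam K <= diam K * (mu * B ^+ d * side K i).
  rewrite -expr2 (le_trans hr)// (le_trans (ler_wpM2l mu0 hv))//.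
  by rewrite le_eqVlt; apply/orP; left; apply/eqP; ring.
rewrite ler_pM2l// => /le_trans; apply.
by rewrite ler_wpM2r ?side_ge0// le_max lexx orbT.
Qed.

(** The two cells share their side in the direction [i], which differs from [j]. The aspect bound
    compares this common side with the diameter of either cell, once for each factor [aspect mu]. *)
Lemma side_neighbor_le mu up i j K : max_ratio g <= mu -> i != j ->
  side K j <= aspect mu ^+ 2 * side (neighbor up j K) j.
Proof.
move=> hmu ij; rewrite (le_trans (side_le_diam K j))//.
rewrite (le_trans (diam_le_side K i hmu))// expr2 -mulrA ler_wpM2l ?aspect_ge0//.
rewrite -(@side_neighbor _ _ _ _ _ up j i)//.
exact: le_trans (side_le_diam _ _) (diam_le_side _ _ hmu).
Qed.

Lemma vol_neighbor_le mu up i j K : max_ratio g <= mu -> i != j ->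
  vol K <= aspect mu ^+ 2 * vol (neighbor up j K).
Proof.
move=> hmu ij; rewrite !(vol_area j) area_neighbor mulrCA ler_wpM2l ?area_ge0//.
exact: side_neighbor_le ij.
Qed.

Lemma cell_of (x : 'rV[R]_d) : Omega a b x -> exists K : cell g, cell_set K x.
Proof.
move=> Ox; have H i : exists k : 'I_(ncell g i), node g i k <= x ord0 i < node g i k.+1.
  have /andP[xa xb] := Ox i.
  rewrite -(node_first g i) -(node_last g i) in xa xb.
  suff H n : (n <= ncell g i)%N -> x ord0 i < node g i n ->
      exists k : 'I_(ncell g i), node g i k <= x ord0 i < node g i k.+1.
    exact: H (leqnn _) xb.
  elim: n => [|n IH] ln xn; first by have := le_lt_trans xa xn; rewrite ltxx.
  have [xn'|nx] := ltP (x ord0 i) (node g i n); first exact: IH (ltnW ln) xn'.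
  by exists (Ordinal ln) => /=; rewrite nx xn.
exists [ffun i => xchoose (H i)] => i; rewrite /lo /hi ffunE; exact: xchooseP (H i).
Qed.

Lemma cell_set_inj K L x : cell_set K x -> cell_set L x -> K = L.
Proof.
move=> Kx Lx; apply/ffunP => i; apply/val_inj => /=.
have /andP[k1 k2] := Kx i; have /andP[l1 l2] := Lx i.
apply/eqP; rewrite eqn_leq; apply/andP; split; rewrite leqNgt; apply/negP => lt.
- have : hi L i <= lo K i by rewrite node_le// lt ltnW.
  by move=> /le_trans/(_ k1)/(lt_le_trans l2); rewrite ltxx.
- have : hi K i <= lo L i by rewrite node_le// lt ltnW.
  by move=> /le_trans/(_ l1)/(lt_le_trans k2); rewrite ltxx.
Qed.

Lemma cell_set_Omega K : cell_set K `<=` Omega a b.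
Proof.
move=> x Kx i; have /andP[k1 k2] := Kx i.
by rewrite (le_trans (lo_ge K i) k1) (lt_le_trans k2 (hi_le K i)).
Qed.

Lemma dual_set_Omega i K : dual_set (i, K) `<=` Omega a b.
Proof. by move=> x [[] /cell_set_Omega|[] /cell_set_Omega]. Qed.

Lemma dual_of i (x : 'rV[R]_d) : Omega a b x -> exists K : cell g, dual_set (i, K) x.
Proof.
move=> /cell_of[K Kx].
have [xm|mx] := ltP (x ord0 i) ((lo K i + hi K i) / 2).
  exists (neighbor false i K); right; rewrite /upper/= (neighborK false).
  by split.
by exists K; left; split.
Qed.

Lemma dual_set_inj i K L x : dual_set (i, K) x -> dual_set (i, L) x -> K = L.
Proof.
case=> [[/= Kx hK]|[/= Kx hK]] [[/= Lx hL]|[/= Lx hL]].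
- exact: cell_set_inj Kx Lx.
- have E := cell_set_inj Kx Lx; rewrite /lower /upper /= in E hK hL Kx Lx.
  by rewrite E in hK; have := lt_le_trans hL hK; rewrite ltxx.
- have E := cell_set_inj Kx Lx; rewrite /lower /upper /= in E hK hL Kx Lx.
  by rewrite E in hK; have := lt_le_trans hK hL; rewrite ltxx.
- exact: (can_inj (neighborK true i)) (cell_set_inj Kx Lx).
Qed.

End mesh_facts.

(** * Sampling on the space-time cylinder *)

Section boxes.
Context {R : realType} {d : nat}.
Implicit Types (l h : 'I_d -> R).

Lemma measurable_box l h :
  measurable [set x : 'rV[R]_d | forall i, l i <= x ord0 i < h i].
Proof.
rewrite (_ : [set _ | _] = \bigcap_(i in [set: 'I_d])
    (@rV_coord _ R d i @^-1` `[l i, h i[%classic)).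
  apply: fin_bigcap_measurable => // i _.
  rewrite -[X in measurable X]setTI.
  by apply: measurable_rV_coord => //; exact: measurable_itv.
apply/seteqP; split => x /= H i; first by move=> _ /=; rewrite in_itv/=; exact: H.
by have /= := H i Logic.I; rewrite in_itv.
Qed.

End boxes.

Section space_time.
Context {R : realType} {d : nat} (T : R) (a b : 'I_d -> R).
Hypotheses (T0 : 0 < T) (hab : forall i, a i < b i).

Local Notation Z := (R * 'rV[R]_d)%type.
Definition muQ : {measure set (measurableTypeR R * 'rV[R]_d)%type -> \bar R} :=
  ((@lebesgue_measure R) \x lebesgue_rV d)%E.
Local Notation Q := (@Qset R d T a b).

Lemma measurable_Omega : measurable (Omega a b). Proof. exact: measurable_box. Qed.

(* The library's measure on [R] lives on [measurableTypeR R], whose display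
   differs from the default one of [R]. *)
Lemma measurable_Q : @measurable _ (measurableTypeR R * 'rV[R]_d)%type Q.
Proof. by apply: measurableX; [exact: measurable_itv|exact: measurable_Omega]. Qed.

Lemma lebesgue_Omega : lebesgue_rV d (Omega a b) = (\prod_i (b i - a i))%:E.
Proof. by apply: lebesgue_rV_box => i; exact/ltW. Qed.

Lemma lebesgue_Omega_fin : (lebesgue_rV d (Omega a b) < +oo)%E.
Proof. by rewrite lebesgue_Omega ltry. Qed.

Lemma muQ_Q : muQ Q = (T * \prod_i (b i - a i))%:E.
Proof.
transitivity ((lebesgue_measure \x lebesgue_rV d)%E (`]0, T[%classic `*` Omega a b)) => //.
rewrite product_measure1E//; last exact: measurable_Omega.
rewrite lebesgue_Omega [X in (X * _)%E](lebesgue_measure_itv `]0, T[)/= lte_fin T0.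
by rewrite oppr0 adde0 EFinM.
Qed.

Lemma muQ_fin : (muQ Q < +oo)%E. Proof. by rewrite muQ_Q ltry. Qed.

Definition slab (z : Z) := 0 <= z.1 <= T /\ forall i, a i <= z.2 ord0 i <= b i.

Definition dist (z z' : Z) : R :=
  `|z.1 - z'.1| + \sum_i `|z.2 ord0 i - z'.2 ord0 i|.

(* Periodicity is only needed to go from the last cell of a row to the first
   one, whose corner lies on the face [x_i = a_i]. *)
Definition plip (L : R) (c : Z -> R) :=
  (forall z z', slab z -> slab z' -> `|c z - c z'| <= L * dist z z') /\
  (forall i t x, slab (t, x) -> x ord0 i = a i ->
     c (t, x + (b i - a i) *: e_ i) = c (t, x)).

Definition lip (c : Z -> R) := exists2 L, 0 <= L & plip L c.

Lemma Q_slab z : Q z -> slab z.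
Proof.
case: z => t x [/=]; rewrite in_itv/= => /andP[t0 tT] Ox; split => /=.
  by rewrite !ltW.
by move=> i; have /andP[-> /ltW ->] := Ox i.
Qed.

Lemma slab0 : slab (0, \row_i a i).
Proof.
split => /=; first by rewrite lexx ltW.
by move=> i; rewrite mxE lexx ltW.
Qed.

Lemma lip_bounded c : lip c -> exists2 M, 0 <= M & forall z, slab z -> `|c z| <= M.
Proof.
move=> [L L0 [hL _]].
exists (`|c (0, \row_i a i)| + L * (T + \sum_i (b i - a i))).
  rewrite addr_ge0// mulr_ge0// addr_ge0//; first exact: ltW.
  by apply: sumr_ge0 => i _; rewrite subr_ge0 ltW.
move=> z sz; have -> : c z = c (0, \row_i a i) + (c z - c (0, \row_i a i)) by rewrite addrC subrK.
rewrite (le_trans (ler_normD _ _))// lerD2l (le_trans (hL _ _ sz slab0))//.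
rewrite ler_wpM2l// lerD//=.
  by case: sz => /andP[z0 zT] _; rewrite subr0 ger0_norm.
apply: ler_sum => i _; rewrite mxE; case: sz => _ /(_ i)/andP[h1 h2].
by rewrite ger0_norm ?subr_ge0// lerB.
Qed.

Lemma lip_cst c : lip (fun=> c).
Proof. by exists 0 => //; split => // z z' _ _; rewrite subrr normr0 mul0r. Qed.

Lemma lipD c c' : lip c -> lip c' -> lip (fun z => c z + c' z).
Proof.
move=> [L L0 [hL pc]] [L' L0' [hL' pc']]; exists (L + L'); first exact: addr_ge0.
split=> [z z' sz sz'|i t x sx xa]; last by rewrite pc// pc'.
by rewrite opprD addrACA (le_trans (ler_normD _ _))// mulrDl lerD ?hL ?hL'.
Qed.

Lemma lipM c c' : lip c -> lip c' -> lip (fun z => c z * c' z).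
Proof.
move=> Lc Lc'; have [M M0 hM] := lip_bounded Lc; have [M' M0' hM'] := lip_bounded Lc'.
case: Lc Lc' => [L L0 [hL pc]] [L' L0' [hL' pc']].
exists (L * M' + M * L'); first by rewrite addr_ge0// mulr_ge0.
split=> [z z' sz sz'|i t x sx xa]; last by rewrite pc// pc'.
have -> : c z * c' z - c z' * c' z' = (c z - c z') * c' z + c z' * (c' z - c' z').
  by ring.
rewrite (le_trans (ler_normD _ _))// !normrM [leRHS]mulrDl lerD//.
  by rewrite mulrAC ler_pM ?hL ?hM'.
by rewrite -mulrA ler_pM ?hM ?hL'.
Qed.

Lemma lipZ k c : lip c -> lip (fun z => k * c z).
Proof. by move=> Lc; apply: lipM => //; exact: lip_cst. Qed.

Lemma lipN c : lip c -> lip (fun z => - c z).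
Proof.
move=> Lc; have := lipZ (-1) Lc; congr lip.
by apply/funext => z; rewrite mulN1r.
Qed.

Lemma lipB c c' : lip c -> lip c' -> lip (fun z => c z - c' z).
Proof. by move=> Lc Lc'; apply: lipD => //; exact: lipN. Qed.

End space_time.

Section sampling.
Context {R : realType} {d : nat} {T : R} {a b : 'I_d -> R}.
Hypotheses (T0 : 0 < T) (hab : forall i, a i < b i).
Variables (g : mac_grid a b) (N : nat) (dt : R).
Hypotheses (N0 : (0 < N)%N) (dtE : dt = T / N%:R).
Implicit Types (K : cell g) (i j : 'I_d).

Local Notation Z := (R * 'rV[R]_d)%type.
Local Notation Q := (@Qset R d T a b).
Local Notation muQ := (@muQ R d).
Local Notation h := (mesh_size g).

Lemma dt_gt0 : 0 < dt. Proof. by rewrite dtE divr_gt0// ltr0n. Qed.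

Lemma dt_ge0 : 0 <= dt. Proof. exact/ltW/dt_gt0. Qed.

Lemma NdtE : N%:R * dt = T.
Proof. by rewrite dtE mulrC divfK// pnatr_eq0 -lt0n. Qed.

Lemma ndt_le n : (n <= N)%N -> n%:R * dt <= T.
Proof. by move=> nN; rewrite -NdtE ler_wpM2r ?dt_ge0// ler_nat. Qed.

Lemma ndt_ge0 n : 0 <= n%:R * dt. Proof. by rewrite mulr_ge0 ?dt_ge0. Qed.

Definition corner K : 'rV[R]_d := \row_i lo K i.

Definition smp (c : Z -> R) (n : nat) K : R := c (n%:R * dt, corner K).

(** The spatial weight is left to the summand, because it is in turn a volume, a dual volume, or a
    flux times a side. *)
Definition Ssum (X : nat -> cell g -> R) : R := dt * \sum_(n < N) \sum_K X n K.

Lemma slab_corner n K : (n <= N)%N -> slab T a b (n%:R * dt, corner K).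
Proof.
move=> nN; split => /=; first by rewrite ndt_ge0 ndt_le.
by move=> i; rewrite mxE lo_ge (le_trans (ltW (lo_lt_hi K i)))// hi_le.
Qed.

Definition right_point K j : 'rV[R]_d := corner K + side K j *: e_ j.

Lemma right_pointE K j i :
  right_point K j ord0 i = if i == j then hi K i else lo K i.
Proof.
rewrite !mxE eqxx/= eq_sym; case: eqP => [->|_].
  by rewrite mulr1 addrC subrK.
by rewrite mulr0 addr0.
Qed.

Lemma slab_right n K j : (n <= N)%N -> slab T a b (n%:R * dt, right_point K j).
Proof.
move=> nN; split => /=; first by rewrite ndt_ge0 ndt_le.
move=> i; rewrite right_pointE; have l := ltW (lo_lt_hi K i).
case: eqP => _; first by rewrite hi_le (le_trans (lo_ge K i)).
by rewrite lo_ge (le_trans l)// hi_le.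
Qed.

Lemma smp_neighbor L c n K j : (n <= N)%N -> plip T a b L c ->
  smp c n (neighbor true j K) = c (n%:R * dt, right_point K j).
Proof.
move=> nN [_ pc]; rewrite /smp.
have := ltn_ord (K j); rewrite leq_eqVlt => /orP[/eqP E|E].
- have loj : lo (neighbor true j K) j = a j.
    by rewrite /lo ffunE eqxx /= E modnn node_first.
  rewrite -(pc j _ _ (slab_corner (neighbor true j K) nN)); last by rewrite mxE.
  congr (c (_, _)); apply/rowP => i; rewrite right_pointE !mxE eqxx/=.
  case: eqP => [->|/eqP ij].
    by rewrite loj mulr1 addrC subrK /hi E node_last.
  by rewrite mulr0 addr0 /lo ffunE (negPf ij).
- congr (c (_, _)); apply/rowP => i; rewrite right_pointE mxE /lo /hi ffunE.
  by case: eqP => [->|//]; rewrite /= modn_small.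
Qed.

Lemma dist_right n K j :
  dist (n%:R * dt, right_point K j) (n%:R * dt, corner K) = side K j.
Proof.
rewrite /dist/= subrr normr0 add0r (bigD1 j)//= big1 => [|i ij].
  by rewrite right_pointE eqxx mxE addr0 ger0_norm// side_ge0.
by rewrite right_pointE (negPf ij) mxE subrr normr0.
Qed.

Lemma smp_neighbor_dist L c n K j : (n <= N)%N -> plip T a b L c ->
  `|smp c n (neighbor true j K) - smp c n K| <= L * side K j.
Proof.
move=> nN pl; rewrite (smp_neighbor K j nN pl) -(dist_right n K j).
by apply: (proj1 pl); [exact: slab_right|exact: slab_corner].
Qed.

Lemma smp_neighbor_le L c n K j : 0 <= L -> (n <= N)%N -> plip T a b L c ->
  `|smp c n (neighbor true j K) - smp c n K| <= L * h.
Proof.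
move=> L0 nN pl; rewrite (le_trans (smp_neighbor_dist K j nN pl))//.
by rewrite ler_wpM2l// side_le_mesh.
Qed.

Lemma smp_time_dist L c n K : (n < N)%N -> plip T a b L c ->
  `|smp c n.+1 K - smp c n K| <= L * dt.
Proof.
move=> nN [hL _].
rewrite (le_trans (hL _ _ (slab_corner K nN) (slab_corner K (ltnW nN))))//.
rewrite /dist/= big1 => [|i _]; last by rewrite subrr normr0.
by rewrite addr0 -mulrBl -natrB// subSnn mul1r ger0_norm// dt_ge0.
Qed.

Lemma smp_bounded c M n K : (forall z, slab T a b z -> `|c z| <= M) ->
  (n <= N)%N -> `|smp c n K| <= M.
Proof. by move=> hM nN; apply/hM/slab_corner. Qed.

Definition time_slot (n : nat) : set R := `[n%:R * dt, n.+1%:R * dt[%classic.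

Lemma slab_cell n K t x : (n < N)%N -> time_slot n t -> cell_set K x ->
  slab T a b (t, x).
Proof.
move=> nN; rewrite /time_slot/= in_itv/= => /andP[t1 t2] Kx; split => /=.
  by rewrite (le_trans (ndt_ge0 n) t1) ltW// (lt_le_trans t2)// ndt_le.
by move=> i; have /andP[-> /ltW ->] := cell_set_Omega Kx i.
Qed.

Lemma smp_cell L c n K t x : 0 <= L -> (n < N)%N -> plip T a b L c ->
  time_slot n t -> cell_set K x ->
  `|c (t, x) - smp c n K| <= L * (dt + d%:R * h).
Proof.
move=> L0 nN [hL _] ts Kx.
rewrite (le_trans (hL _ _ (slab_cell nN ts Kx) (slab_corner K (ltnW nN))))//.
rewrite ler_wpM2l// lerD//=.
  move: ts; rewrite /time_slot/= in_itv/= => /andP[t1 t2].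
  by move: t2; rewrite ger0_norm ?subr_ge0// -natr1 mulrDl mul1r; lra.
have -> : d%:R * h = \sum_(i < d) h by rewrite sumr_const card_ord mulr_natl.
apply: ler_sum => i _; rewrite mxE; have /andP[k1 k2] := Kx i.
rewrite ger0_norm ?subr_ge0// (le_trans _ (side_le_mesh K i))//.
by rewrite lerD2r ltW.
Qed.

Lemma smp_dual L c n i K t x : 0 <= L -> (n < N)%N -> plip T a b L c ->
  time_slot n t -> dual_set (i, K) x ->
  `|c (t, x) - smp c n K| <= L * (dt + d.+1%:R * h).
Proof.
move=> L0 nN pl ts; have h0 := mesh_ge0 g.
case=> -[Kx _]; rewrite /lower /upper /= in Kx.
  rewrite (le_trans (smp_cell L0 nN pl ts Kx))// ler_wpM2l// lerD2l.
  by rewrite ler_wpM2r// ler_nat.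
(* The upper half of the dual cell lies in the neighboring cell. Going back to the corner of [K]
   costs one more [L * h], whence [d.+1]. *)
have -> : c (t, x) - smp c n K = (c (t, x) - smp c n (neighbor true i K)) +
    (smp c n (neighbor true i K) - smp c n K) by rewrite addrA subrK.
rewrite (le_trans (ler_normD _ _))//.
rewrite (le_trans (lerD (smp_cell L0 nN pl ts Kx) (smp_neighbor_le K i L0 (ltnW nN) pl)))//.
by rewrite -mulrDr -addrA -natr1 [(_ + 1) * _]mulrDl mul1r.
Qed.

End sampling.

Section cell_measures.
Context {R : realType} {d : nat} {a b : 'I_d -> R} (g : mac_grid a b).
Implicit Types (K : cell g) (i j : 'I_d).

Lemma half_cell_box up i K :
  measurable (half_cell up i K) /\
  lebesgue_rV d (half_cell up i K) = (vol K / 2)%:E.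
Proof.
pose mid := (lo K i + hi K i) / 2.
pose l j := if (j == i) && up then mid else lo K j.
pose h j := if (j == i) && ~~ up then mid else hi K j.
have lh j : l j <= h j.
  have := lo_lt_hi K j; rewrite /l /h /mid {l h}.
  by case: eqP => [->|_]; case: up => /=; lra.
have E : half_cell up i K = [set x | forall j, l j <= x ord0 j < h j].
  have := lo_lt_hi K i; rewrite /l /h {l h lh} => lhi.
  apply/seteqP; split => x /=.
    case=> Kx hx j; have /andP[k1 k2] := Kx j; move: hx => /=; rewrite -/mid => hx.
    case: eqP => [ji|_] /=; last by rewrite k1 k2.
    by move: k1 k2 hx; rewrite ji; case: up => /= k1 k2 ->; rewrite ?k1 ?k2.
  move=> H; split.
    move=> j; have := H j; case: eqP => [->|_] //=.
    by case: up {H} => /= /andP[H1 H2]; apply/andP; split=> //; move: H1 H2; rewrite /mid; lra.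
  by have := H i; rewrite eqxx /=; case: up {H} => /= /andP[].
split; first by rewrite E; exact: measurable_box.
rewrite E lebesgue_rV_box//; congr EFin.
rewrite (vol_area i) (bigD1 i)//= mulrC -mulrA; congr (_ * _); last first.
  by rewrite /l /h {l h lh E} eqxx /side /mid; case: up => /=; lra.
by apply: eq_bigr => j /negPf ji; rewrite /l /h ji.
Qed.

Lemma dual_set_measure i K :
  measurable (dual_set (i, K)) /\
  lebesgue_rV d (dual_set (i, K)) = (dual_vol (i, K))%:E.
Proof.
have [m1 v1] := half_cell_box true i K.
have [m2 v2] := half_cell_box false i (neighbor true i K).
split; first exact: measurableU.
rewrite /dual_set measureU//=; last first.
  apply/seteqP; split => // x [[/= k1 _] [/= k2 _]].
  have := cell_set_inj k1 k2; rewrite /lower /upper/= => E.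
  by have := neighbor_neq true i K; rewrite -E eqxx.
by rewrite /lower /upper/= v1 v2 -EFinD dual_volE mulrDl.
Qed.

End cell_measures.

Section partition_integrals.
Context {R : realType} {d : nat} {T : R} {a b : 'I_d -> R}.
Hypotheses (T0 : 0 < T) (hab : forall i, a i < b i).
Variables (g : mac_grid a b) (N : nat) (dt : R).
Hypotheses (N0 : (0 < N)%N) (dtE : dt = T / N%:R).

Local Notation Q := (@Qset R d T a b).
Local Notation muQ := (@muQ R d).
Local Notation I f := (Rintegral muQ Q f).
Local Notation S := (@Ssum _ _ _ _ g N dt).
Local Notation bmQ f := (@bm _ (measurableTypeR R * 'rV[R]_d)%type R Q f).

Lemma time_slot_cover t : 0 <= t < T -> exists2 n, (n < N)%N & time_slot dt n t.
Proof.
rewrite -(NdtE N0 dtE) => /andP[t0 tT].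
suff H n : (n <= N)%N -> t < n%:R * dt -> exists2 n, (n < N)%N & time_slot dt n t.
  exact: H (leqnn _) tT.
elim: n => [|n IH] nN tn; first by move: tn; rewrite mul0r ltNge t0.
have [tn'|nt] := ltP t (n%:R * dt); first exact: IH (ltnW nN) tn'.
by exists n => //; rewrite /time_slot/= in_itv/= nt tn.
Qed.

Lemma time_slot_inj n m t : time_slot dt n t -> time_slot dt m t -> n = m.
Proof.
rewrite /time_slot/= !in_itv/= => /andP[n1 n2] /andP[m1 m2].
have dt0 := dt_gt0 T0 N0 dtE.
have := le_lt_trans n1 m2; have := le_lt_trans m1 n2.
rewrite !ltr_pM2r// !ltr_nat !ltnS => mn nm.
by apply/eqP; rewrite eqn_leq mn nm.
Qed.

Variables (A : cell g -> set 'rV[R]_d) (V : cell g -> R).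
Hypothesis A_measure : forall K, measurable (A K) /\ lebesgue_rV d (A K) = (V K)%:E.
Hypothesis A_Omega : forall K, A K `<=` Omega a b.
Hypothesis A_cover : forall x, Omega a b x -> exists K, A K x.
Hypothesis A_inj : forall K L x, A K x -> A L x -> K = L.

Local Notation pw q := (piecewise A dt N q).

Lemma piecewiseE q n K t x : (n < N)%N -> time_slot dt n t -> A K x ->
  pw q (t, x) = q n K.
Proof.
move=> nN ts Kx; rewrite /piecewise (bigD1 (Ordinal nN))//= (bigD1 K)//=.
rewrite indicE mem_set//= mulr1 big1 ?addr0 => [|L LK]; last first.
  rewrite indicE memNset ?mulr0// => -[_ /= Lx].
  by move: LK; rewrite (A_inj Lx Kx) eqxx.
rewrite big1 ?addr0// => m mn; rewrite big1// => L _.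
rewrite indicE memNset ?mulr0// => -[/= tm _].
by move/eqP: mn; apply; apply/val_inj => /=; exact: time_slot_inj tm ts.
Qed.

Lemma Q_slot z : Q z ->
  exists n K, [/\ (n < N)%N, time_slot dt n z.1, A K z.2 &
    forall q, pw q z = q n K].
Proof.
case: z => t x [/=]; rewrite in_itv/= => /andP[t0 tT] Ox.
have [n nN ts] := @time_slot_cover t ltac:(by rewrite ltW).
have [K Kx] := A_cover Ox.
by exists n, K; split => // q; exact: piecewiseE.
Qed.

Let mB n K : @measurable _ (measurableTypeR R * 'rV[R]_d)%type (time_slot dt n `*` A K).
Proof. by apply: measurableX; [exact: measurable_itv|case: (A_measure K)]. Qed.

Lemma bm_piecewise q : bmQ (pw q).
Proof.
apply: bm_sum => n; apply: bm_sum => K; apply: bmZ.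
by apply: bm_indic; exact: mB.
Qed.

Lemma slot_length n : (n < N)%N ->
  lebesgue_measure (`]0, T[%classic `&` time_slot dt n) = dt%:E.
Proof.
move=> nN; have dt0 := dt_gt0 T0 N0 dtE.
have nT : n.+1%:R * dt <= T := ndt_le T0 N0 dtE nN.
have n0 : 0 <= n%:R * dt := ndt_ge0 T0 N0 dtE n.
(* The cylinder is open at [t = 0], so the first slot loses its left end point, a null set. *)
case: n nN nT n0 => [|n] nN nT n0.
- rewrite (_ : _ `&` _ = `]0, dt[%classic).
    by rewrite lebesgue_measure_itv/= lte_fin dt0 oppr0 adde0.
  apply/seteqP; split => t /=; rewrite /time_slot/= !in_itv/= mul0r mul1r in nT *.
    by case=> /andP[-> _] /andP[_ ->].
  by move=> /andP[t0 t1]; rewrite t0 ltW// t1 (lt_le_trans t1 nT).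
- rewrite (_ : _ `&` _ = time_slot dt n.+1).
    rewrite /time_slot lebesgue_measure_itv/= lte_fin ltr_pM2r// ltr_nat ltnSn.
    by rewrite -EFinB -mulrBl -natrB// subSnn mul1r.
  apply/seteqP; split => t /=; first by case.
  rewrite /time_slot/= !in_itv/= => /andP[t1 t2]; rewrite t1 t2.
  rewrite (lt_le_trans t2 nT) (lt_le_trans _ t1)//.
  by rewrite mulr_gt0.
Qed.

Lemma muQ_slot n K : (n < N)%N -> muQ (Q `&` (time_slot dt n `*` A K)) = (dt * V K)%:E.
Proof.
move=> nN; have [mA vA] := A_measure K.
have E : Q `&` (time_slot dt n `*` A K) =
    (`]0, T[%classic `&` time_slot dt n) `*` A K.
  apply/seteqP; split => -[t x] /=; first by case=> -[tT _] [ts Ax].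
  by case=> -[tT ts] Ax; split; split => //; exact: A_Omega Ax.
transitivity ((lebesgue_measure \x lebesgue_rV d)%E
   ((`]0, T[%classic `&` time_slot dt n) `*` A K)); first by rewrite E.
rewrite product_measure1E//; last by apply: measurableI; exact: measurable_itv.
by rewrite [X in (X * _)%E](slot_length nN) vA EFinM.
Qed.

Lemma int_piecewise q : I (pw q) = S (fun n K => V K * q n K).
Proof.
have fQ := muQ_fin T0 hab; have mQ := @measurable_Q R d T a b.
have bB n K : bmQ (fun z => q n K * \1_(time_slot dt n `*` A K) z).
  by apply: bmZ; apply: bm_indic; exact: mB.
rewrite /piecewise (int_sum mQ fQ); last by move=> n; exact: bm_sum.
rewrite /Ssum mulr_sumr; apply: eq_bigr => n _.
rewrite (int_sum mQ fQ); last by move=> K; exact: bB.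
rewrite mulr_sumr; apply: eq_bigr => K _.
rewrite (intZ mQ fQ); last by apply: bm_indic; exact: mB.
rewrite /Rintegral integral_indic//; last exact: mB.
by rewrite setIC [X in fine X](muQ_slot K (ltn_ord n))/=; ring.
Qed.

Lemma Ssum_volume : S (fun _ K => V K) = tot muQ Q.
Proof.
have -> : S (fun _ K => V K) = S (fun n K => V K * 1).
  by congr (_ * _); apply: eq_bigr => n _; apply: eq_bigr => K _; rewrite mulr1.
rewrite -(int_piecewise (fun _ _ => 1)).
rewrite -[RHS]mul1r -(Rintegral_cst muQ (@measurable_Q R d T a b)).
by apply: eq_Rintegral => z /set_mem/Q_slot[n [K [_ _ _ E]]]; exact: E.
Qed.

(** The sum is the integral of a piecewise constant function. Pointwise, the Lipschitz bound of
    [theta] on [J] and on arguments of size [M] splits the error into that of [q], measured in L^1,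
    and the sampling error [e] of [c]. *)
Lemma Ssum_to_int (theta : R -> R -> R) (J : set R) (M C e : R)
    (q : nat -> cell g -> R) (f c : R * 'rV[R]_d -> R) :
  (forall n K t x, (n < N)%N -> time_slot dt n t -> A K x ->
     `|c (t, x) - smp dt c n K| <= e) ->
  (forall z, slab T a b z -> `|c z| <= M) ->
  (forall y y' s s', J y -> J y' -> `|s| <= M -> `|s'| <= M ->
     `|theta y s - theta y' s'| <= C * (`|y - y'| + `|s - s'|)) ->
  0 <= C ->
  (forall n K, (n < N)%N -> J (q n K)) -> (forall z, Q z -> J (f z)) ->
  bmQ f -> bmQ (fun z => theta (f z) (c z)) ->
  `|S (fun n K => V K * theta (q n K) (smp dt c n K)) - I (fun z => theta (f z) (c z))|
    <= C * (I (fun z => `|pw q z - f z|) + e * tot muQ Q).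
Proof.
move=> he hM hth C0 Jq Jf bf bth.
have fQ := muQ_fin T0 hab; have mQ := @measurable_Q R d T a b.
rewrite -(int_piecewise (fun n K => theta (q n K) (smp dt c n K))).
have bp := bm_piecewise (fun n K => theta (q n K) (smp dt c n K)).
have bq := bm_norm (bmB (bm_piecewise q) bf).
have -> : e * tot muQ Q = I (fun=> e) by rewrite Rintegral_cst.
rewrite -(intD mQ fQ bq (bm_cst _ e)).
rewrite -(intZ mQ fQ C (bmD bq (bm_cst _ e))).
rewrite (le_trans (int_dist mQ fQ bp bth))//.
apply: (int_le mQ fQ).
- exact: bm_norm (bmB bp bth).
- exact: bmZ (bmD bq (bm_cst _ e)).
move=> [t x] Qz; have [n [K [nN ts Kx E]]] := Q_slot Qz; rewrite !E.
rewrite (le_trans (hth _ _ _ _ (Jq _ _ nN) (Jf _ Qz) _ _))//.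
- by apply/hM/(slab_corner T0 N0 dtE)/ltnW.
- exact/hM/Q_slab.
- by rewrite ler_wpM2l// lerD2l distrC he.
Qed.

End partition_integrals.

(** * Dominated convergence and the reduction to half lines *)

Section bounded_convergence.
Context {disp : measure_display} {X : measurableType disp} {R : realType}.
Variable mu : {measure set X -> \bar R}.
Variable D : set X.
Hypothesis mD : measurable D.
Hypothesis muD : (mu D < +oo)%E.

Lemma bm_bounded_convergence (f_ : nat -> X -> R) (f : X -> R) (M : R) :
  (forall n, bm D (f_ n)) -> bm D f ->
  (forall n x, D x -> `|f_ n x| <= M) ->
  (forall x, D x -> f_ n x @[n --> \oo] --> f x) ->
  Rintegral mu D (fun x => `|f_ n x - f x|) @[n --> \oo] --> 0.
Proof.
move=> bf_ bf hM cf.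
have [||||//|_ H _] := @dominated_convergence _ X R mu D mD
  (fun n => EFin \o f_ n) (EFin \o f) (EFin \o cst M).
- by move=> n; apply/measurable_EFinP; exact: bm_meas (bf_ n).
- by apply/measurable_EFinP; exact: bm_meas bf.
- by apply: aeW => x Dx; apply: cvg_EFin; [exact: nearW|exact: cf].
- exact: (bm_int mD muD (bm_cst D M)).
- by apply: aeW => x n Dx /=; rewrite lee_fin; exact: hM.
exact: (@fine_cvg _ _ _ _ _ 0 H).
Qed.

Section coordinates.
Variable L : set (X -> R).
Hypothesis L_bm : forall f, L f -> bm D f.
Hypothesis L_cst : forall c, L (fun=> c).
Hypothesis L_D : forall f g, L f -> L g -> L (fun x => f x + g x).
Hypothesis L_M : forall f g, L f -> L g -> L (fun x => f x * g x).

Lemma approximable_pointwise (A : set X) (c : nat -> X -> R) (M : R) :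
  measurable A -> (forall n, L (c n)) ->
  (forall n x, D x -> `|c n x| <= M) ->
  (forall x, D x -> c n x @[n --> \oo] --> (\1_A x : R)) ->
  approximable_set mu D L A.
Proof.
move=> mA Lc hM cA; split => // e e0.
have bA : bm D (\1_A : X -> R) by exact: bm_indic.
have /cvgrPdist_le/(_ e e0)[n _ hn] :=
  bm_bounded_convergence (fun n => L_bm (Lc n)) bA hM cA.
exists (c n) => //; have := hn n (leqnn n); rewrite sub0r normrN.
rewrite ger0_norm; last exact: Rintegral_ge0.
by under eq_fun do rewrite distrC.
Qed.

(** The sets [B] with approximable preimage form a sigma-algebra on the line, and the open half
    lines generate the Borel sets. *)
Lemma approximable_coordinate (c : X -> R) :
  (forall r, approximable_set mu D L [set x | r < c x]) ->
  forall B, measurable B -> approximable_set mu D L (c @^-1` B).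
Proof.
move=> H; have [s0 sC sU] := approximable_sigma_algebra mD muD L_bm L_cst L_D L_M.
have S : sigma_algebra setT [set B | approximable_set mu D L (c @^-1` B)].
  split => /=; first by rewrite preimage_set0.
  - by move=> B hB; rewrite setTD preimage_setC -setTD; exact: sC.
  - by move=> F hF; rewrite preimage_bigcup; exact: sU.
move=> B mB; have {mB} : @measurable _ (measurableTypeR R) B by [].
rewrite RGenOInfty.measurableE; move: B; apply: (smallest_sub S) => _ [r ->] /=.
have := H r; congr (approximable_set _ _ _ _); apply/seteqP.
by split => x /=; rewrite in_itv/= andbT.
Qed.

End coordinates.
End bounded_convergence.

(** * Lipschitz approximations of indicators *)

Section ramp.
Context {R : realType}.
Implicit Types (k : nat) (s t : R).

(** A Lipschitz approximation from below, with constant [k], of the indicator of [0 < s]. *)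
Definition ramp k s : R := Num.min 1 (Num.max 0 (k%:R * s)).

Lemma ramp_ge0 k s : 0 <= ramp k s.
Proof. by rewrite le_min ler01 le_max lexx. Qed.

Lemma ramp_le1 k s : ramp k s <= 1.
Proof. by rewrite ge_min lexx. Qed.

Lemma ramp_npos k s : s <= 0 -> ramp k s = 0.
Proof.
move=> s0; rewrite /ramp max_l ?min_r//.
by rewrite mulr_ge0_le0.
Qed.

Lemma ramp_lip k s t : `|ramp k s - ramp k t| <= k%:R * `|s - t|.
Proof.
rewrite -[X in X * `|_|]ger0_norm// -normrM mulrBr /ramp.
move: (k%:R * s) (k%:R * t) => x y.
rewrite !maxElt; have h := ler_norm (x - y); have h' := ler_norm (- (x - y)).
rewrite normrN in h'.
case: (ltP 0 x) => hx; case: (ltP 0 y) => hy; rewrite !minElt;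
  do 2?[case: ifPn; rewrite -?leNgt => ?]; rewrite ler_norml; lra.
Qed.

Lemma ramp_cvg s : ramp k s @[k --> \oo] --> ((0 < s)%R%:R : R).
Proof.
case: ltP => [s0|s0]; last first.
  by under eq_fun do rewrite ramp_npos//; exact: cvg_cst.
apply: cvg_near_cst; near=> k; rewrite /ramp max_r; last by rewrite mulr_ge0// ltW.
have k1 : s^-1 <= k%:R by near: k; exact: nbhs_infty_ger.
by rewrite min_l// -ler_pdivrMr// div1r.
Unshelve. all: by end_near. Qed.

End ramp.

(** * Limits obtained through approximations *)

Section null_sequences.
Context {R : realType}.
Implicit Types x y z : nat -> R.

Lemma cvg0_le x y : (forall m, `|x m| <= y m) -> y m @[m --> \oo] --> (0 : R) ->
  x m @[m --> \oo] --> (0 : R).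
Proof.
move=> xy y0; apply/cvgrPdist_le => e e0.
have /cvgrPdist_le/(_ e e0) := y0; apply: filterS => m.
rewrite !sub0r !normrN; apply: le_trans.
by rewrite (le_trans (xy m))// ler_norm.
Qed.

Lemma cvg_shift0 x y (l : R) : x m - y m @[m --> \oo] --> (0 : R) -> y m @[m --> \oo] --> l ->
  x m @[m --> \oo] --> l.
Proof.
move=> xy yl.
have -> : x = (fun m => x m - y m + y m) by apply/funext => m; rewrite subrK.
by rewrite -[l]add0r; exact: cvgD.
Qed.

(** For a fixed approximation the comparison sequence [y] only converges to a value near [l], and
    the error bound [z] only to a small limit. Both defects are below [e], which is chosen before
    [m] tends to infinity. *)
Lemma cvg_by_approximation x (l : R) :
  (forall e, 0 < e -> exists y l' z zeta,
     [/\ y m @[m --> \oo] --> l', `|l' - l| <= e, z m @[m --> \oo] --> zeta,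
         zeta <= e & forall m, `|x m - y m| <= z m]) ->
  x m @[m --> \oo] --> l.
Proof.
move=> H; apply/cvgrPdist_le => e e0.
(* Four quarters: [|l' - l|], [|l' - y m|], [zeta], and the distance from [z m] to [zeta]. *)
have e4 : 0 < e / 4 by rewrite divr_gt0.
have [y [l' [z [zeta [yl ll zl ze xy]]]]] := H _ e4.
have /cvgrPdist_le/(_ _ e4) hy := yl.
have /cvgrPdist_le/(_ _ e4) hz := zl.
near=> m.
have h1 : `|l' - y m| <= e / 4 by near: m.
have h2 : `|zeta - z m| <= e / 4 by near: m.
have h3 := xy m.
move: h1 h2 h3 ll; rewrite !ler_norml => /andP[? ?] /andP[? ?] /andP[? ?] /andP[? ?].
by apply/andP; split; lra.
Unshelve. all: by end_near. Qed.

Lemma cvg0Z k x : x m @[m --> \oo] --> (0 : R) -> k * x m @[m --> \oo] --> (0 : R).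
Proof. by move=> x0; rewrite -(mulr0 k); apply: cvgMl_tmp. Qed.

Lemma cvg0D x y : x m @[m --> \oo] --> (0 : R) -> y m @[m --> \oo] --> (0 : R) ->
  x m + y m @[m --> \oo] --> (0 : R).
Proof. by move=> x0 y0; rewrite -(addr0 0); apply: cvgD. Qed.

End null_sequences.

(** * Sums and integrals along a sequence of meshes *)

Section mesh_sequence.
Context {R : realType} {d : nat} {T : R} {a b : 'I_d -> R}.
Hypotheses (T0 : 0 < T) (hab : forall i, a i < b i).
Variables (g : nat -> mac_grid a b) (N : nat -> nat) (dt : nat -> R).
Hypotheses (N0 : forall m, (0 < N m)%N) (dtE : forall m, dt m = T / (N m)%:R).
Hypotheses (dt_cvg : dt m @[m --> \oo] --> 0)
  (h_cvg : mesh_size (g m) @[m --> \oo] --> 0).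

Local Notation Q := (@Qset R d T a b).
Local Notation muQ := (@muQ R d).
Local Notation I f := (Rintegral muQ Q f).
Local Notation S m X := (@Ssum _ _ _ _ (g m) (N m) (dt m) X).
Local Notation bmQ f := (@bm _ (measurableTypeR R * 'rV[R]_d)%type R Q f).
Local Notation lipQ := (lip T a b).
Local Notation fQ := (muQ_fin T0 hab).
Local Notation mQ := (@measurable_Q R d T a b).

Definition mesh_err (k m : nat) : R := dt m + k%:R * mesh_size (g m).

Lemma mesh_err_cvg k : mesh_err k m @[m --> \oo] --> 0.
Proof. by apply: cvg0D => //; exact: cvg0Z. Qed.

Lemma dts_ge0 m : 0 <= dt m. Proof. exact: (dt_ge0 T0 (N0 m) (dtE m)). Qed.

Lemma mesh_err_ge0 k m : 0 <= mesh_err k m.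
Proof. by rewrite addr_ge0 ?dts_ge0// mulr_ge0// mesh_ge0. Qed.

Lemma cell_measure m (K : cell (g m)) :
  measurable (cell_set K) /\ lebesgue_rV d (cell_set K) = (vol K)%:E.
Proof. by split; [exact: measurable_box|exact: lebesgue_cell_set]. Qed.

(** Measurability comes from the meshes themselves: the piecewise constant samples are measurable
    and converge pointwise on the cylinder. *)
Lemma lip_bm c : lipQ c -> bmQ c.
Proof.
move=> Lc; have [M M0 hM] := lip_bounded T0 hab Lc; split; last first.
  by exists M => z Qz; apply/hM/Q_slab.
case: Lc => L L0 pl.
apply: (@measurable_fun_cvg _ _ _ _
  (fun m => piecewise (@cell_set _ _ _ _ (g m)) (dt m) (N m) (smp (dt m) c))).
  by move=> m; exact: bm_meas (bm_piecewise _ _ (@cell_measure m) _).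
move=> z Qz; apply: (@cvg_shift0 _ _ (fun=> c z)); last exact: cvg_cst.
apply: (@cvg0_le _ _ (fun m => L * mesh_err d m)); last exact/cvg0Z/mesh_err_cvg.
move=> m.
have [n [K [nN ts Kx ->]]] := Q_slot T0 (N0 m) (dtE m) (@cell_of _ _ _ _ (g m))
  (@cell_set_inj _ _ _ _ (g m)) Qz.
case: z Qz ts Kx => t x Qz ts Kx; rewrite distrC.
exact: (smp_cell T0 (N0 m) (dtE m) L0 nN pl ts Kx).
Qed.

Section partition_sequence.
Variables (A : forall m, cell (g m) -> set 'rV[R]_d) (V : forall m, cell (g m) -> R).
Hypothesis A_measure : forall m (K : cell (g m)),
  measurable (A K) /\ lebesgue_rV d (A K) = (V K)%:E.
Hypothesis A_Omega : forall m (K : cell (g m)), A K `<=` Omega a b.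
Hypothesis A_cover : forall m x, Omega a b x -> exists K : cell (g m), A K x.
Hypothesis A_inj : forall m (K L : cell (g m)) x, A K x -> A L x -> K = L.
Variable k : nat.
Hypothesis A_near : forall m L c n (K : cell (g m)) t x, 0 <= L -> (n < N m)%N ->
  plip T a b L c -> time_slot (dt m) n t -> A K x ->
  `|c (t, x) - smp (dt m) c n K| <= L * mesh_err k m.

(** It is applied to [theta y s] equal to [y * s], to [|y - s|], and to variants with the positive
    or negative part of [y]. The constant [C M] depends on the bound of [c] because a product is
    only locally Lipschitz. *)
Lemma Ssum_cvg (theta : R -> R -> R) (J : set R) (C : R -> R)
    (q : forall m, nat -> cell (g m) -> R) (f c : R * 'rV[R]_d -> R) :
  (forall M y y' s s', J y -> J y' -> `|s| <= M -> `|s'| <= M ->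
     `|theta y s - theta y' s'| <= C M * (`|y - y'| + `|s - s'|)) ->
  (forall M, 0 <= M -> 0 <= C M) ->
  (forall m n K, (n < N m)%N -> J (q m n K)) -> (forall z, Q z -> J (f z)) ->
  bmQ f -> lipQ c -> bmQ (fun z => theta (f z) (c z)) ->
  I (fun z => `|piecewise (@A m) (dt m) (N m) (q m) z - f z|) @[m --> \oo] --> 0 ->
  S m (fun n K => V K * theta (q m n K) (smp (dt m) c n K)) @[m --> \oo]
    --> I (fun z => theta (f z) (c z)).
Proof.
move=> hth C0 Jq Jf bf Lc bth cv.
have [M M0 hM] := lip_bounded T0 hab Lc; have [L L0 pl] := Lc.
apply: (@cvg_shift0 _ _ (fun=> I (fun z => theta (f z) (c z)))); last exact: cvg_cst.
apply: (@cvg0_le _ _ (fun m => C M * (I (fun z => `|piecewise (@A m) (dt m) (N m) (q m) z - f z|)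
   + L * mesh_err k m * tot muQ Q))).
  move=> m; apply: (Ssum_to_int T0 hab (N0 m) (dtE m) (@A_measure m) (@A_Omega m)
    (@A_cover m) (@A_inj m) (J := J) (M := M)) => //; [|exact: hth|exact: C0|exact: Jq].
  by move=> n K t x nN ts Kx; exact: A_near.
apply/cvg0Z/cvg0D => //.
under eq_fun do rewrite mulrC mulrA.
exact/cvg0Z/mesh_err_cvg.
Qed.

End partition_sequence.

End mesh_sequence.

(** * Density of Lipschitz functions *)

Section generation.
Context {R : realType} {d : nat}.

Lemma measurable_rV_ind (C : set (set 'rV[R]_d)) : sigma_algebra setT C ->
  (forall i (B : set R), measurable B -> C ((@rV_coord _ R d i) @^-1` B)) ->
  forall A, measurable A -> C A.
Proof.
move=> sC H; apply: (smallest_sub sC).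
rewrite -bigcup_seq => A [/= i _ [B mB <-]].
by rewrite setTI; exact: H.
Qed.

Lemma sigma_algebra_preimage (X Y : Type) (f : X -> Y) (C : set (set X)) :
  sigma_algebra setT C -> sigma_algebra setT [set B | C (f @^-1` B)].
Proof.
move=> [s0 sC sU]; split => /=; first by rewrite preimage_set0.
- by move=> B hB; rewrite setTD preimage_setC -setTD; exact: sC.
- by move=> F hF; rewrite preimage_bigcup; exact: sU.
Qed.

Lemma measurable_space_time_ind (C : set (set (R * 'rV[R]_d))) :
  sigma_algebra setT C ->
  (forall B : set R, measurable B -> C (fst @^-1` B)) ->
  (forall i (B : set R), measurable B -> C ((fun z : R * 'rV[R]_d => z.2 ord0 i) @^-1` B)) ->
  forall A, @measurable _ (measurableTypeR R * 'rV[R]_d)%type A -> C A.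
Proof.
move=> sC H1 H2; apply: (smallest_sub sC) => A [[B mB <-]|[B mB <-]].
  by rewrite setTI; exact: H1.
rewrite setTI; apply: (measurable_rV_ind (sigma_algebra_preimage snd sC)) mB.
by move=> i E; exact: H2.
Qed.

End generation.

Section lipschitz_density.
Context {R : realType} {d : nat} {T : R} {a b : 'I_d -> R}.
Hypotheses (T0 : 0 < T) (hab : forall i, a i < b i).
Local Notation Q := (@Qset R d T a b).
Local Notation muQ := (@muQ R d).
Local Notation bmQ f := (@bm _ (measurableTypeR R * 'rV[R]_d)%type R Q f).
Local Notation lipQ := (lip T a b).
Local Notation fQ := (muQ_fin T0 hab).
Local Notation mQ := (@measurable_Q R d T a b).
Local Notation O := (Omega a b).

Hypothesis lip_bm : forall c, lipQ c -> bmQ c.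

Lemma lip_time_ramp k r : lipQ (fun z => ramp k (z.1 - r)).
Proof.
exists k%:R => //; split => // z z' _ _.
rewrite (le_trans (ramp_lip _ _ _))// ler_wpM2l//.
have -> : z.1 - r - (z'.1 - r) = z.1 - z'.1 by ring.
by rewrite /dist lerDl sumr_ge0.
Qed.

Lemma coord_le_dist (z z' : R * 'rV[R]_d) i :
  `|z.2 ord0 i - z'.2 ord0 i| <= dist z z'.
Proof.
rewrite /dist (bigD1 i)//= addrCA lerDl addr_ge0//.
by apply: sumr_ge0.
Qed.

(** The ramp at [r] alone is not periodic. It vanishes on [x_i = a i] because [a i <= r], and the
    second factor makes the product vanish on [x_i = b i] as well; on the half-open box this factor
    tends to 1. *)
Lemma lip_space_ramp k i r : a i <= r ->
  lipQ (fun z => ramp k (z.2 ord0 i - r) * ramp k (b i - z.2 ord0 i)).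
Proof.
move=> ar; exists (k%:R + k%:R) => //; split.
  move=> z z' _ _; set u := ramp _ _; set v := ramp _ _; set u' := ramp _ _; set v' := ramp _ _.
  have -> : u * v - u' * v' = (u - u') * v + u' * (v - v') by ring.
  rewrite (le_trans (ler_normD _ _))// !normrM mulrDl.
  have Hu : `|u - u'| <= k%:R * dist z z'.
    rewrite (le_trans (ramp_lip _ _ _))// ler_wpM2l//.
    have -> : z.2 ord0 i - r - (z'.2 ord0 i - r) = z.2 ord0 i - z'.2 ord0 i by ring.
    exact: coord_le_dist.
  have Hv : `|v - v'| <= k%:R * dist z z'.
    rewrite (le_trans (ramp_lip _ _ _))// ler_wpM2l//.
    have -> : b i - z.2 ord0 i - (b i - z'.2 ord0 i) = - (z.2 ord0 i - z'.2 ord0 i) by ring.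
    by rewrite normrN; exact: coord_le_dist.
  rewrite lerD//.
    by rewrite (le_trans _ Hu)// ler_piMr// ger0_norm ?ramp_ge0// ramp_le1.
  by rewrite (le_trans _ Hv)// ler_piMl// ger0_norm ?ramp_ge0// ramp_le1.
move=> j t x _ xj /=; rewrite !mxE eqxx/=.
move: ar; case: (eqVneq i j) => [->|ij] ar; last by rewrite mulr0 addr0.
rewrite mulr1 xj; have -> : b j - (a j + (b j - a j)) = 0 by ring.
rewrite [ramp k 0]ramp_npos// mulr0 [ramp k (a j - r)]ramp_npos ?mul0r//.
by rewrite subr_le0.
Qed.

Lemma space_ramp_cvg i r (x : 'rV[R]_d) : O x ->
  ramp k (x ord0 i - r) * ramp k (b i - x ord0 i) @[k --> \oo]
    --> ((r < x ord0 i)%R%:R : R).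
Proof.
move=> Ox; have /andP[_ xb] := Ox i.
rewrite -[X in _ --> X]mulr1 -subr_gt0.
apply: cvgM; first exact: ramp_cvg.
by have := @ramp_cvg R (b i - x ord0 i); rewrite subr_gt0 xb.
Qed.

Lemma space_ramp_bound k s t : `|ramp k s * ramp k t| <= (1 : R).
Proof. by rewrite normrM mulr_ile1// ger0_norm ?ramp_ge0// ramp_le1. Qed.

Lemma mcoord i (r : R) : measurable [set x : 'rV[R]_d | r < x ord0 i].
Proof.
rewrite (_ : [set _ | _] = (@rV_coord _ R d i) @^-1` `]r, +oo[%classic).
  rewrite -[X in measurable X]setTI.
  by apply: measurable_rV_coord => //; exact: measurable_itv.
by apply/seteqP; split => x /=; rewrite in_itv/= andbT.
Qed.

Lemma lip_approximable f : bmQ f -> approximable muQ Q lipQ f.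
Proof.
have apT A := approximable_pointwise mQ fQ lip_bm (A := A).
apply: (approximable_bm mQ fQ lip_bm (lip_cst T a b) (@lipD _ _ _ _ _) (lipM T0 hab)) => A.
have sA := approximable_sigma_algebra mQ fQ lip_bm (lip_cst T a b) (@lipD _ _ _ _ _) (lipM T0 hab).
apply: (measurable_space_time_ind sA).
- move=> B; apply: (approximable_coordinate mQ fQ lip_bm (lip_cst T a b) (@lipD _ _ _ _ _) (lipM T0 hab)) => r.
  apply: (apT _ (fun k (z : R * 'rV[R]_d) => ramp k (z.1 - r)) 1).
  + rewrite (_ : [set _ | _] = fst @^-1` `]r, +oo[%classic).
      rewrite -[X in measurable X]setTI.
      by apply: measurable_fst => //; exact: measurable_itv.
    by apply/seteqP; split => x /=; rewrite in_itv/= andbT.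
  + by move=> n; exact: lip_time_ramp.
  + by move=> n z _; rewrite ger0_norm ?ramp_ge0// ramp_le1.
  + move=> z _; have := @ramp_cvg R (z.1 - r); rewrite subr_gt0 indicE.
    by rewrite (_ : (z \in _) = (r < z.1))//; apply/idP/idP; rewrite inE.
- move=> i B; apply: (approximable_coordinate mQ fQ lip_bm (lip_cst T a b) (@lipD _ _ _ _ _) (lipM T0 hab)) => r.
  have mA : @measurable _ (measurableTypeR R * 'rV[R]_d)%type [set z : R * 'rV[R]_d | r < z.2 ord0 i].
    rewrite (_ : [set _ | _] = snd @^-1` [set x : 'rV[R]_d | r < x ord0 i])//.
    rewrite -[X in measurable X]setTI.
    by apply: measurable_snd => //; exact: mcoord.
  have [ar|ra] := leP (a i) r.
    apply: (apT _ (fun k (z : R * 'rV[R]_d) => ramp k (z.2 ord0 i - r) * ramp k (b i - z.2 ord0 i)) 1) => //.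
    + by move=> n; exact: lip_space_ramp.
    + by move=> n z _; exact: space_ramp_bound.
    + move=> z [_ Oz]; rewrite indicE.
      rewrite (_ : (z \in _) = (r < z.2 ord0 i)); first exact: space_ramp_cvg.
      by apply/idP/idP; rewrite inE.
  (* For [r < a i] the half space contains the whole cylinder, where its indicator is the constant
     1. *)
  apply: (apT _ (fun k z => 1) 1) => //.
  + by move=> n; exact: lip_cst.
  + by move=> n z _; rewrite normr1.
  + move=> z [_ Oz]; rewrite indicE mem_set; first exact: cvg_cst.
    by have /andP[az _] := Oz i; exact: lt_le_trans ra az.
Qed.

(** Functions of the space variable are read as functions on the cylinder that are constant in time,
    which transfers the algebra properties of [lip]. *)
Definition lipO : set ('rV[R]_d -> R) := [set c | lipQ (fun z => c z.2)].

Lemma lipO_bm c : lipO c -> bm O c.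
Proof.
move=> Lc; have [mc [M hM]] := lip_bm Lc.
(* Any time inside the open interval would do: the function is restricted to one slice of the
   cylinder. *)
have T2 : 0 < T / 2 < T by apply/andP; split; move: T0; lra.
split; last first.
  by exists M => x Ox; apply: (hM (T / 2, x)); split => //=; rewrite in_itv.
apply: (measurable_comp mQ _ mc (f := fun z : measurableTypeR R * 'rV[R]_d => c z.2)
  (g := fun x => (T / 2, x))).
  by move=> _ [x Ox <-]; split => //=; rewrite in_itv.
by apply: measurable_funTS; exact: pair1_measurable.
Qed.

Lemma lipO_approximable f : bm O f -> approximable (lebesgue_rV d) O lipO f.
Proof.
have mO := @measurable_Omega R d a b.
have fO := lebesgue_Omega_fin hab.
have Oc c : lipO (fun=> c) by exact: lip_cst.
have OD c c' : lipO c -> lipO c' -> lipO (fun x => c x + c' x) by exact: lipD.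
have OM c c' : lipO c -> lipO c' -> lipO (fun x => c x * c' x) by exact: lipM.
have apT A := approximable_pointwise mO fO lipO_bm (A := A).
apply: (approximable_bm mO fO lipO_bm Oc OD OM) => A.
have sA := approximable_sigma_algebra mO fO lipO_bm Oc OD OM.
apply: (measurable_rV_ind sA).
move=> i B; apply: (approximable_coordinate mO fO lipO_bm Oc OD OM) => r.
have [ar|ra] := leP (a i) r.
  apply: (apT _ (fun k (z : 'rV[R]_d) => ramp k (z ord0 i - r) * ramp k (b i - z ord0 i)) 1) => //.
  + exact: mcoord.
  + by move=> n; exact: lip_space_ramp.
  + by move=> n z _; exact: space_ramp_bound.
  + move=> z Oz; rewrite indicE.
    rewrite (_ : (z \in _) = (r < z ord0 i)); first exact: space_ramp_cvg.
    by apply/idP/idP; rewrite inE.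
apply: (apT _ (fun k z => 1) 1) => //.
+ exact: mcoord.
+ by move=> n z _; rewrite normr1.
+ move=> z Oz; rewrite indicE mem_set; first exact: cvg_cst.
  by have /andP[az _] := Oz i; exact: lt_le_trans ra az.
Qed.

End lipschitz_density.

(** * Test functions: Lipschitz bounds and Taylor expansion *)

Section smooth_lipschitz.
Context {R : realType} {d : nat} {T : R} {a b : 'I_d -> R}.
Hypotheses (T0 : 0 < T) (hab : forall i, a i < b i).
Local Notation Z := (R * 'rV[R]_d)%type.
Implicit Types (f phi : Z -> R) (z v : Z).

Definition smooth f := forall k, Ck k f.

Lemma smooth_continuous f : smooth f -> continuous f.
Proof. by move/(_ 0%N) => []. Qed.

Lemma smooth_derivable f v z : smooth f -> derivable f z v.
Proof. by move/(_ 1%N) => [_ /(_ v)[]]. Qed.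

Lemma smooth_derive f v : smooth f -> smooth ('D_v f).
Proof. by move=> sf k; have [_ /(_ v)[]] := sf k.+1. Qed.

Lemma is_derive_line f z v (c : R) : smooth f ->
  is_derive c 1 (fun s : R => f (z + s *: v)) ('D_v f (z + c *: v)).
Proof.
move=> sf; have E : (fun h : R => h^-1 *: (((fun s : R => f (z + s *: v)) \o shift c) (h *: 1)
     - f (z + c *: v))) =
   (fun h => h^-1 *: ((f \o shift (z + c *: v)) (h *: v) - f (z + c *: v))).
  apply/funext => h /=; congr (_ *: (f _ - _)).
  by rewrite [h *: 1]mulr1 scalerDl addrCA.
have df := @smooth_derivable f v (z + c *: v) sf.
by split; rewrite /derivable /derive E.
Qed.

Lemma line_MVT f z v (s : R) : smooth f -> 0 <= s ->
  exists2 c, 0 <= c <= s & f (z + s *: v) - f z = 'D_v f (z + c *: v) * s.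
Proof.
move=> sf s0.
have [|c] := @MVT_segment R (fun s => f (z + s *: v)) (fun s => 'D_v f (z + s *: v)) 0 s s0
  (fun x _ => is_derive_line z v x sf).
  apply: derivable_within_continuous => x _.
  by have [] := is_derive_line z v x sf.
by rewrite in_itv/= scale0r addr0 subr0 => c0s E; exists c.
Qed.

Lemma slab_bounded f : continuous f -> exists2 M, 0 <= M & forall z, slab T a b z -> `|f z| <= M.
Proof.
move=> cf.
have cS : compact (`[0, T]%classic `*` [set x : 'rV[R]_d | forall i, `[a i, b i]%classic (x ord0 i)]).
  apply: compact_setX; first exact: segment_compact.
  by apply: (@rV_compact R d (fun i => `[a i, b i]%classic)) => i; exact: segment_compact.
have := continuous_compact (continuous_subspaceT cf) cS.
move=> /compact_bounded[M [_ hM]]; exists (`|M| + 1); first by rewrite addr_ge0.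
move=> z [z1 z2].
have M1 : M < `|M| + 1 by rewrite (le_lt_trans (ler_norm M))// ltrDl.
by apply: (hM _ M1 (f z)); exists z.
Qed.

Lemma time_shift (t s : R) (x : 'rV[R]_d) : (t, x) + s *: ((1, 0) : Z) = (t + s, x).
Proof. by congr pair; rewrite /= ?[s *: 1]mulr1 ?scaler0 ?addr0. Qed.

Lemma space_shift (t s : R) (x : 'rV[R]_d) i :
  (t, x) + s *: ((0, e_ i) : Z) = (t, x + s *: e_ i).
Proof. by congr pair; rewrite /= scaler0 addr0. Qed.

Lemma shift_coord (x : 'rV[R]_d) (s : R) i j :
  (x + s *: e_ i) ord0 j = if j == i then x ord0 j + s else x ord0 j.
Proof. by rewrite !mxE eqxx/=; case: eqP => _; rewrite ?mulr1// mulr0 addr0. Qed.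

(** The partial derivatives are bounded on the compact slab. Two points are joined by segments
    parallel to the axes, which stay in the slab, and the mean value theorem on each segment yields
    the l^1 distance used in [dist]. *)
Lemma smooth_lip f : smooth f ->
  (forall i t x, f (t, x + (b i - a i) *: e_ i) = f (t, x)) -> lip T a b f.
Proof.
move=> sf pf.
have [M0 M00 hM0] := slab_bounded (smooth_continuous (smooth_derive ((1, 0) : Z) sf)).
have /choice[Mi hMi] i : exists M, 0 <= M /\ forall z, slab T a b z -> `|'D_(0, e_ i) f z| <= M.
  by have [M M1 M2] := slab_bounded (smooth_continuous (smooth_derive ((0, e_ i) : Z) sf)); exists M.
pose L := M0 + \sum_i Mi i.
have Mi0 i : 0 <= Mi i by case: (hMi i).
have L0 : 0 <= L by rewrite addr_ge0// sumr_ge0.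
have LM0 : M0 <= L by rewrite lerDl sumr_ge0.
have LMi i : Mi i <= L.
  by rewrite /L (bigD1 i)//= addrCA lerDl addr_ge0// sumr_ge0.
have htime t t' x : 0 <= t <= t' -> slab T a b (t', x) -> `|f (t', x) - f (t, x)| <= L * `|t' - t|.
  move=> /andP[t0 tt'] [/= /andP[_ t'T] xab].
  have [c /andP[c0 ct]] := @line_MVT f (t, x) (1, 0) (t' - t) sf ltac:(by rewrite subr_ge0).
  rewrite !time_shift [t + (t' - t)]addrC subrK => ->; rewrite normrM ler_wpM2r//.
  apply: le_trans LM0; apply: hM0; split => //=.
  by rewrite addr_ge0//= (le_trans _ t'T)// -lerBrDl.
have hspace t x i s : 0 <= s -> slab T a b (t, x) -> slab T a b (t, x + s *: e_ i) ->
    `|f (t, x + s *: e_ i) - f (t, x)| <= L * s.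
  move=> s0 [/= tT xab] [_ /= yab].
  have [c /andP[c0 cs]] := @line_MVT f (t, x) (0, e_ i) s sf s0.
  rewrite !space_shift => ->; rewrite normrM [`|s|]ger0_norm// ler_wpM2r//.
  apply: le_trans (LMi i); apply: (proj2 (hMi i)); split => //= j.
  have := xab j; have := yab j; rewrite !shift_coord; case: eqP => [->|//].
  move=> /andP[h1 h2] /andP[h3 h4]; apply/andP; split; lra.
have hspace' t x i s : slab T a b (t, x) -> slab T a b (t, x + s *: e_ i) ->
    `|f (t, x + s *: e_ i) - f (t, x)| <= L * `|s|.
  move=> s1 s2; have [s0|/ltW s0] := leP 0 s.
    by rewrite (le_trans (hspace _ _ _ _ s0 s1 s2))// ger0_norm.
  have E : (x + s *: e_ i) + (- s) *: e_ i = x by rewrite -addrA -scalerDl subrr scale0r addr0.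
  rewrite distrC -{1}E [`|s|]ler0_norm//.
  by apply: hspace; rewrite ?E// oppr_ge0.
exists L => //; split; last by move=> i t x _ _; exact: pf.
move=> [t x] [t' x'] [/= tT xab] [/= t'T x'ab].
(* [mix k] takes its first [k] coordinates from [x] and the others from [x'], so passing from [k] to
   [k.+1] moves along one axis. *)
pose mix k : 'rV[R]_d := \row_i if (i < k)%N then x ord0 i else x' ord0 i.
have hmix k : (k <= d)%N ->
    `|f (t, mix k) - f (t, x')| <= L * \sum_(i < d | (i < k)%N) `|x ord0 i - x' ord0 i|.
  elim: k => [|k IH] kd.
    rewrite (_ : mix 0%N = x') ?subrr ?normr0 ?mulr_ge0 ?sumr_ge0//.
    by apply/rowP => i; rewrite mxE.
  have slabmix l : slab T a b (t, mix l).
    by split => //= i; rewrite mxE; case: ifP => _; [exact: xab|exact: x'ab].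
  have E : mix k.+1 = mix k + (x ord0 (Ordinal kd) - x' ord0 (Ordinal kd)) *: e_ (Ordinal kd).
    apply/rowP => i; rewrite shift_coord !mxE ltnS.
    case: eqP => [->|/eqP ik]; first by rewrite leqnn ltnn addrC subrK.
    by rewrite leq_eqVlt (_ : (i == k :> nat) = false)//; apply/negbTE.
  have -> : f (t, mix k.+1) - f (t, x') = (f (t, mix k.+1) - f (t, mix k)) + (f (t, mix k) - f (t, x')).
    by rewrite addrA subrK.
  rewrite (le_trans (ler_normD _ _))// (bigD1 (Ordinal kd))//= mulrDr lerD//.
    by rewrite E; apply: hspace'; rewrite -?E; exact: slabmix.
  rewrite (le_trans (IH (ltnW kd)))// ler_wpM2l// le_eqVlt; apply/orP; left; apply/eqP.
  apply: eq_bigl => i; rewrite ltnS [in RHS]leq_eqVlt -(inj_eq val_inj) /=.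
  by case: (ltngtP i k).
have {hmix} := hmix d (leqnn d).
rewrite (_ : mix d = x); last by apply/rowP => i; rewrite mxE ltn_ord.
rewrite (eq_bigl xpredT) => [hx|i]; last by rewrite ltn_ord.
have -> : f (t, x) - f (t', x') = (f (t, x) - f (t, x')) + (f (t, x') - f (t', x')) by rewrite addrA subrK.
rewrite (le_trans (ler_normD _ _))// /dist/= addrC mulrDr lerD//.
have [tt|tt] := leP t' t.
  by apply: htime => //; case/andP: t'T => ->; rewrite tt.
rewrite distrC [`|t - t'|]distrC; apply: htime => //.
by case/andP: tT => -> _; rewrite ltW.
Qed.

Lemma derive_periodic f v i : 
  (forall t x, f (t, x + (b i - a i) *: e_ i) = f (t, x)) ->
  forall t x, 'D_v f (t, x + (b i - a i) *: e_ i) = 'D_v f (t, x).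
Proof.
move=> pf t x; rewrite /derive.
suff -> : (fun h : R => h^-1 *: ((f \o shift (t, x + (b i - a i) *: e_ i)) (h *: v)
    - f (t, x + (b i - a i) *: e_ i))) =
  (fun h => h^-1 *: ((f \o shift (t, x)) (h *: v) - f (t, x))) by [].
apply/funext => h /=; rewrite pf; congr (_ *: (_ - _)).
case: v => v1 v2; rewrite -[RHS]pf; congr f; congr pair => /=.
by rewrite addrA.
Qed.

Section test_functions.
Variable phi : Z -> R.
Hypothesis tphi : test_function T a b phi.

Let sphi : smooth phi. Proof. by case: tphi. Qed.

Let pphi i t x : phi (t, x + (b i - a i) *: e_ i) = phi (t, x).
Proof. by case: tphi. Qed.

Lemma test_lip : lip T a b phi.
Proof. exact: smooth_lip. Qed.

Lemma test_dt_lip : lip T a b (dt_ phi).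
Proof.
apply: smooth_lip; first exact: smooth_derive.
by move=> i; apply: derive_periodic.
Qed.

Lemma test_dx_lip i : lip T a b (dx_ i phi).
Proof.
apply: smooth_lip; first exact: smooth_derive.
by move=> j; apply: derive_periodic.
Qed.

Lemma test_end x : phi (T, x) = 0.
Proof. by case: tphi => _ _ [T' T'T h]; apply: h; exact: ltW. Qed.

Variables (g : mac_grid a b) (N : nat) (dt : R).
Hypotheses (N0 : (0 < N)%N) (dtE : dt = T / N%:R).
Implicit Types (K : cell g) (i j : 'I_d).

Lemma smp_time_taylor L n K : 0 <= L -> (n < N)%N -> plip T a b L (dt_ phi) ->
  `|smp dt phi n.+1 K - smp dt phi n K - dt * smp dt (dt_ phi) n K| <= L * dt ^+ 2.
Proof.
move=> L0 nN [hL _]; have dt0 := dt_ge0 T0 N0 dtE.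
have [c /andP[c0 cdt]] := @line_MVT phi (n%:R * dt, corner K) (1, 0) dt sphi dt0.
rewrite !time_shift /smp -natr1 mulrDl mul1r => ->.
set A := 'D_(1, 0) phi _; set B := dt_ phi _.
have -> : A * dt - dt * B = dt * (A - B) by ring.
rewrite {}/A {}/B normrM ger0_norm// expr2 mulrCA ler_wpM2l//.
have sl := slab_corner T0 N0 dtE K (ltnW nN).
have sl' : slab T a b (n%:R * dt + c, corner K).
  split => /=; last by case: sl.
  rewrite addr_ge0 ?(ndt_ge0 T0 N0 dtE)//= (le_trans _ (ndt_le T0 N0 dtE nN))//.
  by rewrite -natr1 mulrDl mul1r lerD2l.
rewrite -/(dt_ phi) (le_trans (hL _ _ sl' sl))// ler_wpM2l//.
rewrite /dist/= big1 => [|i _]; last by rewrite subrr normr0.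
by rewrite addr0 addrAC subrr add0r ger0_norm.
Qed.

Lemma smp_space_taylor L n K j : 0 <= L -> (n <= N)%N -> plip T a b L (dx_ j phi) ->
  `|smp dt phi n (neighbor true j K) - smp dt phi n K
    - side K j * smp dt (dx_ j phi) n K| <= L * side K j ^+ 2.
Proof.
move=> L0 nN [hL _]; have s0 := side_ge0 K j.
have [L' _ pl'] := test_lip.
rewrite (smp_neighbor T0 N0 dtE K j nN pl').
have [c /andP[c0 cs]] := @line_MVT phi (n%:R * dt, corner K) (0, e_ j) _ sphi s0.
rewrite !space_shift /smp /right_point => ->.
set A := 'D_(0, e_ j) phi _; set B := dx_ j phi _.
have -> : A * side K j - side K j * B = side K j * (A - B) by ring.
rewrite {}/A {}/B normrM ger0_norm// expr2 mulrCA ler_wpM2l//.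
have sl := slab_corner T0 N0 dtE K nN.
have sl' : slab T a b (n%:R * dt, corner K + c *: e_ j).
  split => /=; first by case: sl.
  move=> i; rewrite shift_coord mxE; have h1 := lo_ge K i; have h2 := hi_le K i.
  have h3 := lo_lt_hi K i; case: eqP => [ij|_]; last by rewrite h1 (le_trans (ltW h3)).
  move: h1 h2 h3; rewrite ij => h1 h2 h3; move: cs; rewrite /side => cs.
  by apply/andP; split; lra.
rewrite -/(dx_ j phi) (le_trans (hL _ _ sl' sl))// ler_wpM2l//.
rewrite /dist/= subrr normr0 add0r (bigD1 j)//= big1 => [|i /negPf ij].
  by rewrite shift_coord eqxx addr0 addrAC subrr add0r ger0_norm.
by rewrite shift_coord ij subrr normr0.
Qed.

End test_functions.
End smooth_lipschitz.

(** * Consistency and convergence of the fluxes *)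

Section space_time_sums.
Context {R : realType} {d : nat} {a b : 'I_d -> R} (g : mac_grid a b).
Variables (N : nat) (dt : R).
Hypothesis dt0 : 0 <= dt.
Implicit Types (X Y W : nat -> cell g -> R) (K : cell g) (i j : 'I_d).
Local Notation S X := (@Ssum _ _ _ _ g N dt X).

Lemma eq_Ssum X Y : (forall n K, (n < N)%N -> X n K = Y n K) -> S X = S Y.
Proof.
by move=> XY; congr (_ * _); apply: eq_bigr => n _; apply: eq_bigr => K _; exact: XY.
Qed.

Lemma SsumD X Y : S (fun n K => X n K + Y n K) = S X + S Y.
Proof.
rewrite /Ssum -mulrDr -big_split; congr (_ * _); apply: eq_bigr => n _.
by rewrite big_split.
Qed.

Lemma SsumZ c X : S (fun n K => c * X n K) = c * S X.
Proof.
rewrite /Ssum mulrCA; congr (_ * _); rewrite mulr_sumr; apply: eq_bigr => n _.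
by rewrite mulr_sumr.
Qed.

Lemma SsumN X : S (fun n K => - X n K) = - S X.
Proof. by rewrite -mulN1r -SsumZ; apply: eq_Ssum => n K _; rewrite mulN1r. Qed.

Lemma SsumB X Y : S (fun n K => X n K - Y n K) = S X - S Y.
Proof. by rewrite (SsumD X (fun n K => - Y n K)) SsumN. Qed.

Lemma Ssum_sum (J : Type) (r : seq J) (X : J -> nat -> cell g -> R) :
  S (fun n K => \sum_(j <- r) X j n K) = \sum_(j <- r) S (X j).
Proof.
elim: r => [|j r IH].
  rewrite big_nil /Ssum big1 ?mulr0// => n _.
  by rewrite big1// => K _; rewrite big_nil.
rewrite big_cons -IH -SsumD; apply: eq_Ssum => n K _.
by rewrite big_cons.
Qed.

Lemma Ssum_le X Y : (forall n K, (n < N)%N -> X n K <= Y n K) -> S X <= S Y.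
Proof.
move=> XY; rewrite ler_wpM2l//; apply: ler_sum => n _; apply: ler_sum => K _.
exact: XY.
Qed.

Lemma Ssum_norm X : `|S X| <= S (fun n K => `|X n K|).
Proof.
rewrite normrM ger0_norm// ler_wpM2l//.
rewrite (le_trans (ler_norm_sum _ _ _))//; apply: ler_sum => n _.
exact: ler_norm_sum.
Qed.

Lemma Ssum_dist X Y W : (forall n K, (n < N)%N -> `|X n K - Y n K| <= W n K) ->
  `|S X - S Y| <= S W.
Proof.
move=> h; rewrite -SsumB (le_trans (Ssum_norm _))//; exact: Ssum_le.
Qed.

Lemma Ssum_norm_le X W : (forall n K, (n < N)%N -> `|X n K| <= W n K) -> `|S X| <= S W.
Proof. by move=> h; rewrite (le_trans (Ssum_norm _))//; exact: Ssum_le. Qed.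

Lemma Ssum_neighbor up i X : S (fun n K => X n (neighbor up i K)) = S X.
Proof.
by congr (_ * _); apply: eq_bigr => n _; rewrite (sum_neighbor up i (X n)).
Qed.

Lemma abel_sum (q c : nat -> R) M : \sum_(n < M) (q n.+1 - q n) * c n.+1 =
  q M * c M - q 0%N * c 0%N - \sum_(n < M) q n * (c n.+1 - c n).
Proof.
elim: M => [|M IH]; first by rewrite !big_ord0 subrr subr0.
by rewrite !big_ord_recr/= IH; ring.
Qed.

(** Periodicity makes [neighbor] a permutation, so moving the space difference onto [c] leaves no
    boundary term. Testing at level [n.+1] leaves the unknown at level [n] against the time
    difference of [c], plus end terms at the levels [N] and 0. *)
Lemma conserved_sum (V : cell g -> R) (q : nat -> cell g -> R)
    (G : nat -> 'I_d -> cell g -> R) (c : nat -> cell g -> R) :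
  (forall n, (n < N)%N -> conserved dt V (q n) (q n.+1) (G n)) ->
  S (fun n K => \sum_j G n j K * (c n.+1 (neighbor true j K) - c n.+1 K)) =
  \sum_K V K * q N K * c N K - \sum_K V K * q 0%N K * c 0%N K
  - \sum_(n < N) \sum_K V K * q n K * (c n.+1 K - c n K).
Proof.
move=> cons.
transitivity (\sum_(n < N) \sum_K V K * (q n.+1 K - q n K) * c n.+1 K); last first.
  rewrite exchange_big/= [X in _ = _ - X]exchange_big/= -!sumrB.
  apply: eq_bigr => K _.
  have := abel_sum (fun n => V K * q n K) (fun n => c n K) N => /= <-.
  by apply: eq_bigr => n _; rewrite mulrBr.
rewrite /Ssum mulr_sumr; apply: eq_bigr => n _.
have E K : V K * (q n.+1 K - q n K) = - (dt * \sum_j (G n j K - G n j (neighbor false j K))).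
  by apply/eqP; rewrite -addr_eq0; apply/eqP; exact: cons.
rewrite [RHS](eq_bigr (fun K => - (dt * ((\sum_j (G n j K - G n j (neighbor false j K))) * c n.+1 K)))).
  rewrite sumrN -[in RHS]mulr_sumr -mulrN; congr (_ * _).
  under [in RHS]eq_bigr do rewrite mulr_suml.
  rewrite exchange_big/= [in RHS]exchange_big/= -sumrN; apply: eq_bigr => j _.
  under [in RHS]eq_bigr do rewrite mulrBl.
  under [in LHS]eq_bigr do rewrite mulrBr.
  rewrite !sumrB opprB; congr (_ - _).
  rewrite -[RHS](sum_neighbor true j); apply: eq_bigr => K _.
  by rewrite (neighborK true).
by move=> K _; rewrite E mulNr mulrA.
Qed.

End space_time_sums.

(** * Limits of fluxes, momenta and pressure jumps *)

Section sequence_limits.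
Context {R : realType} {d : nat} {T : R} {a b : 'I_d -> R}.
Hypotheses (T0 : 0 < T) (hab : forall i, a i < b i).
Variables (g : nat -> mac_grid a b) (N : nat -> nat) (dt : nat -> R).
Hypotheses (N0 : forall m, (0 < N m)%N) (dtE : forall m, dt m = T / (N m)%:R).
Hypotheses (dt_cvg : dt m @[m --> \oo] --> 0)
  (h_cvg : mesh_size (g m) @[m --> \oo] --> 0).

Local Notation Q := (@Qset R d T a b).
Local Notation muQ := (@muQ R d).
Local Notation I f := (Rintegral muQ Q f).
Local Notation S m X := (@Ssum _ _ _ _ (g m) (N m) (dt m) X).
Local Notation bmQ f := (@bm _ (measurableTypeR R * 'rV[R]_d)%type R Q f).
Local Notation lipQ := (lip T a b).
Local Notation fQ := (muQ_fin T0 hab).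
Local Notation mQ := (@measurable_Q R d T a b).
Local Notation dts_ge0 := (dts_ge0 T0 N0 dtE).
Local Notation lip_bm := (lip_bm T0 hab N0 dtE dt_cvg h_cvg).
Local Notation mesh_err_cvg := (mesh_err_cvg dt_cvg h_cvg).
Local Notation err := (mesh_err g dt).
Local Notation smpm m c := (smp (g := g m) (dt m) c).
Local Notation nb := (neighbor true).
Local Notation family := (forall m, nat -> cell (g m) -> R).

Implicit Types (i j : 'I_d) (X Y q u r : family) (chi psi : R * 'rV[R]_d -> R).

Lemma Ssum_vol m : S m (fun _ K => vol K) = tot muQ Q.
Proof.
exact: (Ssum_volume T0 hab (N0 m) (dtE m) (@cell_measure _ _ _ _ g m)
  (@cell_set_Omega _ _ _ _ (g m)) (@cell_of _ _ _ _ (g m)) (@cell_set_inj _ _ _ _ (g m))).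
Qed.

Lemma Ssum_vol_pair m i : S m (fun _ K => vol K + vol (nb i K)) = 2 * tot muQ Q.
Proof.
rewrite SsumD (@Ssum_neighbor _ _ _ _ (g m) (N m) (dt m) true i (fun _ K => vol K)) Ssum_vol.
by ring.
Qed.

Lemma sum_vol m : \sum_(K : cell (g m)) vol K = tot muQ Q / T.
Proof.
rewrite -(Ssum_vol m) /Ssum sumr_const card_ord -mulr_natl mulrA.
rewrite [dt m * _]mulrC (NdtE (N0 m) (dtE m)) mulrC mulrA mulVf ?mul1r//.
by rewrite gt_eqF.
Qed.

(** The volume of the neighbor is part of the weight because the volume of [K] need not control it.
    Re-indexing shows that the total weight is twice the measure of the cylinder. *)
Lemma Ssum_cvg0 i X Y C k : 0 <= C ->
  (forall m n K, (n < N m)%N ->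
     `|X m n K - Y m n K| <= C * err k m * (vol K + vol (nb i K))) ->
  S m (X m) - S m (Y m) @[m --> \oo] --> 0.
Proof.
move=> C0 h; apply: (@cvg0_le _ _ (fun m => C * err k m * (2 * tot muQ Q))).
  move=> m; rewrite -(Ssum_vol_pair m i) -SsumZ.
  by apply: (Ssum_dist (dts_ge0 m)) => n K nN; exact: h.
under eq_fun do rewrite mulrC mulrA.
exact/cvg0Z/mesh_err_cvg.
Qed.

(* The conservation law is tested with [side K i * chi], which is O(h): of its
   differences only the jumps of [side] across faces orthogonal to [e_i] are not
   of higher order. *)
Lemma flux_variation_cvg0 q (G : forall m, nat -> 'I_d -> cell (g m) -> R) Cq CG :
  0 <= Cq -> 0 <= CG ->
  (forall m n, (n < N m)%N ->
     conserved (dt m) (@vol _ _ _ _ (g m)) (q m n) (q m n.+1) (G m n)) ->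
  (forall m n K, (n <= N m)%N -> `|q m n K| <= Cq) ->
  (forall m n j K, (n < N m)%N -> `|G m n j K| <= CG * area (j, K)) ->
  forall i chi, lipQ chi ->
  S m (fun n K => G m n i K * (side (nb i K) i - side K i) * smpm m chi n K)
    @[m --> \oo] --> 0.
Proof.
move=> Cq0 CG0 cons hq hG i chi Lchi.
have [M M0 hM] := lip_bounded T0 hab Lchi; have [L L0 pl] := Lchi.
pose c m n (K : cell (g m)) := side K i * smpm m chi n K.
pose E m := S m (fun n K => \sum_j G m n j K * (c m n.+1 (nb j K) - c m n.+1 K)).
have h0 m := mesh_ge0 (g m).
have smpM m n (K : cell (g m)) : (n <= N m)%N -> `|smpm m chi n K| <= M.
  exact: (smp_bounded T0 (N0 m) (dtE m) K hM).
(* Every term of [conserved_sum] carries a factor [side K i <= mesh_size], and the time differences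
   of [chi] are O(dt), which compensates the number of steps. The total is O(h). *)
have E0 : E m @[m --> \oo] --> 0.
  apply: (@cvg0_le _ _ (fun m => (2 * (Cq * M * (tot muQ Q / T)) + Cq * L * tot muQ Q)
     * mesh_size (g m))); last exact: cvg0Z.
  move=> m; rewrite /E (conserved_sum (c m) (cons m)).
  have slice n : (n <= N m)%N ->
      `|\sum_(K : cell (g m)) vol K * q m n K * c m n K| <= Cq * M * (tot muQ Q / T) * mesh_size (g m).
    move=> nN; rewrite (le_trans (ler_norm_sum _ _ _))// -(sum_vol m) mulr_sumr mulr_suml.
    apply: ler_sum => K _; rewrite /c !normrM (ger0_norm (vol_ge0 K)) (ger0_norm (side_ge0 K i)).
    have -> : Cq * M * vol K * mesh_size (g m) = vol K * Cq * (mesh_size (g m) * M) by ring.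
    have v0 := vol_ge0 K; have s0 := side_ge0 K i.
    apply: ler_pM; rewrite ?mulr_ge0//.
      by rewrite ler_wpM2l// hq.
    by apply: ler_pM => //; [exact: side_le_mesh|exact: smpM].
  have inner : `|\sum_(n < N m) \sum_(K : cell (g m)) vol K * q m n K * (c m n.+1 K - c m n K)|
      <= Cq * L * tot muQ Q * mesh_size (g m).
    have -> : Cq * L * tot muQ Q * mesh_size (g m) =
        \sum_(n < N m) \sum_(K : cell (g m)) vol K * (Cq * mesh_size (g m) * L * dt m).
      transitivity (Cq * mesh_size (g m) * L * S m (fun _ K => vol K)).
        by rewrite Ssum_vol; ring.
      rewrite /Ssum mulrA mulr_sumr; apply: eq_bigr => n _.
      by rewrite mulr_sumr; apply: eq_bigr => K _; ring.
    rewrite (le_trans (ler_norm_sum _ _ _))//; apply: ler_sum => n _.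
    rewrite (le_trans (ler_norm_sum _ _ _))//; apply: ler_sum => K _.
    have v0 := vol_ge0 K; have s0 := side_ge0 K i.
    rewrite /c -mulrBr !normrM (ger0_norm v0) (ger0_norm s0) -!mulrA ler_wpM2l//.
    apply: ler_pM; rewrite ?mulr_ge0//; first by apply: hq; exact: ltnW.
    apply: ler_pM => //; first exact: side_le_mesh.
    exact: (smp_time_dist T0 (N0 m) (dtE m) K (ltn_ord n) pl).
  rewrite (le_trans (ler_normB _ _))// mulrDl lerD//.
  rewrite (le_trans (ler_normB _ _))//.
  have -> : 2 * (Cq * M * (tot muQ Q / T)) * mesh_size (g m) =
    Cq * M * (tot muQ Q / T) * mesh_size (g m) + Cq * M * (tot muQ Q / T) * mesh_size (g m) by ring.
  by rewrite lerD// slice.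
have := Ssum_cvg0 (i := i) (X := fun m n K => G m n i K * (side (nb i K) i - side K i) * smpm m chi n K)
  (Y := fun m n K => \sum_j G m n j K * (c m n.+1 (nb j K) - c m n.+1 K)) (k := d.+1)
  (mulr_ge0 CG0 L0).
move=> H; apply: cvg_shift0 (H _) E0 => {H} m n K nN.
have hh := h0 m; have dd := dts_ge0 m.
have v0 := vol_ge0 K; have v0' := vol_ge0 (nb i K).
have s0 := side_ge0 K i; have s0' := side_ge0 (nb i K) i.
(* Direction [i] produces the jump of [side]. In the other directions the side along [e_i] does not
   change across the face, so that only the variation of [chi] remains. *)
rewrite (bigD1 i)//=; set A := G m n i K * (c _ _ _ - _).
set B := \sum_(_ < _ | _) _; set X := G m n i K * _ * _.
have -> : X - (A + B) = (X - A) - B by ring.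
have -> : CG * L * err d.+1 m * (vol K + vol (nb i K)) =
  CG * L * (dt m + mesh_size (g m)) * (vol K + vol (nb i K))
  + d%:R * (CG * L * mesh_size (g m) * (vol K + vol (nb i K))).
  by rewrite /mesh_err -natr1; ring.
rewrite (le_trans (ler_normB _ _))// lerD//; rewrite /A /X {A X}.
(* A discrete product rule: the variation of [chi] across the face yields a product of two sides,
   and moving its time level from [n.+1] to [n] costs [L * dt]. *)
- have -> : G m n i K * (side (nb i K) i - side K i) * smpm m chi n K
      - G m n i K * (c m n.+1 (nb i K) - c m n.+1 K) =
    - (G m n i K * (side (nb i K) i * (smpm m chi n.+1 (nb i K) - smpm m chi n.+1 K)
       + (side (nb i K) i - side K i) * (smpm m chi n.+1 K - smpm m chi n K))).
    by rewrite /c; ring.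
  rewrite normrN normrM.
  have e1 := smp_neighbor_dist T0 (N0 m) (dtE m) K i nN pl.
  have e2 := smp_time_dist T0 (N0 m) (dtE m) K nN pl.
  have e3 : `|side (nb i K) i * (smpm m chi n.+1 (nb i K) - smpm m chi n.+1 K)
       + (side (nb i K) i - side K i) * (smpm m chi n.+1 K - smpm m chi n K)| <=
      L * (dt m + mesh_size (g m)) * (side K i + side (nb i K) i).
    rewrite (le_trans (ler_normD _ _))// !normrM (ger0_norm s0').
    have b1 : side (nb i K) i * `|smpm m chi n.+1 (nb i K) - smpm m chi n.+1 K| <=
        L * mesh_size (g m) * side K i.
      rewrite (le_trans (ler_wpM2l s0' e1))// mulrCA -mulrA ler_wpM2l// ler_wpM2r//.
      exact: side_le_mesh.
    have b2 : `|side (nb i K) i - side K i| * `|smpm m chi n.+1 K - smpm m chi n K| <=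
        (side K i + side (nb i K) i) * (L * dt m).
      apply: ler_pM => //; rewrite (le_trans (ler_normB _ _))// (ger0_norm s0) (ger0_norm s0').
      by rewrite addrC.
    have b3 : 0 <= L * mesh_size (g m) * side (nb i K) i by rewrite !mulr_ge0.
    rewrite (le_trans (lerD b1 b2))// -subr_ge0.
    by rewrite (_ : _ - _ = L * mesh_size (g m) * side (nb i K) i)//; ring.
  rewrite (le_trans (ler_pM _ _ (hG m n i K nN) e3))//.
  have va : vol (nb i K) = area (i, K) * side (nb i K) i by rewrite area_side_neighbor.
  by rewrite va (vol_area i K) le_eqVlt; apply/orP; left; apply/eqP; ring.
- rewrite /B (le_trans (ler_norm_sum _ _ _))//.
  apply: (@le_trans _ _ (\sum_(j < d) CG * L * mesh_size (g m) * (vol K + vol (nb i K)))).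
    rewrite [leRHS](bigD1 i)//= ler_wpDl ?mulr_ge0 ?addr_ge0//.
    apply: ler_sum => j ji; rewrite /c side_neighbor; last by rewrite eq_sym.
    rewrite -mulrBr !normrM (ger0_norm s0).
    have e1 := smp_neighbor_dist T0 (N0 m) (dtE m) K j nN pl.
    have sj := side_ge0 K j.
    have gj := hG m n j K nN; have aj := area_ge0 (j, K).
    apply: (@le_trans _ _ ((CG * area (j, K)) * (mesh_size (g m) * (L * side K j)))).
      apply: ler_pM; rewrite ?mulr_ge0//.
      by apply: ler_pM => //; exact: side_le_mesh.
    rewrite (_ : _ * _ = CG * L * mesh_size (g m) * vol K); last by rewrite (vol_area j); ring.
    by rewrite ler_wpM2l ?mulr_ge0// lerDl.
  by rewrite sumr_const card_ord mulr_natl.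
Qed.

(** Weak convergence, tested with Lipschitz functions sampled at corners. The flux and momentum
    limits ask no more of the cell quantities. *)
Definition cell_limit q (f : R * 'rV[R]_d -> R) := bmQ f /\
  forall chi, lipQ chi ->
  S m (fun n K => vol K * (q m n K * smpm m chi n K)) @[m --> \oo]
    --> I (fun z => f z * chi z).

(* An upwind flux depends on the positive and negative parts of the velocity
   separately. *)
Definition face_limit i u (f : R * 'rV[R]_d -> R) := bmQ f /\
  forall chi, lipQ chi ->
  [/\ S m (fun n K => dual_vol (i, K) * `|u m n K - smpm m chi n K|) @[m --> \oo]
       --> I (fun z => `|f z - chi z|),
     S m (fun n K => dual_vol (i, K) * `|pos (u m n K) - smpm m chi n K|) @[m --> \oo]
       --> I (fun z => `|pos (f z) - chi z|),
     S m (fun n K => dual_vol (i, K) * `|neg (u m n K) - smpm m chi n K|) @[m --> \oo]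
       --> I (fun z => `|neg (f z) - chi z|),
     S m (fun n K => dual_vol (i, K) * `|pos (u m n K) * smpm m chi n K|) @[m --> \oo]
       --> I (fun z => `|pos (f z) * chi z|)
   & S m (fun n K => dual_vol (i, K) * `|neg (u m n K) * smpm m chi n K|) @[m --> \oo]
       --> I (fun z => `|neg (f z) * chi z|)].

Lemma pos_add_neg (x : R) : pos x + neg x = x.
Proof. by rewrite /pos /neg addr_max_min addr0. Qed.

Lemma bm_pos f : bmQ f -> bmQ (fun z => pos (f z)).
Proof.
move=> [mf [M hM]]; split.
  by apply: measurable_maxr => //; exact: measurable_cst.
exists M => z Qz; apply: le_trans (hM z Qz); rewrite /pos.
by rewrite maxEle; case: ifP => _; rewrite ?normr0.
Qed.

Lemma bm_neg f : bmQ f -> bmQ (fun z => neg (f z)).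
Proof.
move=> [mf [M hM]]; split.
  by apply: measurable_minr => //; exact: measurable_cst.
exists M => z Qz; apply: le_trans (hM z Qz); rewrite /neg.
by rewrite minEle; case: ifP => _; rewrite ?normr0.
Qed.

Lemma lipschitz_approx f e : bmQ f -> 0 < e ->
  exists2 chi, lipQ chi & I (fun z => `|f z - chi z|) <= e.
Proof. by move=> bf; exact: (lip_approximable T0 hab lip_bm bf). Qed.

Lemma vol_pairE m i (K : cell (g m)) : vol K + vol (nb i K) = 2 * dual_vol (i, K).
Proof. by rewrite dual_volE mulrC divfK. Qed.

(* The downwind half [q_{K+} u^-] of the flux carries the weight of [K] instead
   of that of [K+]; the difference is tested against a Lipschitz approximation
   of the indicator of [uf < 0] in the flux variation hypothesis. *)
Lemma upwind_flux_cvg i q u r (G : family) f uf Cq : 0 <= Cq ->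
  (forall m n K, (n < N m)%N -> `|q m n K| <= Cq) ->
  cell_limit q f -> face_limit i u uf ->
  (forall m n K, (n < N m)%N -> G m n K =
     area (i, K) * (q m n K * pos (u m n K) + q m n (nb i K) * neg (u m n K)) + r m n K) ->
  S m (fun n K => `|r m n K| * (side K i + side (nb i K) i)) @[m --> \oo] --> 0 ->
  (forall chi, lipQ chi ->
    S m (fun n K => G m n K * (side (nb i K) i - side K i) * smpm m chi n K)
      @[m --> \oo] --> 0) ->
  forall psi, lipQ psi ->
  S m (fun n K => G m n K * side K i * smpm m psi n K) @[m --> \oo]
    --> I (fun z => f z * uf z * psi z).
Proof.
move=> Cq0 hq [bf wq] [bu hu] GE r0 G0 psi Lpsi.
have bpsi := lip_bm Lpsi.
have [M M0 hM] := lip_bounded T0 hab Lpsi.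
have [Cf Cf0 hCf] := bm_bound bf; have [Cu Cu0 hCu] := bm_bound bu.
(* [B] dominates the two error constants met below: [2 * A * (1 + Cu)] with [A = 2 * (Cq * M)], and
   [2 * (Cf * M)]. *)
pose B := 4 * (2 * (Cq * M)) * (1 + Cu) + 2 * (Cf * M) + 1.
have B1 : 1 <= B by rewrite lerDr addr_ge0// !mulr_ge0// addr_ge0.
have B0 : 0 < B by exact: lt_le_trans B1.
apply: (@cvg_by_approximation R (fun m => S m (fun n K => G m n K * side K i * smpm m psi n K))).
move=> e e0.
have eB : 0 < e / B by rewrite divr_gt0.
have [al Lal hal] := lipschitz_approx (bm_pos bu) eB.
have [be Lbe hbe] := lipschitz_approx (bm_neg bu) eB.
(* Where [ind] is 1 the flux takes its density from the upper cell. Its approximation [ch] makes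
   both [pos uf * ch] and [neg uf * (1 - ch)] small in L^1. *)
pose ind : R * 'rV[R]_d -> R := \1_(Q `&` uf @^-1` `]-oo, 0[%classic).
have bind : bmQ ind.
  by apply: bm_indic; apply: (bm_meas bu); [exact: mQ|exact: measurable_itv].
have indE z : Q z -> ind z = (uf z < 0)%R%:R.
  move=> Qz; rewrite /ind indicE; congr (_%:R); congr nat_of_bool.
  by apply/idP/idP; rewrite inE /= in_itv//= => -[].
have [ch Lch hch] := lipschitz_approx bind eB.
have L1ch : lipQ (fun z => 1 - ch z) by apply: lipB => //; exact: lip_cst.
have bal := lip_bm Lal; have bbe := lip_bm Lbe; have bch := lip_bm Lch.
have bpos := bm_pos bu; have bneg := bm_neg bu.
have Lap := lipM T0 hab Lal Lpsi; have Lbp := lipM T0 hab Lbe Lpsi.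
have Lcp := lipM T0 hab Lch Lpsi.
have [_ Sp _ _ _] := hu _ Lal; have [_ _ Sn _ _] := hu _ Lbe.
have [_ _ _ Spc _] := hu _ Lch; have [_ _ _ _ Snc] := hu _ L1ch.
pose A := 2 * (Cq * M).
have A0 : 0 <= A by rewrite !mulr_ge0.
have [Mc Mc0 hMc] := lip_bounded T0 hab Lch.
have smpM m n (K : cell (g m)) : (n < N m)%N -> `|smpm m psi n K| <= M.
  by move=> nN; exact: (smp_bounded T0 (N0 m) (dtE m) K hM (ltnW nN)).
have smpMc m n (K : cell (g m)) : (n < N m)%N -> `|smpm m ch n K| <= Mc.
  by move=> nN; exact: (smp_bounded T0 (N0 m) (dtE m) K hMc (ltnW nN)).
(* [Y] replaces the two parts of the velocity by [al] and [be] and gives the downwind half the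
   volume of its own cell. This change costs [area * (side (nb i K) i - side K i) * q (nb i K) * neg
   u]. As [pos u * ch] and [neg u * (1 - ch)] are small, it is nearly [(G - r)] times the same jump
   of [side] times [ch], whence the last two terms. *)
pose Y m n (K : cell (g m)) :=
  vol K * (q m n K * (smpm m al n K * smpm m psi n K))
  + vol (nb i K) * (q m n (nb i K) * (smpm m be n K * smpm m psi n K))
  + r m n K * side K i * smpm m psi n K
  - G m n K * (side (nb i K) i - side K i) * (smpm m ch n K * smpm m psi n K)
  + r m n K * (side (nb i K) i - side K i) * (smpm m ch n K * smpm m psi n K).
pose Zm m n (K : cell (g m)) :=
  A * (dual_vol (i, K) * `|pos (u m n K) - smpm m al n K|)
  + A * (dual_vol (i, K) * `|neg (u m n K) - smpm m be n K|)
  + A * (dual_vol (i, K) * `|pos (u m n K) * smpm m ch n K|)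
  + A * (dual_vol (i, K) * `|neg (u m n K) * (1 - smpm m ch n K)|).
exists (fun m => S m (Y m)),
  (I (fun z => f z * (al z * psi z)) + I (fun z => f z * (be z * psi z))),
  (fun m => S m (Zm m)),
  (A * I (fun z => `|pos (uf z) - al z|) + A * I (fun z => `|neg (uf z) - be z|)
   + A * I (fun z => `|pos (uf z) * ch z|) + A * I (fun z => `|neg (uf z) * (1 - ch z)|)).
have r_small (k : family) C : 0 <= C ->
    (forall m n K, (n < N m)%N -> `|k m n K| <= C * (side K i + side (nb i K) i)) ->
    S m (fun n K => r m n K * k m n K) @[m --> \oo] --> 0.
  move=> C0 hk; apply: (cvg0_le _ (cvg0Z C r0)) => m; rewrite -SsumZ.
  apply: (Ssum_norm_le (dts_ge0 m)) => n K nN.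
  by rewrite normrM mulrCA ler_wpM2l// hk.
have pI f1 : bmQ f1 -> 0 <= I (fun z => `|f1 z|) by move=> _; exact: Rintegral_ge0.
split.
- have E m : S m (Y m) =
    S m (fun n K => vol K * (q m n K * smpm m (fun z => al z * psi z) n K))
    + (S m (fun n K => vol (nb i K) * (q m n (nb i K) * smpm m (fun z => be z * psi z) n K))
       - S m (fun n K => vol (nb i K) * (q m n (nb i K) * smpm m (fun z => be z * psi z) n (nb i K))))
    + S m (fun n K => vol K * (q m n K * smpm m (fun z => be z * psi z) n K))
    + S m (fun n K => r m n K * (side K i * smpm m psi n K))
    - S m (fun n K => G m n K * (side (nb i K) i - side K i) * smpm m (fun z => ch z * psi z) n K)
    + S m (fun n K => r m n K * ((side (nb i K) i - side K i) * smpm m (fun z => ch z * psi z) n K)).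
    rewrite -(@Ssum_neighbor _ _ _ _ (g m) (N m) (dt m) true i
      (fun n K => vol K * (q m n K * smpm m (fun z => be z * psi z) n K))).
    rewrite -!(SsumD, SsumB); apply: eq_Ssum => n K nN.
    by rewrite /Y /smp; ring.
  under eq_fun do rewrite E.
  have [Lb Lb0 plb] := Lbp.
  set l1 := Rintegral _ _ _; set l2 := Rintegral _ _ _.
  have -> : l1 + l2 = l1 + 0 + l2 + 0 - 0 + 0 by rewrite !addr0 subr0.
  apply: cvgD; last first.
    apply: (r_small _ (M * Mc)); first exact: mulr_ge0.
    move=> m n K nN; rewrite normrM mulrC ler_pM//.
      by rewrite /smp normrM mulrC ler_pM// ?smpM ?smpMc.
    have s0 := side_ge0 K i; have s1 := side_ge0 (nb i K) i.
    by rewrite (le_trans (ler_normB _ _))// addrC !ger0_norm.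
  apply: cvgB; last exact: G0.
  apply: cvgD; last first.
    apply: (r_small _ M) => // m n K nN.
    have s0 := side_ge0 K i; have s1 := side_ge0 (nb i K) i.
    by rewrite normrM mulrC ler_pM// ?smpM// ger0_norm// lerDl.
  apply: cvgD; last exact: wq.
  apply: cvgD; first exact: wq.
  apply: (Ssum_cvg0 (i := i) (C := Cq * Lb) (k := 1%N)); first exact: mulr_ge0.
  move=> m n K nN; rewrite -!mulrBr !normrM distrC ger0_norm ?vol_ge0//.
  have v0 := vol_ge0 K; have v1 := vol_ge0 (nb i K).
  have e1 := smp_neighbor_le T0 (N0 m) (dtE m) K i Lb0 (ltnW nN) plb.
  have h0 := mesh_ge0 (g m); have dd := dts_ge0 m.
  have -> : Cq * Lb * err 1 m * (vol K + vol (nb i K)) =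
    (vol K + vol (nb i K)) * (Cq * (Lb * err 1 m)) by ring.
  apply: ler_pM; rewrite ?mulr_ge0 ?lerDr//.
  apply: ler_pM => //; first exact: hq.
  rewrite (le_trans e1)// ler_wpM2l// /mesh_err mul1r lerDr//.
- have b1 : bmQ (fun z => f z * (al z * psi z)) by apply: bmM => //; exact: bmM.
  have b2 : bmQ (fun z => f z * (be z * psi z)) by apply: bmM => //; exact: bmM.
  have b3 : bmQ (fun z => f z * uf z * psi z) by apply: bmM => //; exact: bmM.
  have p1 := bm_norm (bmB bpos bal); have p2 := bm_norm (bmB bneg bbe).
  rewrite -(intD mQ fQ b1 b2).
  rewrite (le_trans (int_dist mQ fQ (bmD b1 b2) b3))//.
  apply: (@le_trans _ _ (I (fun z => Cf * M * (`|pos (uf z) - al z| + `|neg (uf z) - be z|)))).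
    apply: (int_le mQ fQ).
    - exact: bm_norm (bmB (bmD b1 b2) b3).
    - exact: bmZ (bmD p1 p2).
    move=> z Qz; rewrite -{1}(pos_add_neg (uf z)).
    have -> : f z * (al z * psi z) + f z * (be z * psi z)
        - f z * (pos (uf z) + neg (uf z)) * psi z =
      - (f z * psi z * ((pos (uf z) - al z) + (neg (uf z) - be z))) by ring.
    rewrite normrN !normrM !ler_pM ?mulr_ge0// ?ler_normD// ?hCf//.
    exact/hM/Q_slab.
  rewrite (intZ mQ fQ _ (bmD p1 p2)) (intD mQ fQ p1 p2).
  apply: (@le_trans _ _ (Cf * M * (e / B + e / B))).
    by apply: ler_wpM2l; [exact: mulr_ge0|exact: lerD].
  have -> : Cf * M * (e / B + e / B) = (2 * (Cf * M)) * e / B by ring.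
  rewrite ler_pdivrMr// mulrC ler_wpM2l ?ltW// /B.
  have : 0 <= 4 * (2 * (Cq * M)) * (1 + Cu) by rewrite !mulr_ge0// addr_ge0.
  lra.
- rewrite /Zm; under eq_fun do rewrite !SsumD !SsumZ.
  by apply: cvgD; [apply: cvgD; [apply: cvgD|]|]; apply: cvgMl_tmp.
- have q3 : I (fun z => `|pos (uf z) * ch z|) <= Cu * (e / B).
    rewrite (le_trans _ (ler_wpM2l Cu0 hch))// -(intZ mQ fQ _ (bm_norm (bmB bind bch))).
    apply: (int_le mQ fQ).
    - exact: bm_norm (bmM bpos bch).
    - exact: bmZ (bm_norm (bmB bind bch)).
    move=> z Qz; rewrite indE// normrM /pos; have := hCu z Qz.
    case: (ltP (uf z) 0) => [u0|u0] hu0.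
      by rewrite normr0 mul0r mulr_ge0.
    by rewrite sub0r normrN ler_wpM2r.
  have q4 : I (fun z => `|neg (uf z) * (1 - ch z)|) <= Cu * (e / B).
    rewrite (le_trans _ (ler_wpM2l Cu0 hch))// -(intZ mQ fQ _ (bm_norm (bmB bind bch))).
    apply: (int_le mQ fQ).
    - exact: bm_norm (bmM bneg (bmB (bm_cst _ 1) bch)).
    - exact: bmZ (bm_norm (bmB bind bch)).
    move=> z Qz; rewrite indE// normrM /neg; have := hCu z Qz.
    case: (ltP (uf z) 0) => [u0|u0] hu0.
      by rewrite ler_wpM2r.
    by rewrite normr0 mul0r mulr_ge0.
  apply: (@le_trans _ _ (A * (e / B) + A * (e / B) + A * (Cu * (e / B)) + A * (Cu * (e / B)))).
    by rewrite !lerD// ler_wpM2l.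
  have -> : A * (e / B) + A * (e / B) + A * (Cu * (e / B)) + A * (Cu * (e / B)) =
    (2 * A * (1 + Cu)) * e / B by ring.
  rewrite ler_pdivrMr// mulrC ler_wpM2l ?ltW// /B -/A.
  have : 0 <= A * (1 + Cu) by rewrite mulr_ge0// addr_ge0.
  have : 0 <= Cf * M by exact: mulr_ge0.
  lra.
- move=> m; rewrite /Zm; apply: (Ssum_dist (dts_ge0 m)) => n K nN.
  have v0 := vol_ge0 K; have v1 := vol_ge0 (nb i K).
  have s0 := side_ge0 K i; have s1 := side_ge0 (nb i K) i.
  have a0 := area_ge0 (i, K).
  have vE := vol_pairE i K.
  have va : vol K = area (i, K) * side K i by exact: vol_area.
  have va' : vol (nb i K) = area (i, K) * side (nb i K) i by rewrite area_side_neighbor.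
  have D0 := dual_vol_ge0 (i, K).
  rewrite /Y (GE m n K nN).
  set P := pos _; set Ng := neg _; set p := smpm m psi n K.
  set x1 := smpm m al n K; set x2 := smpm m be n K; set x3 := smpm m ch n K.
  have bound (w y z : R) : `|w| <= 2 * dual_vol (i, K) -> `|y| <= Cq ->
      `|w * y * z * p| <= A * (dual_vol (i, K) * `|z|).
    move=> hw hy; rewrite !normrM /A.
    have -> : 2 * (Cq * M) * (dual_vol (i, K) * `|z|) =
      2 * dual_vol (i, K) * Cq * `|z| * M by ring.
    rewrite !ler_pM ?mulr_ge0//; exact: smpM.
  have b0 : `|area (i, K) * side K i| <= 2 * dual_vol (i, K).
    by rewrite -va -vE ger0_norm// lerDl.
  have b1 : `|area (i, K) * side (nb i K) i| <= 2 * dual_vol (i, K).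
    by rewrite -va' -vE ger0_norm// lerDr.
  have b2 : `|area (i, K) * (side (nb i K) i - side K i)| <= 2 * dual_vol (i, K).
    rewrite normrM (ger0_norm a0) -vE va va' -mulrDr ler_wpM2l//.
    by rewrite (le_trans (ler_normB _ _))// addrC !ger0_norm.
  have q0 := hq m n K nN; have q1 := hq m n (nb i K) nN.
  have -> : vol K = area (i, K) * side K i by [].
  have -> : vol (nb i K) = area (i, K) * side (nb i K) i by [].
  set s := side K i; set s' := side (nb i K) i; set ar := area (i, K).
  set qK := q m n K; set qL := q m n (nb i K); set rK := r m n K.
  have -> : (ar * (qK * P + qL * Ng) + rK) * s * p -
    (ar * s * (qK * (x1 * p)) + ar * s' * (qL * (x2 * p)) + rK * s * p
     - (ar * (qK * P + qL * Ng) + rK) * (s' - s) * (x3 * p) + rK * (s' - s) * (x3 * p)) =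
    (ar * s) * qK * (P - x1) * p + (ar * s') * qL * (Ng - x2) * p
    + (ar * (s' - s)) * qK * (P * x3) * p - (ar * (s' - s)) * qL * (Ng * (1 - x3)) * p.
    by ring.
  rewrite (le_trans (ler_normB _ _))// lerD//; last exact: bound.
  rewrite (le_trans (ler_normD _ _))// lerD//; last exact: bound.
  rewrite (le_trans (ler_normD _ _))// lerD//; exact: bound.
Qed.

(** [sh] selects the corner where the test function is sampled: that of the cell itself, or, for
    momentum, that of the upper cell of the face. The second choice makes the area of the dual face
    times the side met by the test function equal to the volume of the cell that carries the
    pressure. *)
Lemma weak_consistency i (V : forall m, cell (g m) -> R) q
    (G : forall m, nat -> 'I_d -> cell (g m) -> R)
    (sh : forall m, cell (g m) -> cell (g m)) (C : R) phi (lt : R) (lj : 'I_d -> R) (l0 : R) :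
  0 <= C -> test_function T a b phi ->
  (forall m n, (n < N m)%N -> conserved (dt m) (V m) (q m n) (q m n.+1) (G m n)) ->
  (forall m j K, sh m (nb j K) = nb j (sh m K)) ->
  (forall m n K, (n < N m)%N -> `|V m K * q m n K| <= C * (vol K + vol (nb i K))) ->
  (forall m n j K, (n < N m)%N ->
     `|G m n j K| * side (sh m K) j <= C * (vol K + vol (nb i K))) ->
  S m (fun n K => V m K * q m n K * smpm m (dt_ phi) n (sh m K)) @[m --> \oo] --> lt ->
  (forall j, S m (fun n K => G m n j K * side (sh m K) j * smpm m (dx_ j phi) n (sh m K))
     @[m --> \oo] --> lj j) ->
  \sum_K V m K * q m 0%N K * smpm m phi 0 (sh m K) @[m --> \oo] --> l0 ->
  lt + \sum_j lj j = - l0.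
Proof.
move=> C0 tphi cons shC hV hG ct cj c0.
have [L0 L00 pl0] := test_dt_lip tphi.
have /choice[Lj hLj] j : exists L, 0 <= L /\ plip T a b L (dx_ j phi).
  by have [L ? ?] := test_dx_lip tphi j; exists L.
pose L := \sum_j Lj j.
have Ljle j : Lj j <= L.
  rewrite /L (bigD1 j)//= lerDl sumr_ge0// => l _; by case: (hLj l).
have L_ge0 : 0 <= L by apply: sumr_ge0 => j _; case: (hLj j).
pose c m n (K : cell (g m)) := smpm m phi n (sh m K).
pose X m := S m (fun n K => \sum_j G m n j K * (c m n.+1 (nb j K) - c m n.+1 K)).
pose Y m := \sum_(n < N m) \sum_K V m K * q m n K * (c m n.+1 K - c m n K).
have cX : X m @[m --> \oo] --> \sum_j lj j.
  apply: (@cvg_shift0 _ _ (fun m => \sum_j S m (fun n K =>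
      G m n j K * side (sh m K) j * smpm m (dx_ j phi) n (sh m K)))); last first.
    by apply: cvg_big => //; exact: add_continuous.
  under eq_fun do rewrite -Ssum_sum.
  (* The factor [d] comes from the sum over directions. One [L] is for the Taylor remainder in
     space, the other for the change of time level from [n.+1] to [n]. *)
  apply: (Ssum_cvg0 (i := i) (C := d%:R * (C * (2 * L))) (k := 1%N)); first by rewrite !mulr_ge0.
  move=> m n K nN; rewrite -sumrB (le_trans (ler_norm_sum _ _ _))//.
  have -> : d%:R * (C * (2 * L)) * err 1 m * (vol K + vol (nb i K)) =
    \sum_(j < d) C * (2 * L) * err 1 m * (vol K + vol (nb i K)).
    by rewrite sumr_const card_ord -mulr_natl; ring.
  apply: ler_sum => j _; rewrite /c shC -mulrA -mulrBr normrM.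
  have s0 := side_ge0 (sh m K) j; have [Lj0 pj] := hLj j.
  have t1 := smp_space_taylor T0 tphi (N0 m) (dtE m) (sh m K) Lj0 nN pj.
  have t2 := smp_time_dist T0 (N0 m) (dtE m) (sh m K) nN pj.
  have hh := mesh_ge0 (g m); have dd := dts_ge0 m.
  have sh_le := side_le_mesh (sh m K) j.
  apply: (@le_trans _ _ (`|G m n j K| * (side (sh m K) j * (2 * L * err 1 m)))); last first.
    have -> : C * (2 * L) * err 1 m * (vol K + vol (nb i K)) =
      C * (vol K + vol (nb i K)) * (2 * L * err 1 m) by ring.
    by rewrite mulrA ler_wpM2r ?hG// !mulr_ge0// /mesh_err addr_ge0// mulr_ge0.
  apply: ler_wpM2l => //; set x := smpm m phi n.+1 _ - _.
  have -> : x - side (sh m K) j * smpm m (dx_ j phi) n (sh m K) =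
    (x - side (sh m K) j * smpm m (dx_ j phi) n.+1 (sh m K))
    + side (sh m K) j * (smpm m (dx_ j phi) n.+1 (sh m K) - smpm m (dx_ j phi) n (sh m K)) by ring.
  rewrite (le_trans (ler_normD _ _))// normrM ger0_norm//.
  apply: (@le_trans _ _ (side (sh m K) j * (L * mesh_size (g m)) + side (sh m K) j * (L * dt m))).
    apply: lerD; last first.
      by apply: ler_wpM2l => //; rewrite (le_trans t2)// ler_wpM2r.
    rewrite (le_trans t1)// expr2 mulrCA ler_wpM2l// ler_pM//.
  rewrite -mulrDr ler_wpM2l// -mulrDr /mesh_err mul1r -mulrA [2 * _]mulrC -mulrA.
  rewrite ler_wpM2l//; lra.
have cY : Y m @[m --> \oo] --> lt.
  apply: (@cvg_shift0 _ _ _ _ _ ct).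
  have E m : Y m = S m (fun n K => V m K * q m n K * ((c m n.+1 K - c m n K) / dt m)).
    rewrite /Ssum mulr_sumr; apply: eq_bigr => n _; rewrite mulr_sumr.
    apply: eq_bigr => K _; have := dt_gt0 T0 (N0 m) (dtE m) => dp.
    by field; rewrite gt_eqF.
  under eq_fun do rewrite E.
  apply: (Ssum_cvg0 (i := i) (C := C * L0) (k := 0%N)); first by rewrite mulr_ge0.
  move=> m n K nN; rewrite -mulrBr normrM.
  have dp := dt_gt0 T0 (N0 m) (dtE m).
  have t1 := smp_time_taylor T0 tphi (N0 m) (dtE m) (sh m K) L00 nN pl0.
  rewrite /mesh_err mul0r addr0.
  have -> : C * L0 * dt m * (vol K + vol (nb i K)) = C * (vol K + vol (nb i K)) * (L0 * dt m) by ring.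
  apply: ler_pM => //; first exact: hV.
  rewrite -(ler_pM2l dp) -{1}(ger0_norm (ltW dp)) -normrM mulrBr mulrCA mulfV ?gt_eqF// mulr1.
  by rewrite (le_trans t1)// le_eqVlt; apply/orP; left; apply/eqP; ring.
have XE m : X m = - (\sum_K V m K * q m 0%N K * c m 0%N K) - Y m.
  rewrite /X (conserved_sum (c m) (cons m)) -/(Y m).
  (* The terms at the last level vanish: [N m * dt m = T], and [phi] is zero at time [T]. *)
  rewrite [X in X - _ - _]big1 ?sub0r// => K _.
  by rewrite /c /smp (NdtE (N0 m) (dtE m)) (test_end tphi) mulr0.
have cX' : X m @[m --> \oo] --> - l0 - lt.
  by under eq_fun do rewrite XE; apply: cvgB => //; exact: cvgN.
have E := cvg_unique (@Rhausdorff R) cX cX'.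
by rewrite E addrC subrK.
Qed.

(** The difference telescopes to the levels [N m] and 0, each a bounded sum multiplied by [dt m]. *)
Lemma Ssum_time_shift (X : family) C : 0 <= C ->
  (forall m n K, (n <= N m)%N -> `|X m n K| <= C * vol K) ->
  S m (fun n K => X m n.+1 K) - S m (X m) @[m --> \oo] --> 0.
Proof.
move=> C0 hX; apply: (@cvg0_le _ _ (fun m => 2 * (C * (tot muQ Q / T)) * dt m)); last exact: cvg0Z.
move=> m; rewrite -SsumB /Ssum.
rewrite (_ : \sum_(n < N m) _ = \sum_K X m (N m) K - \sum_K X m 0%N K); last first.
  elim: (N m) => [|M IH]; first by rewrite big_ord0 subrr.
  by rewrite big_ord_recr/= IH sumrB; ring.
have bd n : (n <= N m)%N -> `|\sum_K X m n K| <= C * (tot muQ Q / T).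
  move=> nN; rewrite (le_trans (ler_norm_sum _ _ _))// -(sum_vol m) mulr_sumr.
  by apply: ler_sum => K _; exact: hX.
rewrite normrM (ger0_norm (dts_ge0 m)) mulrC ler_wpM2r ?dts_ge0//.
rewrite (le_trans (ler_normB _ _))//.
have b1 := bd _ (leqnn (N m)); have b2 := bd 0%N (leq0n _).
by rewrite mulr2n mulrDl mul1r lerD.
Qed.

(** It serves the quantities that the scheme takes implicitly. Shifting [q] and [chi] together
    telescopes; sampling [chi] one level earlier then costs [L * dt]. *)
Lemma cell_limit_next (i : 'I_d) q f C : 0 <= C ->
  (forall m n K, (n <= N m)%N -> `|q m n K| <= C) ->
  cell_limit q f -> cell_limit (fun m n => q m n.+1) f.
Proof.
move=> C0 hq [bf wq]; split => // chi Lchi.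
have [M M0 hM] := lip_bounded T0 hab Lchi; have [L L0 pl] := Lchi.
apply: (cvg_shift0 _ (wq chi Lchi)).
pose X m n (K : cell (g m)) := vol K * (q m n K * smpm m chi n K).
have c1 : S m (fun n K => X m n.+1 K) - S m (X m) @[m --> \oo] --> 0.
  apply: (Ssum_time_shift (C := C * M)); first exact: mulr_ge0.
  move=> m n K nN; rewrite /X !normrM (ger0_norm (vol_ge0 K)) mulrC.
  rewrite ler_wpM2r ?vol_ge0// ler_pM ?hq//.
  exact: (smp_bounded T0 (N0 m) (dtE m) K hM).
have c2 : S m (fun n K => vol K * (q m n.+1 K * smpm m chi n K)) - S m (fun n K => X m n.+1 K)
    @[m --> \oo] --> 0.
  apply: (Ssum_cvg0 (i := i) (C := C * L) (k := 0%N)); first exact: mulr_ge0.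
  move=> m n K nN; rewrite /X -!mulrBr !normrM (ger0_norm (vol_ge0 K)).
  have v0 := vol_ge0 K; have v1 := vol_ge0 (nb i K).
  rewrite /mesh_err mul0r addr0 mulrC; apply: ler_pM; rewrite ?mulr_ge0 ?lerDl// -mulrA.
  apply: ler_pM; rewrite ?hq// distrC.
  exact: (smp_time_dist T0 (N0 m) (dtE m) K nN pl).
have := cvg0D c2 c1; apply: cvg_trans; apply: near_eq_cvg; apply: nearW => m /=.
by rewrite addrA subrK.
Qed.

Lemma Ssum_dual_vol m i : S m (fun _ K => dual_vol (i, K)) = tot muQ Q.
Proof.
have -> : S m (fun _ K => dual_vol (i, K)) = S m (fun _ K => 2^-1 * (vol K + vol (nb i K))).
  by apply: eq_Ssum => n K _; rewrite dual_volE mulrC.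
by rewrite SsumZ Ssum_vol_pair mulrA mulVf ?mul1r.
Qed.

Lemma int_limit_dist h f k psi M e : bmQ h -> bmQ f -> bmQ k -> bmQ psi ->
  (forall z, Q z -> `|h z * psi z| <= M) -> 0 <= M ->
  I (fun z => `|f z - k z|) <= e ->
  `|I (fun z => h z * (k z * psi z)) - I (fun z => h z * f z * psi z)| <= M * e.
Proof.
move=> bh bf bk bp hM M0 he.
have b1 : bmQ (fun z => h z * (k z * psi z)) by apply: bmM => //; exact: bmM.
have b2 : bmQ (fun z => h z * f z * psi z) by apply: bmM => //; exact: bmM.
have b3 := bm_norm (bmB bf bk).
rewrite (le_trans (int_dist mQ fQ b1 b2))// (le_trans _ (ler_wpM2l M0 he))//.
rewrite -(intZ mQ fQ _ b3); apply: (int_le mQ fQ).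
- exact: bm_norm (bmB b1 b2).
- exact: bmZ b3.
move=> z Qz; have -> : h z * (k z * psi z) - h z * f z * psi z =
  - (h z * psi z * (f z - k z)) by ring.
by rewrite normrN normrM ler_wpM2r// hM.
Qed.

(* The momentum carried by the dual cell of [(i, K)] is tested at the corner of
   the upper cell of the face. *)
Lemma dual_momentum_cvg i q u f uf C : 0 <= C ->
  (forall m n K, (n < N m)%N -> `|q m n K| <= C) ->
  cell_limit q f -> face_limit i u uf ->
  forall psi, lipQ psi ->
  S m (fun n K => (vol K * q m n K + vol (nb i K) * q m n (nb i K)) / 2 * u m n K
         * smpm m psi n (nb i K)) @[m --> \oo]
    --> I (fun z => f z * uf z * psi z).
Proof.
move=> C0 hq [bf wq] [bu hu] psi Lpsi.
have bpsi := lip_bm Lpsi.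
have [M M0 hM] := lip_bounded T0 hab Lpsi; have [Lp Lp0 plp] := Lpsi.
have [Cf Cf0 hCf] := bm_bound bf.
pose B := C * M + Cf * M + 1.
have B0 : 0 < B by rewrite ltr_wpDl// addr_ge0// mulr_ge0.
apply: (@cvg_by_approximation R (fun m => S m (fun n K =>
  (vol K * q m n K + vol (nb i K) * q m n (nb i K)) / 2 * u m n K
   * smpm m psi n (nb i K)))).
move=> e e0; have eB : 0 < e / B by rewrite divr_gt0.
have [k Lk hk] := lipschitz_approx bu eB.
have bk := lip_bm Lk; have [Mk Mk0 hMk] := lip_bounded T0 hab Lk; have [Lk' Lk0 plk] := Lk.
have [hd _ _ _ _] := hu _ Lk.
pose Y m n (K : cell (g m)) := (vol K * q m n K + vol (nb i K) * q m n (nb i K)) / 2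
   * smpm m k n K * smpm m psi n (nb i K).
have smpM m n (K : cell (g m)) : (n < N m)%N -> `|smpm m psi n K| <= M.
  by move=> nN; exact: (smp_bounded T0 (N0 m) (dtE m) K hM (ltnW nN)).
have smpMk m n (K : cell (g m)) : (n < N m)%N -> `|smpm m k n K| <= Mk.
  by move=> nN; exact: (smp_bounded T0 (N0 m) (dtE m) K hMk (ltnW nN)).
exists (fun m => S m (Y m)), (I (fun z => f z * (k z * psi z))),
  (fun m => C * M * S m (fun n K => dual_vol (i, K) * `|u m n K - smpm m k n K|)),
  (C * M * I (fun z => `|uf z - k z|)).
split.
- have w := wq _ (lipM T0 hab Lk Lpsi).
  apply: (cvg_shift0 _ w).
  (* The mass of the dual cell consists of two halves. The reference sum is split in the same way,
     with one half re-indexed to the upper cell, so that the comparison is made cell by cell. *)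
  have -> : (fun m => S m (Y m) - S m (fun n K => vol K * (q m n K * smpm m (fun z => k z * psi z) n K)))
    = (fun m => S m (Y m) - S m (fun n K => 2^-1 * (vol K * (q m n K * smpm m (fun z => k z * psi z) n K)
        + vol (nb i K) * (q m n (nb i K) * smpm m (fun z => k z * psi z) n (nb i K))))).
    apply/funext => m; congr (_ - _); rewrite SsumZ SsumD.
    rewrite (@Ssum_neighbor _ _ _ _ (g m) (N m) (dt m) true i
      (fun n K => vol K * (q m n K * smpm m (fun z => k z * psi z) n K))).
    by field.
  apply: (Ssum_cvg0 (i := i) (C := C * (Mk * Lp + M * Lk')) (k := 1%N)).
    by rewrite mulr_ge0// addr_ge0// mulr_ge0.
  move=> m n K nN.
  have v0 := vol_ge0 K; have v1 := vol_ge0 (nb i K).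
  have e1 := smp_neighbor_le T0 (N0 m) (dtE m) K i Lp0 (ltnW nN) plp.
  have e2 := smp_neighbor_le T0 (N0 m) (dtE m) K i Lk0 (ltnW nN) plk.
  have h0 := mesh_ge0 (g m); have dd := dts_ge0 m.
  have q0 := hq m n K nN; have q1 := hq m n (nb i K) nN.
  have m1 := smpM m n (nb i K) nN; have m2 := smpMk m n K nN.
  have heE : mesh_size (g m) <= err 1 m by rewrite /mesh_err mul1r lerDr.
  have := le_trans e1 (ler_wpM2l Lp0 heE); have := le_trans e2 (ler_wpM2l Lk0 heE).
  rewrite /Y (_ : smpm m (fun z => k z * psi z) n K = smpm m k n K * smpm m psi n K)//.
  rewrite (_ : smpm m (fun z => k z * psi z) n (nb i K) = smpm m k n (nb i K) * smpm m psi n (nb i K))//.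
  move: q0 q1 m1 m2; set qa := q m n K; set qb := q m n (nb i K).
  set pa := smpm m psi n K; set pb := smpm m psi n (nb i K).
  set ka := smpm m k n K; set kb := smpm m k n (nb i K).
  set va := vol K; set vb := vol (nb i K); set E := err 1 m.
  move=> q0 q1 m1 m2 e2' e1'.
  have E0 : 0 <= E by exact: le_trans h0 heE.
  have -> : (va * qa + vb * qb) / 2 * ka * pb - 2^-1 * (va * (qa * (ka * pa)) + vb * (qb * (kb * pb)))
     = 2^-1 * (va * (qa * (ka * (pb - pa)))) - 2^-1 * (vb * (qb * ((kb - ka) * pb))) by field.
  rewrite (le_trans (ler_normB _ _))// !normrM (ger0_norm v0) (ger0_norm v1).
  rewrite (ger0_norm (_ : 0 <= 2^-1))//.
  have t1 : va * (`|qa| * (`|ka| * `|pb - pa|)) <= va * (C * (Mk * (Lp * E))).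
    by rewrite !ler_wpM2l// !ler_pM// ?mulr_ge0.
  have t2 : vb * (`|qb| * (`|kb - ka| * `|pb|)) <= vb * (C * (Lk' * E * M)).
    by rewrite !ler_wpM2l// !ler_pM// ?mulr_ge0.
  have t3 : 0 <= va * (C * (Lk' * E * M)) by rewrite !mulr_ge0.
  have t4 : 0 <= vb * (C * (Mk * (Lp * E))) by rewrite !mulr_ge0.
  have t5 : 0 <= va * (C * (Mk * (Lp * E))) by rewrite !mulr_ge0.
  have t6 : 0 <= vb * (C * (Lk' * E * M)) by rewrite !mulr_ge0.
  have -> : C * (Mk * Lp + M * Lk') * E * (va + vb) =
    va * (C * (Mk * (Lp * E))) + vb * (C * (Lk' * E * M))
    + (va * (C * (Lk' * E * M)) + vb * (C * (Mk * (Lp * E)))) by ring.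
  rewrite -/va -/vb; lra.
- apply: (@le_trans _ _ (Cf * M * (e / B))).
    apply: (int_limit_dist (h := f) (f := uf) bf bu bk bpsi) => //; last exact: mulr_ge0.
    by move=> z Qz; rewrite normrM ler_pM// ?hCf//; exact/hM/Q_slab.
  rewrite mulrA ler_pdivrMr// mulrC ler_wpM2l ?ltW// /B.
  have := mulr_ge0 C0 M0; lra.
- exact: cvgMl_tmp.
- apply: (@le_trans _ _ (C * M * (e / B))); first by rewrite ler_wpM2l// mulr_ge0.
  rewrite mulrA ler_pdivrMr// mulrC ler_wpM2l ?ltW// /B.
  have := mulr_ge0 Cf0 M0; lra.
- move=> m; rewrite -SsumZ; apply: (Ssum_dist (dts_ge0 m)) => n K nN.
  have v0 := vol_ge0 K; have v1 := vol_ge0 (nb i K).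
  rewrite /Y -mulrBl -mulrBr !normrM dual_volE.
  have -> : C * M * ((vol K + vol (nb i K)) / 2 * `|u m n K - smpm m k n K|) =
    (vol K + vol (nb i K)) * C / 2 * `|u m n K - smpm m k n K| * M by ring.
  rewrite ler_pM ?mulr_ge0//; last exact: smpM.
  rewrite ler_wpM2r// [`|2^-1|]ger0_norm// ler_wpM2r//.
  rewrite (le_trans (ler_normD _ _))// !normrM (ger0_norm v0) (ger0_norm v1) mulrDl.
  by rewrite lerD// ler_wpM2l// hq.
Qed.

(** The mass flux [F] already converges weakly, with its upwinding included. Of the upwind velocity
    it only matters that it is one of the two velocities adjacent to the dual face. The two weight
    bounds let the dual cell of either one absorb the flux, so that its L^1 distance to a Lipschitz
    function controls the error. *)
Lemma momentum_flux_cvg i j (F up : family) u h uf CF Cw : 0 <= CF -> 0 <= Cw -> bmQ h ->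
  (forall m n K, (n < N m)%N -> `|F m n K| <= CF * area (j, K)) ->
  (forall psi, lipQ psi -> S m (fun n K => F m n K * side K j * smpm m psi n K)
     @[m --> \oo] --> I (fun z => h z * psi z)) ->
  (forall psi, lipQ psi ->
     S m (fun n K => F m n K * (side (nb i K) j - side K j) * smpm m psi n K)
     @[m --> \oo] --> 0) ->
  face_limit i u uf ->
  (forall m n K, up m n K = u m n K \/ up m n K = u m n (nb j K)) ->
  (forall m (K : cell (g m)), (area (j, K) + area (j, nb i K)) * side (nb i K) j
     <= Cw * dual_vol (i, K)) ->
  (forall m (K : cell (g m)), (area (j, K) + area (j, nb i K)) * side (nb i K) j
     <= Cw * dual_vol (i, nb j K)) ->
  forall psi, lipQ psi ->
  S m (fun n K => (F m n K + F m n (nb i K)) / 2 * up m n K * side (nb i K) j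
         * smpm m psi n (nb i K)) @[m --> \oo]
    --> I (fun z => h z * uf z * psi z).
Proof.
move=> CF0 Cw0 bh hF wF vF [bu hu] hup w1 w2 psi Lpsi.
have bpsi := lip_bm Lpsi.
have [M M0 hM] := lip_bounded T0 hab Lpsi; have [Lp Lp0 plp] := Lpsi.
have [Ch Ch0 hCh] := bm_bound bh.
pose A := CF * Cw * M.
have A0 : 0 <= A by rewrite !mulr_ge0.
pose B := A + Ch * M + 1.
have B0 : 0 < B by rewrite ltr_wpDl// addr_ge0// mulr_ge0.
apply: (@cvg_by_approximation R (fun m => S m (fun n K =>
  (F m n K + F m n (nb i K)) / 2 * up m n K * side (nb i K) j * smpm m psi n (nb i K)))).
move=> e e0; have eB : 0 < e / B by rewrite divr_gt0.
have [k Lk hk] := lipschitz_approx bu eB.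
have bk := lip_bm Lk; have [Mk Mk0 hMk] := lip_bounded T0 hab Lk; have [L L0 plk] := Lk.
have [hd _ _ _ _] := hu _ Lk.
have Lkp := lipM T0 hab Lk Lpsi; have [Lkp' Lkp0 plkp] := Lkp.
pose kp z := k z * psi z.
pose Y m n (K : cell (g m)) := (F m n K + F m n (nb i K)) / 2
   * smpm m k n K * side (nb i K) j * smpm m psi n (nb i K).
have smpM m n (K : cell (g m)) : (n < N m)%N -> `|smpm m psi n K| <= M.
  by move=> nN; exact: (smp_bounded T0 (N0 m) (dtE m) K hM (ltnW nN)).
have smpMk m n (K : cell (g m)) : (n < N m)%N -> `|smpm m k n K| <= Mk.
  by move=> nN; exact: (smp_bounded T0 (N0 m) (dtE m) K hMk (ltnW nN)).
pose D m n (K : cell (g m)) := dual_vol (i, K) * `|u m n K - smpm m k n K|.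
exists (fun m => S m (Y m)), (I (fun z => h z * (k z * psi z))),
  (fun m => A * S m (D m) + A * L * tot muQ Q * mesh_size (g m)),
  (A * I (fun z => `|uf z - k z|) + 0).
split.
- have c1 := wF _ Lkp; have c2 := vF _ Lkp.
  (* The upper flux is re-indexed to its own cell. The lower flux appears with the side of the upper
     cell, and the discrepancy is the flux variation, which vanishes by [vF]. *)
  have E m : S m (fun n K => 2^-1 * (F m n K * side K j * smpm m kp n K
       + F m n K * (side (nb i K) j - side K j) * smpm m kp n K)
       + 2^-1 * (F m n (nb i K) * side (nb i K) j * smpm m kp n (nb i K))) =
     S m (fun n K => F m n K * side K j * smpm m kp n K)
     + 2^-1 * S m (fun n K => F m n K * (side (nb i K) j - side K j) * smpm m kp n K).
    rewrite SsumD !SsumZ SsumD.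
    rewrite (@Ssum_neighbor _ _ _ _ (g m) (N m) (dt m) true i
      (fun n K => F m n K * side K j * smpm m kp n K)).
    by field.
  apply: (@cvg_shift0 _ _ (fun m => S m (fun n K => F m n K * side K j * smpm m kp n K)
     + 2^-1 * S m (fun n K => F m n K * (side (nb i K) j - side K j) * smpm m kp n K)));
    last by have := cvgD c1 (cvg0Z 2^-1 c2); rewrite addr0; exact.
  under eq_fun do rewrite -E.
  apply: (Ssum_cvg0 (i := i) (C := CF * Cw * (Lkp' + M * L)) (k := 1%N)).
    by rewrite !mulr_ge0// addr_ge0// mulr_ge0.
  move=> m n K nN.
  have h0 := mesh_ge0 (g m); have dd := dts_ge0 m.
  have heE : mesh_size (g m) <= err 1 m by rewrite /mesh_err mul1r lerDr.
  have E0 : 0 <= err 1 m by exact: le_trans h0 heE.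
  have := le_trans (smp_neighbor_le T0 (N0 m) (dtE m) K i Lkp0 (ltnW nN) plkp) (ler_wpM2l Lkp0 heE).
  have := le_trans (smp_neighbor_le T0 (N0 m) (dtE m) K i L0 (ltnW nN) plk) (ler_wpM2l L0 heE).
  have m1 := smpM m n (nb i K) nN.
  have v0 := vol_ge0 K; have v1 := vol_ge0 (nb i K).
  have s1 := side_ge0 (nb i K) j.
  have a0 := area_ge0 (j, K); have a1 := area_ge0 (j, nb i K).
  have f0 := hF m n K nN; have f1 := hF m n (nb i K) nN.
  have := w1 m K; rewrite /Y.
  rewrite (_ : smpm m (fun z => k z * psi z) n (nb i K) = smpm m kp n (nb i K))//.
  rewrite (_ : smpm m (fun z => k z * psi z) n K = smpm m kp n K)//.
  have -> : smpm m kp n (nb i K) = smpm m k n (nb i K) * smpm m psi n (nb i K) by [].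
  move: m1 f0 f1; rewrite dual_volE.
  set pb := smpm m psi n (nb i K); set ka := smpm m k n K; set kb := smpm m k n (nb i K).
  set kpa := smpm m kp n K; set sb := side (nb i K) j in s1 *; set sa := side K j.
  set Fa := F m n K; set Fb := F m n (nb i K); set E1 := err 1 m in E0 *.
  set aa := area (j, K) in a0 *; set ab := area (j, nb i K) in a1 *.
  set W := vol K + vol (nb i K); move=> m1 f0 f1 hw ek ekp.
  have -> : (Fa + Fb) / 2 * ka * sb * pb -
    (2^-1 * (Fa * sa * kpa + Fa * (sb - sa) * kpa) + 2^-1 * (Fb * sb * (kb * pb))) =
    2^-1 * (Fa * sb * (kb * pb - kpa)) - 2^-1 * ((Fa + Fb) * sb * ((kb - ka) * pb)) by field.
  have W0 : 0 <= W by rewrite addr_ge0.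
  have t1 : `|Fa * sb * (kb * pb - kpa)| <= CF * (Cw * (W / 2)) * (Lkp' * E1).
    rewrite normrM ler_pM// normrM (ger0_norm s1) (le_trans (ler_wpM2r s1 f0))//.
    rewrite -mulrA ler_wpM2l// (le_trans _ hw)// ler_wpM2r// lerDl//.
  have t2 : `|(Fa + Fb) * sb * ((kb - ka) * pb)| <= CF * (Cw * (W / 2)) * (L * E1 * M).
    rewrite normrM ler_pM//; last by rewrite normrM ler_pM.
    rewrite normrM (ger0_norm s1); apply: (@le_trans _ _ ((CF * (aa + ab)) * sb)).
      by rewrite ler_wpM2r// (le_trans (ler_normD _ _))// mulrDr lerD.
    by rewrite -mulrA ler_wpM2l.
  rewrite (le_trans (ler_normB _ _))// [`|2^-1 * _|]normrM [X in _ + X]normrM.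
  rewrite (ger0_norm (_ : 0 <= 2^-1))//.
  have t3 : 0 <= CF * (Cw * (W / 2)) * (Lkp' * E1) by rewrite !mulr_ge0// divr_ge0.
  have t4 : 0 <= CF * (Cw * (W / 2)) * (L * E1 * M) by rewrite !mulr_ge0// divr_ge0.
  have -> : CF * Cw * (Lkp' + M * L) * E1 * W =
    2 * (CF * (Cw * (W / 2)) * (Lkp' * E1)) + 2 * (CF * (Cw * (W / 2)) * (L * E1 * M)) by field.
  lra.
- apply: (@le_trans _ _ (Ch * M * (e / B))).
    apply: (int_limit_dist (h := h) (f := uf) bh bu bk bpsi) => //; last exact: mulr_ge0.
    by move=> z Qz; rewrite normrM ler_pM// ?hCh//; exact/hM/Q_slab.
  rewrite mulrA ler_pdivrMr// mulrC ler_wpM2l ?ltW// /B; lra.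
- apply: cvgD; first exact: cvgMl_tmp.
  exact: cvg0Z.
- rewrite addr0 (le_trans (ler_wpM2l A0 hk))// mulrA ler_pdivrMr// mulrC.
  rewrite ler_wpM2l ?ltW// /B; have := mulr_ge0 Ch0 M0; lra.
- move=> m.
  have E1 : S m (D m) = S m (fun n K => D m n (nb j K)).
    by rewrite (@Ssum_neighbor _ _ _ _ (g m) (N m) (dt m) true j (D m)).
  have -> : A * S m (D m) + A * L * tot muQ Q * mesh_size (g m) =
    S m (fun n K => A / 2 * D m n K + A / 2 * D m n (nb j K)
       + A * L * mesh_size (g m) * dual_vol (i, K)).
    by rewrite !SsumD !SsumZ -E1 Ssum_dual_vol; field.
  apply: (Ssum_dist (dts_ge0 m)) => n K nN.
  have h0 := mesh_ge0 (g m).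
  have := smp_neighbor_le T0 (N0 m) (dtE m) K j L0 (ltnW nN) plk.
  have := w1 m K; have := w2 m K.
  have m1 := smpM m n (nb i K) nN.
  have s1 := side_ge0 (nb i K) j.
  have a0 := area_ge0 (j, K); have a1 := area_ge0 (j, nb i K).
  have f0 := hF m n K nN; have f1 := hF m n (nb i K) nN.
  have D0 := dual_vol_ge0 (i, K); have D1 := dual_vol_ge0 (i, nb j K).
  have hupm := hup m n K.
  rewrite /Y /D; move: m1 f0 f1 hupm.
  set pb := smpm m psi n (nb i K); set ka := smpm m k n K; set kb := smpm m k n (nb j K).
  set sb := side (nb i K) j in s1 *.
  set Fa := F m n K; set Fb := F m n (nb i K).
  set aa := area (j, K) in a0 *; set ab := area (j, nb i K) in a1 *.
  set da := dual_vol (i, K) in D0 *; set db := dual_vol (i, nb j K) in D1 *.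
  set ua := u m n K; set ub := u m n (nb j K); set uu := up m n K.
  move=> m1 f0 f1 hupm hw2 hw1 ek.
  have -> : (Fa + Fb) / 2 * uu * sb * pb - (Fa + Fb) / 2 * ka * sb * pb =
    2^-1 * ((Fa + Fb) * sb * pb * (uu - ka)) by ring.
  rewrite normrM (ger0_norm (_ : 0 <= 2^-1))// normrM.
  have c0 : 0 <= CF * M by exact: mulr_ge0.
  have wt w0 : (aa + ab) * sb <= Cw * w0 -> `|(Fa + Fb) * sb * pb| <= A * w0.
    move=> hw; have -> : A * w0 = CF * (Cw * w0) * M by rewrite /A; ring.
    rewrite normrM ler_pM// normrM (ger0_norm s1); apply: (@le_trans _ _ ((CF * (aa + ab)) * sb)).
      by rewrite ler_wpM2r// (le_trans (ler_normD _ _))// mulrDr lerD.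
    by rewrite -mulrA ler_wpM2l.
  have wa := wt _ hw1; have wb := wt _ hw2.
  have nn : 0 <= `|(Fa + Fb) * sb * pb| by [].
  set w0 := `|(Fa + Fb) * sb * pb| in wa wb nn *.
  have p1 : 0 <= A * da * `|ua - ka| by apply: mulr_ge0 => //; exact: mulr_ge0.
  have p2 : 0 <= A * db * `|ub - kb| by apply: mulr_ge0 => //; exact: mulr_ge0.
  have p3 : 0 <= A * da * (L * mesh_size (g m)) by apply: mulr_ge0; exact: mulr_ge0.
  have -> : A / 2 * (da * `|ua - ka|) + A / 2 * (db * `|ub - kb|) + A * L * mesh_size (g m) * da =
    2^-1 * (A * da * `|ua - ka|) + 2^-1 * (A * db * `|ub - kb|) + A * da * (L * mesh_size (g m)).
    by ring.
  (* Each velocity is compared with [k] at its own dual cell. In the second case [k] is then moved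
     from [nb j K] back to [K], at the cost [L * h]. *)
  case: hupm => ->.
    have q1 : w0 * `|ua - ka| <= A * da * `|ua - ka| by rewrite ler_wpM2r.
    lra.
  have q2 : w0 * `|ub - ka| <= A * db * `|ub - kb| + A * da * (L * mesh_size (g m)).
    have tri : `|ub - ka| <= `|ub - kb| + `|kb - ka| by exact: ler_distD.
    rewrite (le_trans (ler_wpM2l nn tri))// mulrDr lerD//; first by rewrite ler_wpM2r.
    by rewrite ler_pM.
  lra.
Qed.

(** A jump is at most the distances of the two values to a fixed Lipschitz function plus the jump of
    that function, which is O(h). Comparing [dt] with the sides turns [dt * area] into the volume of
    either cell, and the distances become L^1 errors. *)
Lemma pressure_jump_cvg0 i p pf C Cmu : 0 <= C -> 0 <= Cmu -> bmQ pf ->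
  (forall m n K, (n <= N m)%N -> `|p m n K| <= C) ->
  (forall chi, lipQ chi -> S m (fun n K => vol K * `|p m n K - smpm m chi n K|)
     @[m --> \oo] --> I (fun z => `|pf z - chi z|)) ->
  (forall m (K : cell (g m)) j, dt m <= Cmu * side K j) ->
  S m (fun n K => dt m * area (i, K) * `|p m n.+1 (nb i K) - p m n.+1 K|)
    @[m --> \oo] --> 0.
Proof.
move=> C0 Cmu0 bp hp sp hdt.
apply: (@cvg_by_approximation R (fun m => S m (fun n K =>
  dt m * area (i, K) * `|p m n.+1 (nb i K) - p m n.+1 K|))).
move=> e e0; have eB : 0 < e / (2 * Cmu + 1).
  by rewrite divr_gt0// ltr_wpDl// mulr_ge0.
have [k Lk hk] := lipschitz_approx bp eB.
have [M M0 hM] := lip_bounded T0 hab Lk; have [L L0 pl] := Lk.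
pose X m n (K : cell (g m)) := vol K * `|p m n K - smpm m k n K|.
have cX : S m (fun n K => X m n.+1 K) @[m --> \oo] --> I (fun z => `|pf z - k z|).
  apply: (cvg_shift0 _ (sp k Lk)); apply: (Ssum_time_shift (C := C + M)); first exact: addr_ge0.
  move=> m n K nN; rewrite /X normrM normr_id (ger0_norm (vol_ge0 K)) mulrC.
  rewrite ler_wpM2r ?vol_ge0// (le_trans (ler_normB _ _))// lerD ?hp//.
  exact: (smp_bounded T0 (N0 m) (dtE m) K hM).
exists (fun=> 0), 0,
  (fun m => Cmu * (2 * S m (fun n K => X m n.+1 K) + L * tot muQ Q * mesh_size (g m))),
  (Cmu * (2 * I (fun z => `|pf z - k z|) + 0)).
split; [exact: cvg_cst|by rewrite subr0 normr0 ltW| | |].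
- by apply: cvgMl_tmp; apply: cvgD; [exact: cvgMl_tmp|exact: cvg0Z].
- rewrite addr0 (le_trans (ler_wpM2l Cmu0 (ler_wpM2l _ hk)))//.
  have -> : Cmu * (2 * (e / (2 * Cmu + 1))) = 2 * Cmu * e / (2 * Cmu + 1) by ring.
  rewrite ler_pdivrMr; last by rewrite ltr_wpDl// mulr_ge0.
  by rewrite [e * _]mulrC ler_wpM2r ?lerDl// ltW.
- move=> m; rewrite subr0.
  have E1 : S m (fun n K => X m n.+1 K) = S m (fun n K => X m n.+1 (nb i K)).
    by rewrite (@Ssum_neighbor _ _ _ _ (g m) (N m) (dt m) true i (fun n K => X m n.+1 K)).
  have -> : Cmu * (2 * S m (fun n K => X m n.+1 K) + L * tot muQ Q * mesh_size (g m)) =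
    S m (fun n K => Cmu * (X m n.+1 (nb i K) + X m n.+1 K + L * mesh_size (g m) * vol K)).
    by rewrite SsumZ !SsumD SsumZ Ssum_vol -E1; ring.
  apply: (Ssum_norm_le (dts_ge0 m)) => n K nN.
  have v0 := vol_ge0 K; have v1 := vol_ge0 (nb i K); have a0 := area_ge0 (i, K).
  have dd := dts_ge0 m.
  have e1 := smp_neighbor_le T0 (N0 m) (dtE m) K i L0 nN pl.
  have w0 : dt m * area (i, K) <= Cmu * vol K.
    by rewrite (vol_area i) mulrCA mulrC ler_wpM2l// hdt.
  have w1 : dt m * area (i, K) <= Cmu * vol (nb i K).
    by rewrite -(area_side_neighbor _ i) mulrCA mulrC ler_wpM2l// hdt.
  rewrite normrM normr_id ger0_norm ?mulr_ge0// /X.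
  set pa := p m n.+1 K; set pb := p m n.+1 (nb i K).
  set ka := smpm m k n.+1 K in e1 *; set kb := smpm m k n.+1 (nb i K) in e1 *.
  have t : `|pb - pa| <= `|pb - kb| + `|pa - ka| + `|kb - ka|.
    have -> : pb - pa = (pb - kb) - (pa - ka) + (kb - ka) by ring.
    by rewrite (le_trans (ler_normD _ _))// lerD2r ler_normB.
  have W0 : 0 <= dt m * area (i, K) by exact: mulr_ge0.
  rewrite (le_trans (ler_wpM2l W0 t))//.
  have q1 : dt m * area (i, K) * `|pb - kb| <= Cmu * vol (nb i K) * `|pb - kb|.
    by rewrite ler_wpM2r.
  have q2 : dt m * area (i, K) * `|pa - ka| <= Cmu * vol K * `|pa - ka|.
    by rewrite ler_wpM2r.
  have q3 : dt m * area (i, K) * `|kb - ka| <= Cmu * vol K * (L * mesh_size (g m)).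
    by rewrite ler_pM.
  have -> : Cmu * (vol (nb i K) * `|pb - kb| + vol K * `|pa - ka| + L * mesh_size (g m) * vol K) =
    Cmu * vol (nb i K) * `|pb - kb| + Cmu * vol K * `|pa - ka|
    + Cmu * vol K * (L * mesh_size (g m)) by ring.
  rewrite !mulrDr; lra.
Qed.

Lemma int_time_constant (f : 'rV[R]_d -> R) : bm (Omega a b) f ->
  bmQ (fun z => f z.2) /\
  I (fun z => f z.2) = T * Rintegral (lebesgue_rV d) (Omega a b) f.
Proof.
move=> bf; have [mf [M hM]] := bf.
have bmf : bmQ (fun z => f z.2).
  split; last by exists M => z [_ Oz]; exact: hM.
  apply: (measurable_comp (measurable_Omega a b) _ mf (g := @snd (measurableTypeR R) _)).
    by move=> _ [z [_ Oz] <-].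
  by apply: measurable_funTS; exact: measurable_snd.
split => //.
pose F : measurableTypeR R * 'rV[R]_d -> \bar R := (fun z => (f z.2)%:E) \_ Q.
have iF : muQ.-integrable setT F.
  by apply/(integrable_mkcond _ mQ).1; exact: (bm_int mQ fQ bmf).
have fO := lebesgue_Omega_fin hab; have mO := @measurable_Omega R d a b.
pose c := Rintegral (lebesgue_rV d) (Omega a b) f.
have cE : (\int[lebesgue_rV d]_(x in Omega a b) (f x)%:E)%E = c%:E.
  by rewrite /c /Rintegral fineK//; apply: integrable_fin_num => //; exact: bm_int.
have inner t : (\int[lebesgue_rV d]_x F (t, x))%E = (c * \1_(`]0, T[%classic) t)%:E.
  rewrite indicE; case: (boolP (t \in `]0, T[%classic)) => tT.
    rewrite mulr1 -cE [RHS]integral_mkcond; apply: eq_integral => x _.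
    rewrite /F /patch; congr (if _ then _ else _).
    apply/idP/idP; rewrite !inE; first by case.
    by move=> Ox; split => //; exact: set_mem tT.
  rewrite mulr0 integral0_eq// => x _; rewrite /F patchE ifF//.
  by apply/negP => /set_mem[/= tT' _]; move/negP: tT; apply; exact: mem_set.
rewrite [LHS]/Rintegral integral_mkcond.
have -> : (\int[muQ]_x ((fun z => (f z.2)%:E) \_ Q) x)%E =
    (\int[@lebesgue_measure R]_t \int[lebesgue_rV d]_x F (t, x))%E.
  by rewrite (integral12_prod_meas1 iF).
under eq_integral do rewrite inner.
have mI : measurable (`]0, T[%classic : set R) by exact: measurable_itv.
transitivity (Rintegral (@lebesgue_measure R) setT (fun t => c * \1_(`]0, T[%classic) t)) => //.
rewrite RintegralZl//; last first.
  exact: (@integrable_indic_itv R 0 T false true).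
rewrite [X in c * X = _](_ : _ = T); first by rewrite mulrC.
rewrite /Rintegral integral_indic// setIT [X in fine X](lebesgue_measure_itv `]0, T[)/=.
by rewrite lte_fin T0 oppr0 adde0.
Qed.

Lemma piecewise_L1_cell q f C :
  (forall m n K, (n < N m)%N -> `|q m n K| <= C) -> bmQ f ->
  (forall z, Q z -> `|f z| <= C) -> 0 <= C ->
  I (fun z => `|piecewise (@cell_set _ _ _ _ (g m)) (dt m) (N m) (q m) z - f z|) @[m --> \oo] --> 0 ->
  cell_limit q f /\
  forall chi, lipQ chi -> S m (fun n K => vol K * `|q m n K - smpm m chi n K|)
     @[m --> \oo] --> I (fun z => `|f z - chi z|).
Proof.
move=> hq bf hf C0 cv.
have near m L k n (K : cell (g m)) t x : 0 <= L -> (n < N m)%N ->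
  plip T a b L k -> time_slot (dt m) n t -> cell_set K x ->
  `|k (t, x) - smp (dt m) k n K| <= L * err d m.
  by move=> L0 nN pl ts Kx; exact: (smp_cell T0 (N0 m) (dtE m) L0 nN pl ts Kx).
have main := Ssum_cvg T0 hab N0 dtE dt_cvg h_cvg (@cell_measure _ _ _ _ g)
  (fun m => @cell_set_Omega _ _ _ _ (g m)) (fun m => @cell_of _ _ _ _ (g m))
  (fun m => @cell_set_inj _ _ _ _ (g m)) near (J := [set y | `|y| <= C]).
split; first split => //.
- move=> chi Lchi; apply: (main (fun y s => y * s) (fun M => C + M) q f chi) => //.
  + move=> M y y' s s' hy hy' hs hs'.
    have -> : y * s - y' * s' = y * (s - s') + s' * (y - y') by ring.
    rewrite (le_trans (ler_normD _ _))// !normrM mulrDr addrC lerD// ler_wpM2r//.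
      by rewrite (le_trans hs')// lerDr.
    by rewrite (le_trans hy)// lerDl (le_trans _ hs).
  + by move=> M M0; rewrite addr_ge0.
  + by apply: bmM => //; exact: lip_bm.
- move=> chi Lchi; apply: (main (fun y s => `|y - s|) (fun=> 1) q f chi) => //.
  + move=> M y y' s s' _ _ _ _; rewrite mul1r.
    rewrite (le_trans (ler_dist_dist _ _))//.
    have -> : y - s - (y' - s') = (y - y') - (s - s') by ring.
    exact: ler_normB.
  + by apply: bm_norm; apply: bmB => //; exact: lip_bm.
Qed.

Lemma pos_lip (x y : R) : `|pos x - pos y| <= `|x - y|.
Proof.
rewrite /pos; have h := ler_norm (x - y); have h' := ler_norm (- (x - y)).
rewrite normrN in h'.
by case: (ltP x 0) => hx; case: (ltP y 0) => hy; rewrite ler_norml; apply/andP; split; lra.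
Qed.

Lemma neg_lip (x y : R) : `|neg x - neg y| <= `|x - y|.
Proof.
rewrite /neg; have h := ler_norm (x - y); have h' := ler_norm (- (x - y)).
rewrite normrN in h'.
by case: (ltP x 0) => hx; case: (ltP y 0) => hy; rewrite ler_norml; apply/andP; split; lra.
Qed.

Lemma pos_norm (x : R) : `|pos x| <= `|x|.
Proof. by have := pos_lip x 0; rewrite /pos maxxx !subr0. Qed.

Lemma neg_norm (x : R) : `|neg x| <= `|x|.
Proof. by have := neg_lip x 0; rewrite /neg minxx !subr0. Qed.

Lemma piecewise_L1_face i (u : family) f C :
  (forall m n K, (n < N m)%N -> `|u m n K| <= C) -> bmQ f ->
  (forall z, Q z -> `|f z| <= C) -> 0 <= C ->
  I (fun z => `|piecewise (fun K : cell (g m) => dual_set (i, K)) (dt m) (N m) (u m) z - f z|)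
    @[m --> \oo] --> 0 ->
  face_limit i u f.
Proof.
move=> hq bf hf C0 cv.
have near m L k n (K : cell (g m)) t x : 0 <= L -> (n < N m)%N ->
  plip T a b L k -> time_slot (dt m) n t -> dual_set (i, K) x ->
  `|k (t, x) - smp (dt m) k n K| <= L * err d.+1 m.
  by move=> L0 nN pl ts Kx; exact: (smp_dual T0 (N0 m) (dtE m) L0 nN pl ts Kx).
have main := Ssum_cvg T0 hab N0 dtE dt_cvg h_cvg (fun m => @dual_set_measure _ _ _ _ (g m) i)
  (fun m => @dual_set_Omega _ _ _ _ (g m) i) (fun m => @dual_of _ _ _ _ (g m) i)
  (fun m => @dual_set_inj _ _ _ _ (g m) i) near (J := [set y | `|y| <= C]).
have dist_lip (p : R -> R) : (forall x y, `|p x - p y| <= `|x - y|) -> forall y y' s s' : R,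
    `| `|p y - s| - `|p y' - s'| | <= 1 * (`|y - y'| + `|s - s'|).
  move=> hp y y' s s'; rewrite mul1r (le_trans (ler_dist_dist _ _))//.
  have -> : p y - s - (p y' - s') = (p y - p y') - (s - s') by ring.
  by rewrite (le_trans (ler_normB _ _))// lerD.
have prod_lip (p : R -> R) : (forall x y, `|p x - p y| <= `|x - y|) ->
    (forall x, `|p x| <= `|x|) -> forall M y y' s s' : R, `|y| <= C -> `|s| <= M -> `|s'| <= M ->
    `| `|p y * s| - `|p y' * s'| | <= (C + M) * (`|y - y'| + `|s - s'|).
  move=> hp hp' M y y' s s' hy hs hs'; rewrite (le_trans (ler_dist_dist _ _))//.
  have -> : p y * s - p y' * s' = p y * (s - s') + s' * (p y - p y') by ring.
  rewrite (le_trans (ler_normD _ _))// !normrM mulrDr addrC lerD//.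
    by rewrite ler_pM// (le_trans hs')// lerDr.
  by rewrite ler_pM// (le_trans (hp' y))// (le_trans hy)// lerDl (le_trans _ hs).
split => // chi Lchi; have bchi := lip_bm Lchi; split.
- apply: (main (fun y s => `|y - s|) (fun=> 1) u f chi) => //.
  + by move=> M y y' s s' _ _ _ _; exact: (dist_lip id).
  + by apply: bm_norm; exact: bmB.
- apply: (main (fun y s => `|pos y - s|) (fun=> 1) u f chi) => //.
  + by move=> M y y' s s' _ _ _ _; apply: dist_lip; exact: pos_lip.
  + by apply: bm_norm; apply: bmB => //; exact: bm_pos.
- apply: (main (fun y s => `|neg y - s|) (fun=> 1) u f chi) => //.
  + by move=> M y y' s s' _ _ _ _; apply: dist_lip; exact: neg_lip.
  + by apply: bm_norm; apply: bmB => //; exact: bm_neg.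
- apply: (main (fun y s => `|pos y * s|) (fun M => C + M) u f chi) => //.
  + by move=> M y y' s s' *; apply: prod_lip => //; [exact: pos_lip|exact: pos_norm].
  + by move=> M M0; rewrite addr_ge0.
  + by apply: bm_norm; apply: bmM => //; exact: bm_pos.
- apply: (main (fun y s => `|neg y * s|) (fun M => C + M) u f chi) => //.
  + by move=> M y y' s s' *; apply: prod_lip => //; [exact: neg_lip|exact: neg_norm].
  + by move=> M M0; rewrite addr_ge0.
  + by apply: bm_norm; apply: bmM => //; exact: bm_neg.
Qed.

(** Mean value theorem: since [gamma > 1], the derivative [gamma * s ^ (gamma - 1)] is largest at
    [hi]. *)
Lemma powR_lipschitz (gamma lo hi : R) : 1 < gamma -> 0 < lo -> lo <= hi ->
  exists2 L, 0 <= L & forall x y, lo <= x <= hi -> lo <= y <= hi ->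
    `|x `^ gamma - y `^ gamma| <= L * `|x - y|.
Proof.
move=> g1 lo0 lohi; exists (gamma * hi `^ (gamma - 1)).
  by rewrite mulr_ge0 ?powR_ge0// ltW// (lt_trans ltr01).
have main x y : lo <= x -> x <= y -> y <= hi ->
    `|y `^ gamma - x `^ gamma| <= gamma * hi `^ (gamma - 1) * `|y - x|.
  move=> lox xy yhi.
  have der s : x <= s -> is_derive s 1 (@powR R ^~ gamma) (gamma * s `^ (gamma - 1)).
    by move=> xs; apply: (@is_derive1_powR R gamma s); exact: lt_le_trans lo0 (le_trans lox xs).
  have [||c] := @MVT_segment R (@powR R ^~ gamma) (fun s => gamma * s `^ (gamma - 1)) x y xy.
  - by move=> s; rewrite in_itv/= => /andP[xs _]; apply: der; exact: ltW.
  - apply: derivable_within_continuous => s; rewrite in_itv/= => /andP[xs _].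
    by have [] := der s xs.
  rewrite in_itv/= => /andP[xc cy] ->; rewrite normrM ler_wpM2r//.
  rewrite ger0_norm ?mulr_ge0 ?powR_ge0//; last by rewrite ltW// (lt_trans ltr01).
  rewrite ler_wpM2l//; first by rewrite ltW// (lt_trans ltr01).
  apply: ge0_ler_powR.
  - by rewrite subr_ge0 ltW.
  - by rewrite nnegrE ltW// (lt_le_trans lo0)// (le_trans lox).
  - by rewrite nnegrE ltW// (lt_le_trans lo0).
  - exact: le_trans cy yhi.
move=> x y /andP[lx xh] /andP[ly yh]; have [xy|/ltW yx] := leP x y.
  by rewrite distrC [`|x - y|]distrC main.
exact: main.
Qed.

Lemma time_constant_sum m (c : cell (g m) -> R) : S m (fun _ K => c K) = T * \sum_K c K.
Proof.
rewrite /Ssum sumr_const card_ord -mulr_natl mulrA [dt m * _]mulrC.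
by rewrite (NdtE (N0 m) (dtE m)).
Qed.

(** * L^1 convergence of compositions, products and averages *)

Section partition_L1.
Variables (A : forall m, cell (g m) -> set 'rV[R]_d) (V : forall m, cell (g m) -> R).
Hypothesis A_measure : forall m (K : cell (g m)),
  measurable (A K) /\ lebesgue_rV d (A K) = (V K)%:E.
Hypothesis A_Omega : forall m (K : cell (g m)), A K `<=` Omega a b.
Hypothesis A_cover : forall m x, Omega a b x -> exists K : cell (g m), A K x.
Hypothesis A_inj : forall m (K L : cell (g m)) x, A K x -> A L x -> K = L.

Local Notation pw m q := (piecewise (@A m) (dt m) (N m) q).

Let slot m := Q_slot T0 (N0 m) (dtE m) (@A_cover m) (@A_inj m).
Let bpw m (q : nat -> cell (g m) -> R) : bmQ (pw m q).
Proof. exact: (bm_piecewise (N m) (dt m) (@A_measure m)). Qed.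

Let ipw m (q : nat -> cell (g m) -> R) :=
  int_piecewise T0 hab (N0 m) (dtE m) (@A_measure m) (@A_Omega m) q.

Lemma piecewise_L1_map (theta : R -> R) (J : set R) L q f : 0 <= L ->
  (forall y y', J y -> J y' -> `|theta y - theta y'| <= L * `|y - y'|) ->
  (forall m n K, (n < N m)%N -> J (q m n K)) -> (forall z, Q z -> J (f z)) ->
  bmQ f -> bmQ (fun z => theta (f z)) ->
  I (fun z => `|pw m (q m) z - f z|) @[m --> \oo] --> 0 ->
  I (fun z => `|pw m (fun n K => theta (q m n K)) z - theta (f z)|) @[m --> \oo] --> 0.
Proof.
move=> L0 hth hq hf bf bt cv; apply: (cvg0_le _ (cvg0Z L cv)) => m.
rewrite ger0_norm; last exact: Rintegral_ge0.
have b1 := bm_norm (bmB (bpw (q m)) bf).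
rewrite -(intZ mQ fQ _ b1); apply: (int_le mQ fQ).
- by apply: bm_norm; apply: bmB => //; exact: bpw.
- exact: bmZ b1.
move=> z Qz; have [n [K [nN _ _ E]]] := slot m Qz; rewrite !E.
by apply: hth; [exact: hq|exact: hf].
Qed.

Lemma piecewise_L1_mul C q q' f f' : 0 <= C ->
  (forall m n K, (n < N m)%N -> `|q m n K| <= C) -> (forall z, Q z -> `|f' z| <= C) ->
  bmQ f -> bmQ f' ->
  I (fun z => `|pw m (q m) z - f z|) @[m --> \oo] --> 0 ->
  I (fun z => `|pw m (q' m) z - f' z|) @[m --> \oo] --> 0 ->
  I (fun z => `|pw m (fun n K => q m n K * q' m n K) z - f z * f' z|) @[m --> \oo] --> 0.
Proof.
move=> C0 hq hf bf bf' cv cv'; apply: (cvg0_le _ (cvg0Z C (cvg0D cv cv'))) => m.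
rewrite ger0_norm; last exact: Rintegral_ge0.
have b1 := bm_norm (bmB (bpw (q m)) bf); have b2 := bm_norm (bmB (bpw (q' m)) bf').
rewrite -(intD mQ fQ b1 b2) -(intZ mQ fQ _ (bmD b1 b2)); apply: (int_le mQ fQ).
- by apply: bm_norm; apply: bmB; [exact: bpw|exact: bmM].
- exact: bmZ (bmD b1 b2).
move=> z Qz; have [n [K [nN _ _ E]]] := slot m Qz; rewrite !E.
have -> : q m n K * q' m n K - f z * f' z =
  f' z * (q m n K - f z) + q m n K * (q' m n K - f' z) by ring.
rewrite (le_trans (ler_normD _ _))// !normrM mulrDr lerD// ler_wpM2r//.
  exact: hf.
exact: hq.
Qed.

Hypothesis V_gt0 : forall m (K : cell (g m)), 0 < V K.
Variable k : nat.
Hypothesis A_near : forall m L c n (K : cell (g m)) t x, 0 <= L -> (n < N m)%N ->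
  plip T a b L c -> time_slot (dt m) n t -> A K x ->
  `|c (t, x) - smp (dt m) c n K| <= L * err k m.

Lemma sum_partition_int m (f : 'rV[R]_d -> R) : bm (Omega a b) f ->
  \sum_(K : cell (g m)) Rintegral (lebesgue_rV d) (A K) f =
  Rintegral (lebesgue_rV d) (Omega a b) f.
Proof.
move=> bf; have mO := @measurable_Omega R d a b; have fO := lebesgue_Omega_fin hab.
transitivity (\sum_(K : cell (g m)) Rintegral (lebesgue_rV d) (Omega a b)
    (fun x => f x * \1_(A K) x)).
  apply: eq_bigr => K _; rewrite -{1}(setIidr (@A_Omega m K)) Rintegral_mkcondr.
  congr (Rintegral _ _ _); apply/funext => x; rewrite patchE indicE.
  by case: (x \in A K); rewrite ?mulr1 ?mulr0.
have bK (K : cell (g m)) : bm (Omega a b) (fun x => f x * \1_(A K) x).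
  by apply: bmM => //; apply: bm_indic; case: (@A_measure m K).
rewrite -(int_sum mO fO)//; apply: eq_Rintegral => x /set_mem Ox.
have [K Kx] := @A_cover m x Ox; rewrite (bigD1 K)//= indicE mem_set// mulr1 big1 ?addr0// => L LK.
rewrite indicE memNset ?mulr0// => Lx; move: LK.
by rewrite (@A_inj m _ _ _ Lx Kx) eqxx.
Qed.

(** Averaging over the cells is a contraction of L^1, so it suffices to compare with a Lipschitz
    function [c]. Replacing [f] by [c] costs [T * W] before and after averaging, and sampling [c]
    costs [L * tot muQ Q * err k m] each time. *)
Lemma average_L1 (f : 'rV[R]_d -> R) : bm (Omega a b) f ->
  I (fun z => `|pw m (fun _ K => (V K)^-1 * Rintegral (lebesgue_rV d) (A K) f) z - f z.2|)
    @[m --> \oo] --> 0.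
Proof.
move=> bf; have mO := @measurable_Omega R d a b; have fO := lebesgue_Omega_fin hab.
pose avg m (K : cell (g m)) := (V K)^-1 * Rintegral (lebesgue_rV d) (A K) f.
apply: (@cvg_by_approximation R (fun m =>
  I (fun z => `|pw m (fun _ K => (V K)^-1 * Rintegral (lebesgue_rV d) (A K) f) z - f z.2|))).
move=> e e0; have e2 : 0 < e / (2 * T) by rewrite divr_gt0// mulr_gt0.
have [c Lc hc] := lipO_approximable T0 hab lip_bm bf e2.
have bc := lipO_bm T0 lip_bm Lc.
have bfc := bm_norm (bmB bf bc).
have [bfc2 ifc2] := int_time_constant bfc.
have [bf2 _] := int_time_constant bf.
pose c2 (z : R * 'rV[R]_d) : R := c z.2.
have Lc2 : lipQ c2 by exact: Lc.
have bc2 := lip_bm Lc2.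
have [L L0 pl] := Lc2.
pose W := Rintegral (lebesgue_rV d) (Omega a b) (fun x => `|f x - c x|).
exists (fun=> 0), 0, (fun m => (T * W + L * tot muQ Q * err k m) + L * tot muQ Q * err k m + T * W),
  ((T * W + 0) + 0 + T * W).
split; [exact: cvg_cst|by rewrite subr0 normr0 ltW| | |].
- do !apply: cvgD; try exact: cvg_cst; exact/cvg0Z/mesh_err_cvg.
- have TT : 0 < 2 * T by rewrite mulr_gt0.
  have -> : T * W + 0 + 0 + T * W = 2 * T * W by ring.
  by rewrite (le_trans (ler_wpM2l (ltW TT) hc))// mulrC divfK// gt_eqF.
move=> m; rewrite subr0 ger0_norm; last exact: Rintegral_ge0.
have b1 := bpw (fun _ K => avg m K); have b2 := bpw (smp (g := g m) (dt m) c2).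
have err0 := mesh_err_ge0 T0 g N0 dtE k m : 0 <= err k m.
have SV : S m (fun _ K => V K) = tot muQ Q.
  exact: (Ssum_volume T0 hab (N0 m) (dtE m) (@A_measure m) (@A_Omega m) (@A_cover m) (@A_inj m)).
rewrite (le_trans (int_L1_triangle mQ fQ b1 b2 bf2))//.
rewrite -addrA lerD//; last first.
  rewrite (le_trans (int_L1_triangle mQ fQ b2 bc2 bf2))// lerD//; last first.
    rewrite -ifc2 le_eqVlt; apply/orP; left; apply/eqP.
    by apply: eq_Rintegral => z _; rewrite distrC.
  have -> : L * tot muQ Q * err k m = L * err k m * tot muQ Q by ring.
  apply: (int_le_cst mQ fQ); first exact: bm_norm (bmB b2 bc2).
  move=> [t x] Qz; have [n [K [nN ts Kx E]]] := slot m Qz; rewrite E distrC.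
  exact: A_near.
have -> : I (fun z => `|pw m (fun _ K => avg m K) z - pw m (smp (g := g m) (dt m) c2) z|) =
    S m (fun n K => V K * `|avg m K - smpm m c2 n K|).
  rewrite -ipw; apply: eq_Rintegral => z /set_mem Qz.
  have [n [K [nN _ _ E]]] := slot m Qz.
  by rewrite !E; exact/esym/(E (fun n K => `|avg m K - smpm m c2 n K|)).
apply: (@le_trans _ _ (S m (fun n K => Rintegral (lebesgue_rV d) (A K) (fun x => `|f x - c x|)
    + L * err k m * V K))); last first.
  rewrite SsumD SsumZ SV time_constant_sum sum_partition_int// lerD2l.
  by rewrite le_eqVlt; apply/orP; left; apply/eqP; ring.
apply: (Ssum_le (dts_ge0 m)) => n K nN.
have [mA vA] := @A_measure m K.
have fA : (lebesgue_rV d (A K) < +oo)%E by rewrite vA ltry.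
have sub (h : 'rV[R]_d -> R) : bm (Omega a b) h -> bm (A K) h.
  move=> [mh [M hM]]; split; first exact: measurable_funS mh.
  by exists M => x /A_Omega; exact: hM.
have V0 := V_gt0 K.
have ck (h : R) : Rintegral (lebesgue_rV d) (A K) (fun=> h) = h * V K.
  rewrite Rintegral_cst//; congr (h * _).
  by transitivity (fine (V K)%:E) => //; congr fine; exact: vA.
have bk := bm_cst (A K) (smpm m c2 n K).
have -> : V K * `|avg m K - smpm m c2 n K| =
    `|Rintegral (lebesgue_rV d) (A K) (fun x => f x - smpm m c2 n K)|.
  rewrite (intB mA fA (sub _ bf) bk) ck -{1}(ger0_norm (ltW V0)) -normrM /avg.
  by congr `|_|; field; rewrite gt_eqF.
rewrite (le_trans (int_norm mA fA (bmB (sub _ bf) bk)))//.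
rewrite -ck -(intD mA fA (sub _ bfc) (bm_cst _ _)).
apply: (int_le mA fA); [exact: bm_norm (bmB (sub _ bf) bk)|exact: bmD (sub _ bfc) (bm_cst _ _)|].
move=> x Kx; rewrite (le_trans (ler_distD (c x) _ _))// lerD2l.
(* [c2] does not depend on time, so the sampling estimate may be read at time 0 of the first
   slot. *)
have ts : time_slot (dt m) 0 0.
  rewrite /time_slot/= in_itv/= mul0r lexx mul1r; exact: (dt_gt0 T0 (N0 m) (dtE m)).
exact: (@A_near m L c2 0%N K 0 x L0 (N0 m) pl ts Kx).
Qed.

End partition_L1.

(** * Passage to the limit *)

Section weak_limits.
Variables (gamma eps eta : R).
Hypotheses (gamma1 : 1 < gamma) (eps0 : 0 < eps) (eta0 : 0 < eta).
Variable w : forall m, nat -> state (g m).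
Hypothesis hw : forall m n, (n < N m)%N ->
  scheme_step gamma eps eta (dt m) (w m n) (w m n.+1).
Variables (Cl Cu C mu : R).
Hypotheses (Cl0 : 0 < Cl) (C0 : 0 <= C) (mu0 : 0 <= mu) (ClCu : Cl <= Cu).
Hypothesis rho_bound : forall m n K, (n <= N m)%N -> Cl <= rho_ (w m n) K <= Cu.
Hypothesis theta_bound : forall m n K, (n <= N m)%N -> Cl <= theta_ (w m n) K <= Cu.
Hypothesis u_bound : forall m n s, (n <= N m)%N -> `|u_ (w m n) s| <= C.
Hypothesis dt_mesh : forall m, dt m <= mu * min_diam (g m).
Hypothesis ratio_mesh : forall m, max_ratio (g m) <= mu.
Variables (rho theta : R * 'rV[R]_d -> R) (u : 'I_d -> R * 'rV[R]_d -> R).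
Hypotheses (brho : bmQ rho) (btheta : bmQ theta) (bu : forall i, bmQ (u i)).
Hypothesis rho_range : forall z, Q z -> Cl <= rho z <= Cu.
Hypothesis theta_range : forall z, Q z -> Cl <= theta z <= Cu.
Hypothesis u_range : forall i z, Q z -> `|u i z| <= C.
Hypothesis rho_L1 :
  I (fun z => `|rho_fun (dt m) (N m) (w m) z - rho z|) @[m --> \oo] --> 0.
Hypothesis theta_L1 :
  I (fun z => `|theta_fun (dt m) (N m) (w m) z - theta z|) @[m --> \oo] --> 0.
Hypothesis u_L1 : forall i,
  I (fun z => `|u_fun i (dt m) (N m) (w m) z - u i z|) @[m --> \oo] --> 0.
Variables (rho0 theta0 : 'rV[R]_d -> R) (u0 : 'I_d -> 'rV[R]_d -> R).
Hypotheses (brho0 : bm (Omega a b) rho0) (btheta0 : bm (Omega a b) theta0)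
  (bu0 : forall i, bm (Omega a b) (u0 i)).
Hypothesis w0 : forall m, w m 0%N = initial_state (g m) rho0 u0 theta0.

Let Cu0 : 0 <= Cu. Proof. by rewrite (le_trans (ltW Cl0)). Qed.

Let rq : family := fun m n K => rho_ (w m n) K.
Let tq : family := fun m n K => theta_ (w m n) K.
Let rtq : family := fun m n K => rhotheta (w m n) K.
Let pq : family := fun m n K => pressure gamma (w m n) K.
Let uq i : family := fun m n K => u_ (w m n) (i, K).
Let F j : family := fun m n K => upflux (rho_ (w m n)) (u_ (w m n)) j K.
Arguments rq : clear implicits.
Arguments tq : clear implicits.
Arguments rtq : clear implicits.
Arguments pq : clear implicits.
Arguments uq : clear implicits.
Arguments F : clear implicits.
(** The range of [rho theta]. Its lower end is positive, which puts it where [powR_lipschitz]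
    applies. *)
Let J : set R := [set y | Cl ^+ 2 <= y <= Cu ^+ 2].

Let norm_in_range (x : R) : Cl <= x <= Cu -> `|x| <= Cu.
Proof. by move=> /andP[lx xu]; rewrite ger0_norm// (le_trans (ltW Cl0)). Qed.

Let rho_norm m n (K : cell (g m)) : (n <= N m)%N -> `|rq m n K| <= Cu.
Proof. by move=> nN; apply/norm_in_range/rho_bound. Qed.

Let prod_J (x y : R) : Cl <= x <= Cu -> Cl <= y <= Cu -> J (x * y).
Proof.
move=> /andP[lx xu] /andP[ly yu]; rewrite /J/= !expr2.
have Cl0' := ltW Cl0; have x0 := le_trans Cl0' lx; have y0 := le_trans Cl0' ly.
by rewrite !ler_pM.
Qed.

Let J_norm y : J y -> `|y| <= Cu ^+ 2.
Proof. by move=> /andP[ly yu]; rewrite ger0_norm// (le_trans _ ly)// sqr_ge0. Qed.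

Let rt_J m n (K : cell (g m)) : (n <= N m)%N -> J (rtq m n K).
Proof. by move=> nN; apply: prod_J; [exact: rho_bound|exact: theta_bound]. Qed.

Let Cp := (Cu ^+ 2) `^ gamma.

Let powR_norm y : J y -> 0 <= y /\ `|y `^ gamma| <= Cp.
Proof.
move=> /andP[h1 h2]; have y0 : 0 <= y by rewrite (le_trans _ h1)// sqr_ge0.
split=> //; rewrite ger0_norm ?powR_ge0//; apply: ge0_ler_powR => //.
- by rewrite ltW// (lt_trans ltr01).
- by rewrite nnegrE sqr_ge0.
Qed.

Let p_norm m n (K : cell (g m)) : (n <= N m)%N -> `|pq m n K| <= Cp.
Proof. by move=> nN; have [] := powR_norm (rt_J K nN). Qed.

Let Cp0 : 0 <= Cp. Proof. exact: powR_ge0. Qed.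

Let rt z := rho z * theta z.
Let p z := rt z `^ gamma.

Let brt : bmQ rt. Proof. exact: bmM. Qed.

Let rt_range z : Q z -> J (rt z).
Proof. by move=> Qz; apply: prod_J; [exact: rho_range|exact: theta_range]. Qed.

Let bp : bmQ p.
Proof.
apply: bm_powR => //; first by rewrite ltW// (lt_trans ltr01).
by move=> z Qz; have [] := powR_norm (rt_range Qz).
Qed.

Let cl_rho : cell_limit rq rho.
Proof.
have [] // := piecewise_L1_cell (q := rq) (f := rho) (C := Cu).
- by move=> m n K nN; apply: rho_norm; exact: ltnW.
- by move=> z Qz; apply/norm_in_range/rho_range.
Qed.

Let L1_rt : I (fun z => `|piecewise (@cell_set _ _ _ _ (g m)) (dt m) (N m) (rtq m) z - rt z|)
  @[m --> \oo] --> 0.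
Proof.
apply: (piecewise_L1_mul (@cell_measure _ _ _ _ g)
  (fun m => @cell_of _ _ _ _ (g m)) (fun m => @cell_set_inj _ _ _ _ (g m))
  (C := Cu) (q := rq) (q' := tq)) => //.
- by move=> m n K nN; apply: rho_norm; exact: ltnW.
- by move=> z Qz; apply/norm_in_range/theta_range.
Qed.

Let cl_rt : cell_limit rtq rt.
Proof.
have [] // := piecewise_L1_cell (q := rtq) (f := rt) (C := Cu ^+ 2).
- by move=> m n K nN; apply/J_norm/rt_J/ltnW.
- by move=> z Qz; apply/J_norm/prod_J; [exact: rho_range|exact: theta_range].
- exact: sqr_ge0.
Qed.

Let cl_p : cell_limit pq p /\
  forall chi, lipQ chi -> S m (fun n K => vol K * `|pq m n K - smpm m chi n K|)
     @[m --> \oo] --> I (fun z => `|p z - chi z|).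
Proof.
apply: (piecewise_L1_cell (q := pq) (f := p) (C := Cp)) => //.
- by move=> m n K nN; apply: p_norm; exact: ltnW.
- by move=> z Qz; have [] := powR_norm (rt_range Qz).
have [L L0 hL] := @powR_lipschitz gamma (Cl ^+ 2) (Cu ^+ 2) gamma1
  (exprn_gt0 2 Cl0) ltac:(by rewrite ler_pXn2r// nnegrE ltW).
apply: (piecewise_L1_map (@cell_measure _ _ _ _ g)
  (fun m => @cell_of _ _ _ _ (g m)) (fun m => @cell_set_inj _ _ _ _ (g m))
  (theta := fun y => y `^ gamma) (J := J) (L := L) (q := rtq) (f := rt)) => //.
- by move=> m n K nN; apply: rt_J; exact: ltnW.
Qed.

Let fl_u i : face_limit i (uq i) (u i).
Proof.
apply: (piecewise_L1_face (C := C)) => //.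
- by move=> m n K nN; apply: u_bound; exact: ltnW.
- exact: u_range.
- exact: u_L1.
Qed.

Let kap := @aspect R d a b mu.

Let kap1 : 1 <= kap. Proof. exact: aspect_ge1. Qed.

Let kap0 : 0 <= kap. Proof. exact: aspect_ge0. Qed.

(** The smallest diameter bounds the time step, and the aspect bound passes from a diameter to the
    side in any direction. *)
Let dt_side m (K : cell (g m)) j : dt m <= mu * kap * side K j.
Proof.
rewrite (le_trans (dt_mesh m))// -mulrA ler_wpM2l// (le_trans (min_diam_le K))//.
exact: diam_le_side.
Qed.

Let F_bound m n j (K : cell (g m)) : (n < N m)%N -> `|F j m n K| <= 2 * Cu * C * area (j, K).
Proof.
move=> nN; rewrite /F /upflux normrM (ger0_norm (area_ge0 _)) mulrC ler_wpM2r ?area_ge0//.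
have un := u_bound (j, K) (ltnW nN).
rewrite (le_trans (ler_normD _ _))// !normrM.
have r1 := rho_norm K (ltnW nN); have r2 := rho_norm (nb j K) (ltnW nN).
have -> : 2 * Cu * C = Cu * C + Cu * C by ring.
by rewrite lerD// ler_pM// (le_trans _ un)// ?pos_norm// neg_norm.
Qed.

Let mass_cons m n : (n < N m)%N ->
  conserved (dt m) (@vol _ _ _ _ (g m)) (rq m n) (rq m n.+1) (fun j => F j m n).
Proof.
move=> nN; have dtn0 : dt m != 0 by rewrite gt_eqF// (dt_gt0 T0 (N0 m) (dtE m)).
by have [] := scheme_conserved dtn0 (hw nN).
Qed.

Let F_variation i chi : lipQ chi ->
  S m (fun n K => F i m n K * (side (nb i K) i - side K i) * smpm m chi n K) @[m --> \oo] --> 0.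
Proof.
move=> Lchi; apply: (flux_variation_cvg0 (q := rq) (G := fun m n j => F j m n) (Cq := Cu) (CG := 2 * Cu * C)) Lchi.
- exact: Cu0.
- by rewrite !mulr_ge0.
- exact: mass_cons.
- by move=> m n K nN; exact: rho_norm.
- by move=> m n j K nN; exact: F_bound.
Qed.

Let F_limit i psi : lipQ psi ->
  S m (fun n K => F i m n K * side K i * smpm m psi n K) @[m --> \oo]
    --> I (fun z => rho z * u i z * psi z).
Proof.
apply: (upwind_flux_cvg (i := i) (q := rq) (u := uq i) (r := fun m n K => 0) (Cq := Cu)) => //.
- by move=> m n K nN; apply: rho_norm; exact: ltnW.
- by move=> m n K nN; rewrite addr0.
- apply: (@cvg0_le _ _ (fun=> 0)); last exact: cvg_cst.
  move=> m; rewrite /Ssum big1 ?mulr0 ?normr0// => n _.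
  rewrite big1//= => K _.
  by rewrite mul0r.
- by move=> chi Lchi; exact: F_variation.
Qed.

Let initial_lip phi : lipQ phi -> lipQ (fun z => phi (0, z.2)).
Proof.
move=> [L L0 [hL pL]]; exists L => //; split.
  move=> [t x] [t' x'] [/= _ sx] [/= _ sx'].
  rewrite (le_trans (hL (0, x) (0, x') _ _))//.
  - by split => //=; rewrite lexx ltW.
  - by split => //=; rewrite lexx ltW.
  - by rewrite ler_wpM2l// /dist/= subrr normr0 add0r lerDr.
move=> i t x [/= _ sx] xi; apply: pL => //.
by split => //=; rewrite lexx ltW.
Qed.

(* Sums over the initial data are read as space-time sums of families that are
   constant in time. *)
Let initial_limit (X : forall m, cell (g m) -> R) (h : 'rV[R]_d -> R) :
  bm (Omega a b) h ->
  S m (fun _ K => X m K) @[m --> \oo] --> I (fun z => h z.2) ->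
  \sum_K X m K @[m --> \oo] --> Rintegral (lebesgue_rV d) (Omega a b) h.
Proof.
move=> bh; have [_ ->] := int_time_constant bh; under eq_fun do rewrite time_constant_sum.
move=> cv.
have : T^-1 * (T * \sum_K X m K) @[m --> \oo] -->
    T^-1 * (T * Rintegral (lebesgue_rV d) (Omega a b) h) by exact: cvgMl_tmp.
rewrite mulrA mulVf ?gt_eqF// mul1r; apply: cvg_trans; apply: near_eq_cvg.
by apply: nearW => m /=; rewrite mulrA mulVf ?gt_eqF// mul1r.
Qed.

Lemma bm_initial phi : lipQ phi -> bm (Omega a b) (fun x => phi (0, x)).
Proof. by move=> Lphi; apply: (lipO_bm T0 lip_bm); exact: initial_lip. Qed.

Let cell_near m L c n (K : cell (g m)) t x : 0 <= L -> (n < N m)%N ->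
  plip T a b L c -> time_slot (dt m) n t -> cell_set K x ->
  `|c (t, x) - smp (dt m) c n K| <= L * err d m.
Proof. by move=> L0 nN pl ts Kx; exact: (smp_cell T0 (N0 m) (dtE m) L0 nN pl ts Kx). Qed.

Let face_near i m L c n (K : cell (g m)) t x : 0 <= L -> (n < N m)%N ->
  plip T a b L c -> time_slot (dt m) n t -> dual_set (i, K) x ->
  `|c (t, x) - smp (dt m) c n K| <= L * err d.+1 m.
Proof. by move=> L0 nN pl ts Kx; exact: (smp_dual T0 (N0 m) (dtE m) L0 nN pl ts Kx). Qed.

Let cell_average_L1 (f0 : 'rV[R]_d -> R) (X : forall m, cell (g m) -> R) : bm (Omega a b) f0 ->
  (forall m K, X m K = (vol K)^-1 * Rintegral (lebesgue_rV d) (cell_set K) f0) ->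
  I (fun z => `|piecewise (@cell_set _ _ _ _ (g m)) (dt m) (N m) (fun=> X m) z - f0 z.2|)
    @[m --> \oo] --> 0.
Proof.
move=> bf0 XE.
have := average_L1 (@cell_measure _ _ _ _ g)
  (fun m => @cell_set_Omega _ _ _ _ (g m)) (fun m => @cell_of _ _ _ _ (g m))
  (fun m => @cell_set_inj _ _ _ _ (g m)) (fun m => @vol_gt0 _ _ _ _ (g m)) cell_near bf0.
have E m : X m = fun K => (vol K)^-1 * Rintegral (lebesgue_rV d) (cell_set K) f0.
  by apply/funext => K; exact: XE.
by under [in X in _ -> X]eq_fun do rewrite E.
Qed.

Let face_average_L1 i (f0 : 'rV[R]_d -> R) (X : forall m, cell (g m) -> R) : bm (Omega a b) f0 ->
  (forall m K, X m K = (dual_vol (i, K))^-1 * Rintegral (lebesgue_rV d) (dual_set (i, K)) f0) ->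
  I (fun z => `|piecewise (fun K : cell (g m) => dual_set (i, K)) (dt m) (N m) (fun=> X m) z - f0 z.2|)
    @[m --> \oo] --> 0.
Proof.
move=> bf0 XE.
have := average_L1 (fun m => @dual_set_measure _ _ _ _ (g m) i)
  (fun m => @dual_set_Omega _ _ _ _ (g m) i) (fun m => @dual_of _ _ _ _ (g m) i)
  (fun m => @dual_set_inj _ _ _ _ (g m) i) (fun m K => dual_vol_gt0 (i, K)) (face_near (i := i)) bf0.
have E m : X m = fun K => (dual_vol (i, K))^-1 * Rintegral (lebesgue_rV d) (dual_set (i, K)) f0.
  by apply/funext => K; exact: XE.
by under [in X in _ -> X]eq_fun do rewrite E.
Qed.

Let rho0_L1 : I (fun z => `|piecewise (@cell_set _ _ _ _ (g m)) (dt m) (N m) (fun=> rq m 0%N) z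
    - rho0 z.2|) @[m --> \oo] --> 0.
Proof. by apply: cell_average_L1 => // m K; rewrite /rq w0. Qed.

Let theta0_L1 : I (fun z => `|piecewise (@cell_set _ _ _ _ (g m)) (dt m) (N m) (fun=> tq m 0%N) z
    - theta0 z.2|) @[m --> \oo] --> 0.
Proof. by apply: cell_average_L1 => // m K; rewrite /tq w0. Qed.

Let u0_L1 i : I (fun z => `|piecewise (fun K : cell (g m) => dual_set (i, K)) (dt m) (N m)
    (fun=> uq i m 0%N) z - u0 i z.2|) @[m --> \oo] --> 0.
Proof. by apply: face_average_L1 => // m K; rewrite /uq w0. Qed.

(** An arbitrary direction, used to name the neighbor in the error weights. *)
Variable i0 : 'I_d.

Let initial_cell_limit (X : forall m, cell (g m) -> R) (h : 'rV[R]_d -> R) (B : R) :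
  (forall m K, `|X m K| <= B) -> bm (Omega a b) h ->
  I (fun z => `|piecewise (@cell_set _ _ _ _ (g m)) (dt m) (N m) (fun=> X m) z - h z.2|)
    @[m --> \oo] --> 0 -> cell_limit (fun m _ => X m) (fun z => h z.2).
Proof.
move=> XB bh X1; have [M M0 hM] := bm_bound bh.
have [bh' _] := int_time_constant bh.
(* The discrete values are bounded by [B] and the datum by its own [M]; the maximum is a bound for
   both. *)
have [||||cl _] := piecewise_L1_cell (q := fun m _ => X m) (f := fun z => h z.2)
    (C := Num.max B M) _ _ _ _ X1 => //.
- by move=> m n K _; rewrite le_max XB.
- by move=> [t x] [/= _ Ox]; rewrite le_max hM// orbT.
- by rewrite le_max M0 orbT.
Qed.

Let initial_cell (X : forall m, cell (g m) -> R) (h : 'rV[R]_d -> R) phi :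
  bm (Omega a b) h -> cell_limit (fun m _ => X m) (fun z => h z.2) -> lipQ phi ->
  \sum_K vol K * X m K * smpm m phi 0 K @[m --> \oo] -->
    Rintegral (lebesgue_rV d) (Omega a b) (fun x => h x * phi (0, x)).
Proof.
move=> bh [_ cl] Lphi.
apply: initial_limit; first exact: bmM (bm_initial Lphi).
have := cl _ (initial_lip Lphi); apply: cvg_trans; apply: near_eq_cvg; apply: nearW => m /=.
by apply: eq_Ssum => n K _; rewrite mulrA /smp mul0r.
Qed.

Let w_norm0 m (K : cell (g m)) : `|rq m 0%N K| <= Cu /\ `|rtq m 0%N K| <= Cu ^+ 2.
Proof. by split; [exact: rho_norm|exact/J_norm/rt_J]. Qed.

Let C1 := 2 * Cu * C.
Let C10 : 0 <= C1. Proof. by rewrite !mulr_ge0. Qed.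

Lemma mass_limit phi : test_function T a b phi ->
  I (fun z => rho z * dt_ phi z) + \sum_j I (fun z => rho z * u j z * dx_ j phi z) =
  - Rintegral (lebesgue_rV d) (Omega a b) (fun x => rho0 x * phi (0, x)).
Proof.
move=> tphi; apply: (weak_consistency (i := i0) (V := fun m => @vol _ _ _ _ (g m)) (q := rq)
  (G := fun m n j => F j m n) (sh := fun m => id) (C := Cu + C1)
  (lj := fun j => I (fun z => rho z * u j z * dx_ j phi z)) _ tphi) => //.
- by rewrite addr_ge0.
- move=> m n K nN; rewrite normrM mulrC (ger0_norm (vol_ge0 K)).
  by rewrite ler_pM ?vol_ge0// ?lerDl ?vol_ge0// (le_trans (rho_norm _ (ltnW nN)))// lerDl.
- move=> m n j K nN /=; rewrite (le_trans (ler_wpM2r (side_ge0 _ _) (F_bound j K nN)))//.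
  rewrite -/C1 -mulrA -vol_area.
  by rewrite ler_pM ?vol_ge0// ?lerDl ?lerDr ?vol_ge0.
- have := cl_rho.2 _ (test_dt_lip tphi); apply: cvg_trans; apply: near_eq_cvg.
  by apply: nearW => m; apply: eq_Ssum => n K _; rewrite mulrA.
- by move=> j; apply: F_limit; exact: test_dx_lip.
- apply: (initial_cell (X := fun m => rq m 0%N)) => //; last exact: test_lip.
  by apply: (initial_cell_limit (B := Cu)) => // m K; have [] := w_norm0 K.
Qed.

Let cell_time q (f psi : R * 'rV[R]_d -> R) : cell_limit q f -> lipQ psi ->
  S m (fun n K => vol K * q m n K * smpm m psi n K) @[m --> \oo] --> I (fun z => f z * psi z).
Proof.
move=> [_ cl] Lpsi; apply: cvg_trans (cl _ Lpsi); apply: near_eq_cvg.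
by apply: nearW => m; apply: eq_Ssum => n K _; rewrite mulrA.
Qed.

(** * The temperature equation *)

Let ke := eta / eps ^+ 2.
Let ke0 : 0 <= ke. Proof. by rewrite divr_ge0 ?sqr_ge0// ltW. Qed.
Let du m n s : R := eta * dt m / eps ^+ 2 * dif (pressure gamma (w m n.+1)) s.
Arguments du : clear implicits.
Let H j : family := fun m n K =>
  tempflux (rhotheta (w m n.+1)) (u_ (w m n)) (du m n) j K.
Arguments H : clear implicits.

Let du_norm m n j (K : cell (g m)) :
  dual_vol (j, K) * `|du m n (j, K)| = ke * (dt m * area (j, K) * `|pq m n.+1 (nb j K) - pq m n.+1 K|).
Proof.
have v0 := dual_vol_gt0 (j, K).
rewrite -[X in X * _](ger0_norm (ltW v0)) -normrM /du /dif normal_lower mulr1.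
rewrite -[upper (j, K)]/(nb j K) -[lower (j, K)]/K.
rewrite (_ : dual_vol (j, K) * _ = ke * (dt m * area (j, K)) * (pq m n.+1 (nb j K) - pq m n.+1 K)); last first.
  by rewrite /ke /pq; field; rewrite !gt_eqF.
have k0 : 0 <= ke * (dt m * area (j, K)) by apply: mulr_ge0 => //; rewrite mulr_ge0 ?area_ge0 ?dts_ge0.
by rewrite normrM (ger0_norm k0) [RHS]mulrA.
Qed.

(** By [du_norm] the correction is [ke * dt * area * jump / dual_vol]. Here [dt * area <= mu * kap *
    vol K <= 2 * (mu * kap) * dual_vol], and a pressure jump is at most [2 * Cp]. *)
Let Cd := ke * (2 * (mu * kap) * (2 * Cp)).

Let Cd0 : 0 <= Cd. Proof. by apply: mulr_ge0 => //; rewrite !mulr_ge0. Qed.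

Let du_bound m n j (K : cell (g m)) : (n < N m)%N -> `|du m n (j, K)| <= Cd.
Proof.
move=> nN; have v0 := dual_vol_gt0 (j, K).
rewrite -(ler_pM2l v0) du_norm /Cd [leRHS]mulrCA; apply: ler_wpM2l => //.
rewrite [leRHS]mulrA; apply: ler_pM => //; first by rewrite mulr_ge0 ?area_ge0 ?dts_ge0.
  have := ler_wpM2r (area_ge0 (j, K)) (dt_side K j); move/le_trans; apply.
  rewrite [leLHS](_ : _ = mu * kap * vol K); last by rewrite (vol_area j); ring.
  rewrite [leRHS](_ : _ = mu * kap * (2 * dual_vol (j, K))); last by ring.
  by rewrite ler_wpM2l ?mulr_ge0// -vol_pairE lerDl vol_ge0.
by rewrite (le_trans (ler_normB _ _))// mulr2n mulrDl mul1r lerD// p_norm.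
Qed.

Let C2 := 2 * Cu ^+ 2 * (C + Cd).
Let C20 : 0 <= C2. Proof. by rewrite !mulr_ge0 ?sqr_ge0 ?addr_ge0. Qed.

Let H_bound m n j (K : cell (g m)) : (n < N m)%N -> `|H j m n K| <= C2 * area (j, K).
Proof.
move=> nN; rewrite /H /tempflux normrM (ger0_norm (area_ge0 _)) mulrC ler_wpM2r ?area_ge0//.
have un := u_bound (j, K) (ltnW nN); have dn := du_bound j K nN.
have r1 := J_norm (rt_J K nN); have r2 := J_norm (rt_J (nb j K) nN).
rewrite (le_trans (ler_normD _ _))// /C2 [leRHS](_ : _ = Cu ^+ 2 * (C + Cd) + Cu ^+ 2 * (C + Cd)); last by ring.
have pn (x y : R) : `|x| <= C -> `|y| <= Cd ->
    `|pos x - neg y| <= C + Cd /\ `|neg x - pos y| <= C + Cd.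
  move=> xC yC; split; rewrite (le_trans (ler_normB _ _))// lerD//.
  - exact: le_trans (pos_norm _) xC.
  - exact: le_trans (neg_norm _) yC.
  - exact: le_trans (neg_norm _) xC.
  - exact: le_trans (pos_norm _) yC.
have [p1 p2] := pn _ _ un dn.
by apply: lerD; rewrite normrM; apply: ler_pM.
Qed.

Let temp_cons m n : (n < N m)%N ->
  conserved (dt m) (@vol _ _ _ _ (g m)) (rtq m n) (rtq m n.+1) (fun j => H j m n).
Proof.
move=> nN; have dtn0 : dt m != 0 by rewrite gt_eqF// (dt_gt0 T0 (N0 m) (dtE m)).
by have [] := scheme_conserved dtn0 (hw nN).
Qed.

(** The stabilisation is the remainder [r] of the upwind flux and vanishes with the pressure jumps.
    The transported quantity is implicit, hence the shift by [cell_limit_next]. *)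
Let H_limit j psi : lipQ psi ->
  S m (fun n K => H j m n K * side K j * smpm m psi n K) @[m --> \oo]
    --> I (fun z => rt z * u j z * psi z).
Proof.
apply: (upwind_flux_cvg (i := j) (q := fun m n => rtq m n.+1) (u := uq j)
  (r := fun m n K => area (j, K) * (- (rtq m n.+1 K * neg (du m n (j, K)))
     - rtq m n.+1 (nb j K) * pos (du m n (j, K)))) (Cq := Cu ^+ 2)) => //.
- exact: sqr_ge0.
- by move=> m n K nN; exact/J_norm/rt_J.
- apply: (cell_limit_next i0 (C := Cu ^+ 2)) => //; first exact: sqr_ge0.
  by move=> m n K nN; exact/J_norm/rt_J.
- by move=> m n K nN; rewrite /H /tempflux /rtq /uq; ring.
(* The area times the sum of the two sides is [2 * dual_vol], and each of the two parts of [du]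
   contributes [Cu ^ 2 * |du|]; this gives the factor 4. *)
- apply: (@cvg0_le _ _ (fun m => 4 * Cu ^+ 2 * ke *
    S m (fun n K => dt m * area (j, K) * `|pq m n.+1 (nb j K) - pq m n.+1 K|))); last first.
    apply: cvg0Z; case: cl_p => _ clp.
    by apply: (pressure_jump_cvg0 j (p := pq) (C := Cp) (Cmu := mu * kap) _ _ bp) => //; rewrite mulr_ge0.
  move=> m; rewrite -SsumZ; apply: (Ssum_norm_le (dts_ge0 m)) => n K nN.
  have a0 := area_ge0 (j, K); have s0 := side_ge0 K j; have s1 := side_ge0 (nb j K) j.
  rewrite normrM normr_id (ger0_norm (addr_ge0 s0 s1)).
  rewrite [leRHS](_ : _ = 4 * Cu ^+ 2 * (dual_vol (j, K) * `|du m n (j, K)|)); last first.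
    by rewrite du_norm; ring.
  rewrite normrM (ger0_norm a0).
  rewrite [leLHS](_ : _ = 2 * dual_vol (j, K) * `|- (rtq m n.+1 K * neg (du m n (j, K)))
     - rtq m n.+1 (nb j K) * pos (du m n (j, K))|); last first.
    by rewrite -vol_pairE (vol_area j K) -(area_side_neighbor true j K); ring.
  rewrite [leRHS](_ : _ = 2 * dual_vol (j, K) *
     (Cu ^+ 2 * `|du m n (j, K)| + Cu ^+ 2 * `|du m n (j, K)|)); last by ring.
  apply: ler_wpM2l; first by rewrite mulr_ge0 ?dual_vol_ge0.
  have r1 := J_norm (rt_J K nN); have r2 := J_norm (rt_J (nb j K) nN).
  apply: le_trans (ler_normB _ _) _; rewrite normrN; apply: lerD.
    by rewrite normrM; apply: ler_pM => //; exact: neg_norm.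
  by rewrite normrM; apply: ler_pM => //; exact: pos_norm.
- move=> chi Lchi; apply: (flux_variation_cvg0 (q := rtq) (G := fun m n j => H j m n)
    (Cq := Cu ^+ 2) (CG := C2)) Lchi => //; first exact: sqr_ge0.
  by move=> m n K nN; exact/J_norm/rt_J.
Qed.

Lemma temp_limit phi : test_function T a b phi ->
  I (fun z => rho z * theta z * dt_ phi z)
    + \sum_j I (fun z => rho z * theta z * u j z * dx_ j phi z) =
  - Rintegral (lebesgue_rV d) (Omega a b) (fun x => rho0 x * theta0 x * phi (0, x)).
Proof.
move=> tphi; have Cu20 : 0 <= Cu ^+ 2 by exact: sqr_ge0.
apply: (weak_consistency (i := i0) (V := fun m => @vol _ _ _ _ (g m)) (q := rtq)
  (G := fun m n j => H j m n) (sh := fun m => id) (C := Cu ^+ 2 + C2)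
  (lj := fun j => I (fun z => rho z * theta z * u j z * dx_ j phi z)) _ tphi) => //.
- by rewrite addr_ge0.
- move=> m n K nN; rewrite normrM mulrC (ger0_norm (vol_ge0 K)).
  by rewrite ler_pM ?vol_ge0// ?lerDl ?vol_ge0// (le_trans (J_norm (rt_J _ (ltnW nN))))// lerDl.
- move=> m n j K nN /=; rewrite (le_trans (ler_wpM2r (side_ge0 _ _) (H_bound j K nN)))//.
  rewrite -mulrA -vol_area.
  by rewrite ler_pM ?vol_ge0// ?lerDl ?lerDr ?vol_ge0.
- exact: (cell_time cl_rt (test_dt_lip tphi)).
- by move=> j; apply: H_limit; exact: test_dx_lip.
- apply: (initial_cell (X := fun m => rtq m 0%N) (h := fun x => rho0 x * theta0 x));
    [exact: bmM| |exact: test_lip].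
  apply: (initial_cell_limit (X := fun m => rtq m 0%N) (h := fun x => rho0 x * theta0 x) (B := Cu ^+ 2)) => //.
  + by move=> m K; have [] := w_norm0 K.
  + exact: bmM.
  + have [M M0 hM] := bm_bound btheta0.
    have [B1 _] := int_time_constant brho0; have [B2 _] := int_time_constant btheta0.
    apply: (piecewise_L1_mul (@cell_measure _ _ _ _ g)
      (fun m => @cell_of _ _ _ _ (g m)) (fun m => @cell_set_inj _ _ _ _ (g m))
      (C := Num.max Cu M) (q := fun m _ K => rq m 0%N K) (q' := fun m _ K => tq m 0%N K)) => //.
    * by rewrite le_max Cu0.
    * by move=> m n K _; rewrite le_max rho_norm.
    * by move=> [t x] [/= _ Ox]; rewrite le_max hM// orbT.
Qed.

(** * The momentum equation for one component *)

Section component.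
Variable i : 'I_d.

Let dualfluxE (r : forall m, cell (g m) -> R) (v : forall m, face (g m) -> R) m j K :
  dualflux (r m) (v m) i j K = (upflux (r m) (v m) j K + upflux (r m) (v m) j (nb i K)) / 2.
Proof. by rewrite /dualflux; case: eqP => // ->. Qed.

Let dual_mass m n (K : cell (g m)) :
  dual_vol (i, K) * (dual_density (rho_ (w m n)) (i, K) * u_ (w m n) (i, K)) =
  (vol K * rq m n K + vol (nb i K) * rq m n (nb i K)) / 2 * uq i m n K.
Proof.
have v0 := dual_vol_gt0 (i, K).
by rewrite /dual_density -[upper (i, K)]/(nb i K) -[lower (i, K)]/K /rq /uq; field; rewrite gt_eqF.
Qed.

(** For [j = i] both areas agree and each product is the volume of the upper cell. For [j != i] the
    side along [e_j] is common to both cells, and the two products are their volumes. *)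
Let area_pair m j (K : cell (g m)) :
  (area (j, K) + area (j, nb i K)) * side (nb i K) j <= 2 * (vol K + vol (nb i K)).
Proof.
have v0 := vol_ge0 K; have v1 := vol_ge0 (nb i K).
have [->|ji] := eqVneq j i.
  by rewrite area_neighbor mulrDl area_side_neighbor//; lra.
rewrite mulrDl -[X in _ + X](vol_area j) side_neighbor// -(vol_area j); lra.
Qed.

(** This is the case where the upwind velocity belongs to the next dual cell along [e_j]. For
    [j = i] that dual cell contains half of [nb i K], and the comparison is immediate. For [j != i]
    the direction [i] is transverse to [j], so that [vol_neighbor_le] applies. *)
Let area_pair_shift m j (K : cell (g m)) :
  (area (j, K) + area (j, nb i K)) * side (nb i K) j <= 4 * kap ^+ 2 * dual_vol (i, nb j K).
Proof.
have v0 := vol_ge0 K; have v1 := vol_ge0 (nb i K).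
have kap21 : 1 <= kap ^+ 2 by rewrite expr_ge1.
rewrite dual_volE; have [->|ji] := eqVneq j i.
  rewrite area_neighbor mulrDl area_side_neighbor//.
  have v2 := vol_ge0 (nb i (nb i K)).
  rewrite (@le_trans _ _ (1 * (2 * (vol (nb i K) + vol (nb i (nb i K)))))) //; first lra.
  rewrite [leRHS](_ : _ = kap ^+ 2 * (2 * (vol (nb i K) + vol (nb i (nb i K))))); last by field.
  by rewrite ler_wpM2r// mulr_ge0// addr_ge0.
rewrite mulrDl -[X in _ + X](vol_area j) side_neighbor// -(vol_area j).
have ij : i != j by rewrite eq_sym.
have h1 := vol_neighbor_le true K (ratio_mesh m) ij.
have h2 := vol_neighbor_le true (nb i K) (ratio_mesh m) ij.
rewrite (neighborC true true i j).
have w1 := vol_ge0 (nb j K); have w2 := vol_ge0 (nb j (nb i K)).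
have h3 : vol K + vol (nb i K) <= kap ^+ 2 * (vol (nb j K) + vol (nb j (nb i K))).
  by rewrite mulrDr lerD.
apply: (le_trans h3).
rewrite [leRHS](_ : _ = kap ^+ 2 * (2 * (vol (nb j K) + vol (nb j (nb i K))))); last by field.
by rewrite ler_wpM2l ?sqr_ge0//; lra.
Qed.

Let up j : family := fun m n K => upval (rho_ (w m n)) (u_ (w m n)) i j K.
Arguments up : clear implicits.
Let M j : family := fun m n K => momflux gamma eps (w m n) (w m n.+1) i j K.
Arguments M : clear implicits.
Let ie := (eps ^+ 2)^-1.
Let ie0 : 0 <= ie. Proof. by rewrite invr_ge0 sqr_ge0. Qed.

Let ME m n j (K : cell (g m)) : M j m n K = (F j m n K + F j m n (nb i K)) / 2 * up j m n K +
  (if j == i then ie * area (i, K) * pq m n.+1 (nb i K) else 0).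
Proof. by rewrite /M /momflux (dualfluxE (fun m => rho_ (w m n)) (fun m => u_ (w m n))). Qed.

Let up_bound m n j (K : cell (g m)) : (n < N m)%N -> `|up j m n K| <= C.
Proof. by move=> nN; rewrite /up /upval; case: ifP => _; rewrite u_bound// ltnW. Qed.

Let M_bound m n j (K : cell (g m)) : (n < N m)%N ->
  `|M j m n K| * side (nb i K) j <= (C1 * C + ie * Cp) * (vol K + vol (nb i K)).
Proof.
move=> nN; have s0 := side_ge0 (nb i K) j.
rewrite ME -[X in _ * X](ger0_norm s0) -normrM mulrDl (le_trans (ler_normD _ _))// [leRHS]mulrDl.
have v0 := vol_ge0 K; have v1 := vol_ge0 (nb i K).
apply: lerD.
  rewrite normrM (ger0_norm s0) normrM.
  have b1 : `|(F j m n K + F j m n (nb i K)) / 2| <= C1 * ((area (j, K) + area (j, nb i K)) / 2).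
    have n2 : `|2^-1 : R| = 2^-1 by rewrite ger0_norm.
    rewrite normrM n2 [leRHS]mulrA ler_wpM2r// mulrDr (le_trans (ler_normD _ _))// lerD//.
      exact: F_bound.
    exact: F_bound.
  have b2 := up_bound j K nN.
  apply: (@le_trans _ _ (C1 * ((area (j, K) + area (j, nb i K)) / 2) * C * side (nb i K) j)).
    by rewrite ler_wpM2r// ler_pM.
  rewrite [leLHS](_ : _ = C1 * C * ((area (j, K) + area (j, nb i K)) * side (nb i K) j / 2)); last by ring.
  rewrite ler_wpM2l ?mulr_ge0//.
  by have := area_pair j K; lra.
case: eqP => [->|_]; last by rewrite mul0r normr0 mulr_ge0// ?addr_ge0// mulr_ge0.
rewrite [X in `|X|](_ : _ = ie * (vol (nb i K) * pq m n.+1 (nb i K))); last first.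
  by rewrite -(area_side_neighbor true i K); ring.
rewrite normrM (ger0_norm ie0) -[leRHS]mulrA; apply: ler_wpM2l => //.
rewrite normrM (ger0_norm v1) mulrC; apply: ler_pM => //; first exact: p_norm.
by rewrite lerDr.
Qed.

Let lim j (phi : R * 'rV[R]_d -> R) := I (fun z => rho z * u j z * u i z * dx_ j phi z) +
  (if j == i then ie * I (fun z => p z * dx_ j phi z) else 0).

Let M_limit phi j : test_function T a b phi ->
  S m (fun n K => M j m n K * side (nb i K) j * smpm m (dx_ j phi) n (nb i K))
     @[m --> \oo] --> lim j phi.
Proof.
move=> tphi; have Ldx := test_dx_lip tphi j; rewrite /lim.
have c1 : S m (fun n K => (F j m n K + F j m n (nb i K)) / 2 * up j m n K * side (nb i K) j
    * smpm m (dx_ j phi) n (nb i K)) @[m --> \oo]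
    --> I (fun z => rho z * u j z * u i z * dx_ j phi z).
  apply: (momentum_flux_cvg (i := i) (j := j) (F := F j) (up := up j) (u := uq i)
    (h := fun z => rho z * u j z) (uf := u i) (CF := C1) (Cw := 4 * kap ^+ 2)) => //.
  - by rewrite mulr_ge0// sqr_ge0.
  - exact: bmM.
  - by move=> m n K nN; exact: F_bound.
  - exact: F_limit.
  (* For [j != i] a shift along [e_i] does not change the side along [e_j], and every summand is
     zero. *)
  - move=> psi Lpsi; have [->|ji] := eqVneq j i; first exact: F_variation.
    apply: (@cvg0_le _ _ (fun=> 0)); last exact: cvg_cst.
    move=> m; rewrite /Ssum big1 ?mulr0 ?normr0// => n _.
    by rewrite big1// => K _; rewrite side_neighbor// subrr mulr0 mul0r.
  - by move=> m n K; rewrite /up /upval; case: ifP => _; [left|right].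
  - move=> m K; rewrite (le_trans (area_pair j K))// vol_pairE mulrA ler_wpM2r ?dual_vol_ge0//.
    have : 1 <= kap ^+ 2 by rewrite expr_ge1.
    lra.
have c2 : S m (fun n K => (if j == i then ie * area (i, K) * pq m n.+1 (nb i K) else 0)
    * side (nb i K) j * smpm m (dx_ j phi) n (nb i K)) @[m --> \oo]
    --> (if j == i then ie * I (fun z => p z * dx_ j phi z) else 0).
  case: eqP => [ji|_]; last first.
    apply: (@cvg0_le _ _ (fun=> 0)); last exact: cvg_cst.
    move=> m; rewrite /Ssum big1 ?mulr0 ?normr0// => n _.
    by rewrite big1// => K _; rewrite !mul0r.
  (* The pressure is taken at level [n.+1]. Since area times side is the volume of the cell carrying
     it, re-indexing by [nb i] gives the weak limit on cells. *)
  have [_ cp] := cell_limit_next i Cp0 (fun m n K nN => p_norm K nN) cl_p.1.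
  have : ie * S m (fun n K => vol K * (pq m n.+1 K * smpm m (dx_ j phi) n K)) @[m --> \oo]
      --> ie * I (fun z => p z * dx_ j phi z) by apply: cvgMl_tmp; exact: cp.
  apply: cvg_trans; apply: near_eq_cvg; apply: nearW => m.
  rewrite -SsumZ -(Ssum_neighbor _ _ true i); apply: eq_Ssum => n K _.
  by rewrite -(area_side_neighbor true i K) ji; ring.
apply: cvg_trans (cvgD c1 c2); apply: near_eq_cvg; apply: nearW => m /=.
apply/esym; rewrite [RHS]/GRing.add/= -[RHS]SsumD; apply: eq_Ssum => n K _.
by rewrite ME !mulrDl.
Qed.

Lemma momentum_limit phi : test_function T a b phi ->
  I (fun z => rho z * u i z * dt_ phi z)
    + \sum_j (I (fun z => rho z * u j z * u i z * dx_ j phi z)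
        + (if j == i then (eps ^+ 2)^-1 * I (fun z => (rho z * theta z) `^ gamma * dx_ j phi z)
           else 0)) =
  - Rintegral (lebesgue_rV d) (Omega a b) (fun x => rho0 x * u0 i x * phi (0, x)).
Proof.
move=> tphi; have CC : 0 <= C1 * C + ie * Cp by rewrite addr_ge0 ?mulr_ge0.
have CuC : 0 <= Cu * C by rewrite mulr_ge0.
apply: (weak_consistency (i := i) (V := fun m K => dual_vol (i, K))
  (q := fun m n K => dual_density (rho_ (w m n)) (i, K) * u_ (w m n) (i, K))
  (G := fun m n j => M j m n) (sh := fun m => nb i) (C := Cu * C + (C1 * C + ie * Cp))
  (lj := fun j => lim j phi) _ tphi).
- by rewrite addr_ge0.
- move=> m n nN; have dtn0 : dt m != 0 by rewrite gt_eqF// (dt_gt0 T0 (N0 m) (dtE m)).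
  by have [] := scheme_conserved dtn0 (hw nN).
- by move=> m j K; rewrite neighborC.
- move=> m n K nN; rewrite dual_mass normrM.
  have v0 := vol_ge0 K; have v1 := vol_ge0 (nb i K).
  have r1 := rho_norm K (ltnW nN); have r2 := rho_norm (nb i K) (ltnW nN).
  have un := u_bound (i, K) (ltnW nN).
  apply: (@le_trans _ _ (Cu * (vol K + vol (nb i K)) * C)).
    have n2 : `|2^-1 : R| = 2^-1 by rewrite ger0_norm.
    apply: ler_pM => //; rewrite normrM n2.
    apply: (@le_trans _ _ `|vol K * rq m n K + vol (nb i K) * rq m n (nb i K)|).
      by rewrite ler_piMr//; lra.
    rewrite (le_trans (ler_normD _ _))// mulrDr lerD//.
      by rewrite normrM (ger0_norm v0) mulrC ler_wpM2r.
    by rewrite normrM (ger0_norm v1) mulrC ler_wpM2r.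
  rewrite mulrAC mulrDl lerDl mulr_ge0// addr_ge0//.
- move=> m n j K nN; rewrite (le_trans (M_bound j K nN))// ler_wpM2r ?addr_ge0 ?vol_ge0//.
  by rewrite lerDr.
- have := dual_momentum_cvg Cu0 (fun m n K nN => rho_norm K (ltnW nN)) cl_rho (fl_u i) (test_dt_lip tphi).
  apply: cvg_trans; apply: near_eq_cvg; apply: nearW => m; apply: eq_Ssum => n K nN.
  by rewrite dual_mass.
- by move=> j; exact: M_limit.
(* The initial momentum is treated as a family constant in time, so that [dual_momentum_cvg] applies
   to it as it does to the solution. *)
- apply: (@initial_limit (fun m K => _)); first exact: bmM (bmM brho0 (bu0 i)) (bm_initial (test_lip tphi)).
  have [Mu Mu0 hMu] := bm_bound (bu0 i); have [bu0' _] := int_time_constant (bu0 i).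
  have clr : cell_limit (fun m _ => rq m 0%N) (fun z => rho0 z.2).
    by apply: (initial_cell_limit (B := Cu)) => // m K; have [] := w_norm0 K.
  have flu : face_limit i (fun m _ => uq i m 0%N) (fun z => u0 i z.2).
    apply: (piecewise_L1_face (C := Num.max C Mu)) => //.
    + by move=> m n K _; rewrite le_max u_bound.
    + by move=> [t x] [/= _ Ox]; rewrite le_max hMu// orbT.
    + by rewrite le_max C0.
  have := dual_momentum_cvg Cu0 (fun m n K nN => rho_norm K (leq0n _)) clr flu (initial_lip (test_lip tphi)).
  apply: cvg_trans; apply: near_eq_cvg; apply: nearW => m; apply: eq_Ssum => n K nN.
  by rewrite dual_mass /smp mul0r.
Qed.

End component.

End weak_limits.

End sequence_limits.

(** * Truncation *)

Section clipping.
Context {disp : measure_display} {X : measurableType disp} {R : realType}.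
Variable mu : {measure set X -> \bar R}.
Variable D : set X.
Hypotheses (mD : measurable D) (muD : (mu D < +oo)%E).
Implicit Types f g : X -> R.

Definition clip (l h x : R) : R := Num.max l (Num.min h x).

Lemma clip_range l h x : l <= h -> l <= clip l h x <= h.
Proof. by move=> lh; rewrite /clip le_max lexx/= ge_max lh ge_min lexx. Qed.

Lemma clip_id l h x : l <= x <= h -> clip l h x = x.
Proof. by move=> /andP[lx xh]; rewrite /clip min_r// max_r. Qed.

Lemma clip_lip l h x y : `|clip l h x - clip l h y| <= `|x - y|.
Proof.
rewrite /clip !maxEle !minEle ler_norml; have := ler_norm (x - y); have := ler_norm (y - x).
rewrite distrC => h1 h2; apply/andP.
by case: (leP h x) => ?; case: (leP h y) => ?; do ![case: (leP l _) => ?]; split; lra.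
Qed.

Lemma measurable_clip l h f : measurable_fun D f -> measurable_fun D (fun x => clip l h (f x)).
Proof.
move=> mf; apply: measurable_maxr; first exact: measurable_cst.
by apply: measurable_minr => //; exact: measurable_cst.
Qed.

Lemma bm_clip l h f : l <= h -> measurable_fun D f -> bm D (fun x => clip l h (f x)).
Proof.
move=> lh mf; split; first exact: measurable_clip.
exists (`|l| + `|h|) => x _; have /andP[] := clip_range (f x) lh.
have := ler_norm h; have := ler_norm (- l); rewrite normrN => h1 h2 h3 h4.
have n1 := normr_ge0 l; have n2 := normr_ge0 h.
by rewrite ler_norml; apply/andP; split; lra.
Qed.

Lemma Linfty_measurable f : f \_ D \in Lfun mu +oo%E -> measurable_fun D f.
Proof.
move=> /sub_Lfun_mfun; rewrite inE => mf; have := mf.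
by move/(measurable_restrict f mD measurableT).2; rewrite setTI.
Qed.

(** The initial data are replaced by representatives bounded everywhere, truncated at their own
    essential bound. *)
Lemma Linfty_bounded f : f \_ D \in Lfun mu +oo%E ->
  exists2 f', bm D f' & ae_eq mu D f f'.
Proof.
move=> Lf; have mf := Linfty_measurable Lf.
have := sub_Lfun_finLfun Lf; rewrite inE /finite_norm unlock.
(* The L^oo norm is the essential supremum only if the space has positive measure. Otherwise any two
   functions agree almost everywhere, and 0 is a representative. *)
have [mu0|] := ltP 0%E (mu [set: X]); last first.
  rewrite measure_le0 => /eqP mu0 _; exists (fun=> 0); first exact: bm_cst.
  by exists setT; split => //.
rewrite /=; set g := abse \o _ => eg.
have [M gM] : exists M : R, (ess_sup mu g <= M%:E)%E.
  case: (ess_sup mu g) eg => [r| |] //; first by exists r.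
  by exists 0; rewrite leNye.
exists (fun x => clip (- `|M|) `|M| (f x)); first by apply: bm_clip => //; rewrite ge0_cp.
have := ess_sup_ge mu g; apply: filterS => x gx Dx.
have : ((`|f x|%R)%:E <= M%:E)%E.
  by apply: le_trans gM; apply: le_trans gx; rewrite /g/= /patch mem_set.
by rewrite lee_fin => fM; rewrite clip_id// -ler_norml (le_trans fM)// ler_norm.
Qed.

Lemma ae_Rintegral f g : measurable_fun D f -> measurable_fun D g -> ae_eq mu D f g ->
  Rintegral mu D f = Rintegral mu D g.
Proof.
move=> mf mg fg; congr fine; apply: ae_eq_integral => //; try exact/measurable_EFinP.
by apply: filterS fg => x fgx Dx /=; rewrite fgx.
Qed.

(* The limit takes its values in the interval of the approximations: it is
   closer to them after clipping, so it is a.e. equal to its clipped version. *)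
Lemma clip_limit (F : nat -> X -> R) f l h : l <= h -> measurable_fun D f ->
  (forall m, measurable_fun D (F m)) -> (forall m x, D x -> l <= F m x <= h) ->
  'N[mu]_1%:E[EFin \o ((F m \- f)%R \_ D)]%E @[m --> \oo] --> 0%E ->
  ae_eq mu D f (fun x => clip l h (f x)) /\
  Rintegral mu D (fun x => `|F m x - clip l h (f x)|) @[m --> \oo] --> 0.
Proof.
move=> lh mf mF hF cv.
have mc := measurable_clip l h mf.
have {}cv : (\int[mu]_(x in D) (`|F m x - f x|%R)%:E)%E @[m --> \oo] --> 0%E.
  apply: cvg_trans cv; apply: near_eq_cvg; apply: nearW => m; rewrite Lnorm1.
  rewrite [RHS]integral_mkcond; apply: eq_integral => x _ /=.
  by rewrite /patch; case: ifP => //= _; rewrite normr0.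
(* A function dominated by every [|F m - f|] has integral zero. This is applied to the part of [f]
   outside the interval. *)
have le1 g : measurable_fun D g -> (forall m x, D x -> `|g x| <= `|F m x - f x|) ->
    (\int[mu]_(x in D) (`|g x|%R)%:E = 0)%E.
  move=> mg hg; apply/eqP; rewrite eq_le integral_ge0// andbT.
  apply: (cvge_to_ge cv); apply: nearW => m; apply: ge0_le_integral => //.
  - by apply/measurable_EFinP; exact: measurableT_comp.
  - by apply/measurable_EFinP; apply: measurableT_comp => //; exact: measurable_funB.
  - by move=> x Dx; rewrite lee_fin hg.
split.
  have : (\int[mu]_(x in D) `|(f x - clip l h (f x))%R%:E| = 0)%E.
    apply: (le1 (fun x => f x - clip l h (f x))); first exact: measurable_funB.
    move=> m x Dx; have /andP[] := hF m x Dx.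
    rewrite /clip maxEle minEle.
    have := ler_norm (F m x - f x); have := ler_norm (f x - F m x); rewrite distrC => h1 h2 h3 h4.
    by case: (leP h (f x)) => ?; case: (leP l _) => ?; rewrite ler_norml; apply/andP; split; lra.
  move/ae_eq_integral_abs => /(_ mD) H.
  have /H : measurable_fun D (fun x => (f x - clip l h (f x))%:E).
    by apply/measurable_EFinP; exact: measurable_funB.
  by apply: filterS => x /[apply] -[/eqP]; rewrite subr_eq0 => /eqP.
apply: fine_cvg; apply: (squeeze_cvge _ _ cv); last exact: cvg_cst.
apply: nearW => m; rewrite integral_ge0//=.
apply: ge0_le_integral => //.
- by apply/measurable_EFinP; apply: measurableT_comp => //; exact: measurable_funB.
- by apply/measurable_EFinP; apply: measurableT_comp => //; exact: measurable_funB.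
- by move=> x Dx; rewrite lee_fin -{1}(clip_id (hF m x Dx)) clip_lip.
Qed.

End clipping.

Lemma ae_Rintegral_sub {disp : measure_display} {X : measurableType disp} {R : realType}
    (mu : {measure set X -> \bar R}) (D A : set X) (f g : X -> R) :
  measurable D -> measurable A -> A `<=` D ->
  measurable_fun D f -> measurable_fun D g -> ae_eq mu D f g ->
  Rintegral mu A f = Rintegral mu A g.
Proof.
move=> mD mA AD mf mg fg; apply: ae_Rintegral => //; try exact: measurable_funS mD AD _.
by apply: filterS fg => x fgx /AD.
Qed.

(** Averages do not see null sets, so the given discrete solutions also start from the bounded
    representatives of the data. *)
Lemma initial_state_ae (R : realType) (d : nat) (a b : 'I_d -> R) (g : mac_grid a b)
    (rho0 theta0 rho1 theta1 : 'rV[R]_d -> R) (u0 u1 : 'I_d -> 'rV[R]_d -> R) :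
  let mO f := measurable_fun (Omega a b) f in
  let eqO := ae_eq (lebesgue_rV d) (Omega a b) in
  mO rho0 -> mO theta0 -> (forall i, mO (u0 i)) ->
  mO rho1 -> mO theta1 -> (forall i, mO (u1 i)) ->
  eqO rho0 rho1 -> eqO theta0 theta1 -> (forall i, eqO (u0 i) (u1 i)) ->
  initial_state g rho0 u0 theta0 = initial_state g rho1 u1 theta1.
Proof.
move=> mO eqO m1 m2 m3 m4 m5 m6 e1 e2 e3; have mOm := @measurable_Omega R d a b.
have cellE f f1 (K : cell g) : mO f -> mO f1 -> eqO f f1 ->
    Rintegral (lebesgue_rV d) (cell_set K) f = Rintegral (lebesgue_rV d) (cell_set K) f1.
  by move=> mf mf1; apply: ae_Rintegral_sub => //; [exact: measurable_box|exact: cell_set_Omega].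
rewrite /initial_state; f_equal; apply/funext.
- by move=> K; congr (_ * _); exact: cellE.
- move=> [i K]; congr (_ * _); have [md _] := dual_set_measure i K.
  exact: (ae_Rintegral_sub mOm md (@dual_set_Omega _ _ _ _ g i K) (m3 i) (m6 i) (e3 i)).
- by move=> K; congr (_ * _); exact: cellE.
Qed.

Theorem theorem4p1 (R : realType) (d : nat) (hd : (1 <= d <= 3)%N)
  (a b : 'I_d -> R) (hab : forall i, a i < b i)
  (T gamma eps eta : R) (hT : 0 < T) (hgamma : 1 < gamma)
  (heps : 0 < eps <= 1) (heta : 0 < eta)
  (rho0 : 'rV[R]_d -> R) (u0 : 'I_d -> 'rV[R]_d -> R) (theta0 : 'rV[R]_d -> R)
  (hrho0 : Linfty_Omega a b rho0) (hu0 : forall i, Linfty_Omega a b (u0 i))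
  (htheta0 : Linfty_Omega a b theta0)
  (g : nat -> mac_grid a b) (N : nat -> nat) (hN : forall m, (0 < N m)%N)
  (dt : nat -> R) (dtE : forall m, dt m = T / (N m)%:R)
  (dt_cvg : dt m @[m --> \oo] --> 0)
  (h_cvg : mesh_size (g m) @[m --> \oo] --> 0)
  (w : forall m, nat -> state (g m))
  (hw : forall m, discrete_solution gamma eps eta (dt m) (N m)
                    rho0 u0 theta0 (w m))
  (hbound : exists Cl Cu C : R, [/\ 0 < Cl, 0 < Cu, 0 < C &
     forall m n, (n <= N m)%N ->
       [/\ forall K, Cl < rho_ (w m n) K <= Cu,
           forall K, Cl < theta_ (w m n) K <= Cu
         & forall s, `|u_ (w m n) s| <= C]])
  (rho : R * 'rV[R]_d -> R) (u : 'I_d -> R * 'rV[R]_d -> R)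
  (theta : R * 'rV[R]_d -> R)
  (hrho : Linfty_Q T a b rho) (hu : forall i, Linfty_Q T a b (u i))
  (htheta : Linfty_Q T a b theta)
  (rho_cvg : forall r, 1 <= r ->
     LrQ_norm T a b r (rho_fun (dt m) (N m) (w m) \- rho) @[m --> \oo] --> 0%E)
  (u_cvg : forall r i, 1 <= r ->
     LrQ_norm T a b r (u_fun i (dt m) (N m) (w m) \- u i) @[m --> \oo] --> 0%E)
  (theta_cvg : forall r, 1 <= r ->
     LrQ_norm T a b r (theta_fun (dt m) (N m) (w m) \- theta)
       @[m --> \oo] --> 0%E)
  (hmesh : exists2 mu : R, 0 < mu & forall m,
     dt m / min_diam (g m) <= mu /\ max_ratio (g m) <= mu) :
  weak_solution T a b gamma eps rho0 u0 theta0 rho u theta.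
Proof.
have [Cl [Cu [C [Cl0 Cu0 C0 hb]]]] := hbound; have [mu mu0 hm] := hmesh.
have eps0 : 0 < eps by case/andP: heps.
have i0 : 'I_d by case/andP: hd => d0 _; exact: Ordinal d0.
have rb m n K : (n <= N m)%N -> Cl <= rho_ (w m n) K <= Cu.
  by move=> /hb[h _ _]; have /andP[/ltW-> ->] := h K.
have tb m n K : (n <= N m)%N -> Cl <= theta_ (w m n) K <= Cu.
  by move=> /hb[_ h _]; have /andP[/ltW-> ->] := h K.
have ub m n s : (n <= N m)%N -> `|u_ (w m n) s| <= C by move=> /hb[_ _].
have ClCu : Cl <= Cu.
  by have /andP[h1 h2] := rb 0%N 0%N (cell0 (g 0%N)) (leq0n _); exact: le_trans h2.
have CC : - C <= C by lra.
have dt_mesh m : dt m <= mu * min_diam (g m).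
  by rewrite -ler_pdivrMr ?(min_diam_gt0 (g m) i0)//; case: (hm m).
have ratio_mesh m : max_ratio (g m) <= mu by case: (hm m).
have mQ := @measurable_Q R d T a b; have fQ := muQ_fin hT hab.
have mO := @measurable_Omega R d a b; have fO := lebesgue_Omega_fin hab.
have mrho := Linfty_measurable mQ hrho.
have mtheta := Linfty_measurable mQ htheta.
have mu_ i := Linfty_measurable mQ (hu i).
have lim (A : forall m, cell (g m) -> set 'rV[R]_d) (V : forall m, cell (g m) -> R)
    (q : forall m, nat -> cell (g m) -> R) l h (f : R * 'rV[R]_d -> R) :
    (forall m K, measurable (A m K) /\ lebesgue_rV d (A m K) = (V m K)%:E) ->
    (forall m x, Omega a b x -> exists K, A m K x) ->
    (forall m K L x, A m K x -> A m L x -> K = L) ->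
    (forall m n K, (n <= N m)%N -> l <= q m n K <= h) -> l <= h ->
    @measurable_fun _ _ (measurableTypeR R * 'rV[R]_d)%type _ (Qset T a b) f ->
    LrQ_norm T a b 1 (piecewise (@A m) (dt m) (N m) (q m) \- f) @[m --> \oo] --> 0%E ->
    ae_eq (@muQ R d) (Qset T a b) f (fun z => clip l h (f z)) /\
    Rintegral (@muQ R d) (Qset T a b)
      (fun z => `|piecewise (@A m) (dt m) (N m) (q m) z - clip l h (f z)|) @[m --> \oo] --> 0.
  move=> hA cov inj hq lh mf; apply: clip_limit => //.
    by move=> m; have [] := @bm_piecewise _ _ T _ _ _ (N m) (dt m) _ _ (hA m) (q m).
  move=> m z Qz; have [n [K [nN _ _ ->]]] := Q_slot hT (hN m) (dtE m) (cov m) (inj m) Qz.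
  by rewrite hq// ltnW.
have [erho Lrho] := lim _ _ (fun m n => rho_ (w m n)) _ _ _ (@cell_measure _ _ _ _ g)
  (fun m => @cell_of _ _ _ _ (g m)) (fun m => @cell_set_inj _ _ _ _ (g m)) rb ClCu mrho
  (rho_cvg 1 (lexx 1)).
have [etheta Ltheta] := lim _ _ (fun m n => theta_ (w m n)) _ _ _ (@cell_measure _ _ _ _ g)
  (fun m => @cell_of _ _ _ _ (g m)) (fun m => @cell_set_inj _ _ _ _ (g m)) tb ClCu mtheta
  (theta_cvg 1 (lexx 1)).
have ub' i m n (K : cell (g m)) : (n <= N m)%N -> - C <= u_ (w m n) (i, K) <= C.
  by move=> nN; rewrite -ler_norml ub.
have ulim i := lim _ _ (fun m n K => u_ (w m n) (i, K)) _ _ _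
  (fun m => @dual_set_measure _ _ _ _ (g m) i) (fun m => @dual_of _ _ _ _ (g m) i)
  (fun m => @dual_set_inj _ _ _ _ (g m) i) (ub' i) CC (mu_ i) (u_cvg 1 i (lexx 1)).
pose rho' z := clip Cl Cu (rho z); pose theta' z := clip Cl Cu (theta z).
pose u' i z := clip (- C) C (u i z).
(* There are finitely many components, so one null set serves all the unknowns. *)
have E : \forall z \ae (@muQ R d), Qset T a b z ->
    [/\ rho z = rho' z, theta z = theta' z & forall i, u i z = u' i z].
  have eu : \forall z \ae (@muQ R d), forall i, Qset T a b z -> u i z = u' i z.
    by apply: filter_forall => i; have [] := ulim i.
  by apply: filterS3 erho etheta eu => z hr ht hv Qz; split => [| |i]; [exact: hr|exact: ht|exact: hv].
have FF : Filter (nbhs (almost_everywhere (@muQ R d))) by exact: ae_filter_ringOfSetsType.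
have [rho1 brho1 erho0] := Linfty_bounded mO hrho0.
have [theta1 btheta1 etheta0] := Linfty_bounded mO htheta0.
have /choice[u1 hu1] i : exists f, bm (Omega a b) f /\ ae_eq (lebesgue_rV d) (Omega a b) (u0 i) f.
  by have [f] := Linfty_bounded mO (hu0 i); exists f.
have mrho0 := Linfty_measurable mO hrho0.
have mtheta0 := Linfty_measurable mO htheta0.
have mu0_ i := Linfty_measurable mO (hu0 i).
have bu1 i : bm (Omega a b) (u1 i) by case: (hu1 i).
have eu0 i : ae_eq (lebesgue_rV d) (Omega a b) (u0 i) (u1 i) by case: (hu1 i).
have w0 m : w m 0%N = initial_state (g m) rho1 u1 theta1.
  have [-> _] := hw m; apply: initial_state_ae => //; try exact: bm_meas.
  by move=> i; exact: bm_meas.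
have hw' m n : (n < N m)%N -> scheme_step gamma eps eta (dt m) (w m n) (w m n.+1).
  by have [_] := hw m; apply.
have brho' := bm_clip ClCu mrho; have btheta' := bm_clip ClCu mtheta.
have bu' i := bm_clip CC (mu_ i).
have rr z : Qset T a b z -> Cl <= rho' z <= Cu by move=> _; exact: clip_range.
have tr z : Qset T a b z -> Cl <= theta' z <= Cu by move=> _; exact: clip_range.
have ur i z : Qset T a b z -> `|u' i z| <= C by move=> _; rewrite ler_norml; exact: clip_range.
have Lu i := (ulim i).2.
have tbm f : test_function T a b f -> bm (Omega a b) (fun x => f (0, x)) /\
    [/\ bm (Qset T a b : set (measurableTypeR R * 'rV[R]_d)%type) (dt_ f)
      & forall i, bm (Qset T a b : set (measurableTypeR R * 'rV[R]_d)%type) (dx_ i f)].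
  move=> tf; split.
    by apply: (bm_initial hT hab hN dtE dt_cvg h_cvg); exact: test_lip.
  split => [|i]; apply: (lip_bm hT hab hN dtE dt_cvg h_cvg).
    exact: test_dt_lip.
  exact: test_dx_lip.
have C0' := ltW C0; have mu0' := ltW mu0.
have mass f (tf : test_function T a b f) := mass_limit hT hab hN dtE dt_cvg h_cvg hw' Cl0 C0'
  ClCu rb tb ub brho' bu' rr ur Lrho Lu brho1 w0 i0 tf.
have temp f (tf : test_function T a b f) := temp_limit hT hab hN dtE dt_cvg h_cvg hgamma eps0
  heta hw' Cl0 C0' mu0' ClCu rb tb ub dt_mesh ratio_mesh brho' btheta' bu' rr tr ur Lrho Ltheta Lu
  brho1 btheta1 w0 i0 tf.
have momentum f i (tf : test_function T a b f) := momentum_limit hT hab hN dtE dt_cvg h_cvg hgamma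
  hw' Cl0 C0' ClCu rb tb ub ratio_mesh brho' btheta' bu' rr tr ur Lrho Ltheta Lu
  brho1 bu1 w0 i tf.
pose mQ_ (f : R * 'rV[R]_d -> R) :=
  measurable_fun (Qset T a b : set (measurableTypeR R * 'rV[R]_d)%type) f.
(* [e] builds an integrand whose value at [z] depends only on the values of the unknowns at [z], so
   almost everywhere equality passes to it. One statement covers the three equations. *)
have clipped (e : (R * 'rV[R]_d -> R) -> (R * 'rV[R]_d -> R) ->
      ('I_d -> R * 'rV[R]_d -> R) -> R * 'rV[R]_d -> R) :
    (forall r t v, mQ_ r -> mQ_ t -> (forall i, mQ_ (v i)) -> mQ_ (e r t v)) ->
    (forall r t v r' t' v' z, r z = r' z -> t z = t' z -> (forall i, v i z = v' i z) ->
       e r t v z = e r' t' v' z) ->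
    int_Q T a b (e rho theta u) = Rintegral (@muQ R d) (Qset T a b) (e rho' theta' u').
  move=> me Ee; rewrite -[LHS]/(Rintegral (@muQ R d) (Qset T a b) (e rho theta u)).
  apply: ae_Rintegral => //.
  - exact: me.
  - by apply: me => [||i]; [exact: (bm_meas brho')|exact: (bm_meas btheta')|exact: (bm_meas (bu' i))].
  - by apply: filterS E => z hz Qz; have [? ? ?] := hz Qz; exact: Ee.
pose mO_ (f : 'rV[R]_d -> R) := measurable_fun (Omega a b) f.
have initial (e : ('rV[R]_d -> R) -> ('rV[R]_d -> R) ->
      ('I_d -> 'rV[R]_d -> R) -> 'rV[R]_d -> R) :
    (forall r t v, mO_ r -> mO_ t -> (forall i, mO_ (v i)) -> mO_ (e r t v)) ->
    (forall r t v r' t' v' z, r z = r' z -> t z = t' z -> (forall i, v i z = v' i z) ->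
       e r t v z = e r' t' v' z) ->
    int_Omega a b (e rho0 theta0 u0) = Rintegral (lebesgue_rV d) (Omega a b) (e rho1 theta1 u1).
  move=> me Ee; apply: ae_Rintegral => //.
  - exact: me.
  - by apply: me => [||i]; [exact: (bm_meas brho1)|exact: (bm_meas btheta1)|exact: (bm_meas (bu1 i))].
  - have eu : \forall x \ae lebesgue_rV d, forall i, Omega a b x -> u0 i x = u1 i x.
      by apply: filter_forall => i; exact: eu0.
    apply: filterS3 erho0 etheta0 eu => x h1 h2 h3 Ox.
    by apply: Ee => [||i]; [exact: h1|exact: h2|exact: h3].
split => //.
- move=> phi tphi; have [bphi [bt bx]] := tbm _ tphi.
  rewrite (clipped (fun r _ v z => r z * dt_ phi z + \sum_i r z * v i z * dx_ i phi z)); last first.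
  - by move=> r t v r' t' v' z -> _ hv; congr (_ + _); apply: eq_bigr => i _; rewrite hv.
  - move=> r t v mr _ mv; apply: measurable_funD.
      by apply: measurable_funM => //; exact: bm_meas.
    apply: measurable_sum => i; apply: measurable_funM; last exact: bm_meas.
    exact: (measurable_funM _ (mv _)).
  rewrite (initial (fun r _ _ x => r x * phi (0, x))); last first.
  - by move=> r t v r' t' v' x ->.
  - by move=> r t v mr _ _; apply: (measurable_funM mr); exact: (bm_meas bphi).
  rewrite -mass// intD//; [|exact: bmM brho' bt|by apply: bm_sum => i; exact: bmM (bmM brho' (bu' i)) (bx i)].
  by rewrite int_sum// => i; exact: bmM (bmM brho' (bu' i)) (bx i).
- move=> phi tphi.
  have bphi i := (tbm _ (tphi i)).1; have bt i := (tbm _ (tphi i)).2.1.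
  have bx j i := (tbm _ (tphi i)).2.2 j.
  rewrite (clipped (fun r t v z => (\sum_i r z * v i z * dt_ (phi i) z)
          + (\sum_i \sum_j r z * v i z * v j z * dx_ j (phi i) z)
          + (eps ^+ 2)^-1 * (r z * t z) `^ gamma * (\sum_i dx_ i (phi i) z))); last first.
  - move=> r t v r' t' v' z -> -> hv; congr (_ + _ + _); apply: eq_bigr => i _; rewrite hv//.
    by apply: eq_bigr => j _; rewrite hv.
  - move=> r t v mr mt mv; apply: measurable_funD; first apply: measurable_funD.
    + apply: measurable_sum => i; apply: measurable_funM; last exact: bm_meas.
      exact: (measurable_funM _ (mv _)).
    + apply: measurable_sum => i; apply: measurable_sum => j.
      apply: measurable_funM; last exact: bm_meas.
      by apply: measurable_funM (mv _); exact: (measurable_funM _ (mv _)).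
    + apply: measurable_funM; last by apply: measurable_sum => i; exact: bm_meas.
      apply: measurable_funM; first exact: measurable_cst.
      by apply: (measurableT_comp (measurable_powR gamma)); exact: measurable_funM.
  rewrite (initial (fun r _ v x => \sum_i r x * v i x * phi i (0, x))); last first.
  - by move=> r t v r' t' v' x -> _ hv; apply: eq_bigr => i _; rewrite hv.
  - move=> r t v mr _ mv; apply: measurable_sum => i.
    by apply: measurable_funM; [exact: (measurable_funM _ (mv _))|exact: bm_meas].
  rewrite int_sum//; last by move=> i; exact: bmM (bmM brho1 (bu1 i)) (bphi i).
  (* The vector equation is the sum over [i] of the scalar equations tested with the components
     [phi i]. *)
  rewrite -sumrN; under [RHS]eq_bigr do rewrite -momentum//.
  have bp : bm (Qset T a b : set (measurableTypeR R * 'rV[R]_d)%type)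
      (fun z => (rho' z * theta' z) `^ gamma).
    apply: bm_powR; [lra| |exact: bmM brho' btheta'].
    move=> z Qz; have /andP[h1 _] := rr z Qz; have /andP[h2 _] := tr z Qz.
    by rewrite mulr_ge0// (le_trans (ltW Cl0)).
  under eq_fun do rewrite -mulrA mulr_sumr mulr_sumr.
  rewrite intD//; last first.
  - by apply: bm_sum => i; apply: bmZ; exact: bmM bp (bx i i).
  - apply: bmD; apply: bm_sum => i; first exact: bmM (bmM brho' (bu' i)) (bt i).
    by apply: bm_sum => j; exact: bmM (bmM (bmM brho' (bu' i)) (bu' j)) (bx j i).
  rewrite intD//; last first.
  - by apply: bm_sum => i; apply: bm_sum => j; exact: bmM (bmM (bmM brho' (bu' i)) (bu' j)) (bx j i).
  - by apply: bm_sum => i; exact: bmM (bmM brho' (bu' i)) (bt i).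
  rewrite !int_sum//; last first.
  - by move=> i; exact: bmM (bmM brho' (bu' i)) (bt i).
  - by move=> i; apply: bm_sum => j; exact: bmM (bmM (bmM brho' (bu' i)) (bu' j)) (bx j i).
  - by move=> i; apply: bmZ; exact: bmM bp (bx i i).
  rewrite -!big_split/=; apply: eq_bigr => i _; rewrite -addrA; congr (_ + _).
  rewrite int_sum//; last by move=> j; exact: bmM (bmM (bmM brho' (bu' i)) (bu' j)) (bx j i).
  rewrite big_split/=; congr (_ + _).
    by apply: eq_bigr => j _; apply: eq_Rintegral => z _; rewrite (mulrAC (rho' z)).
  (* Only [j = i] carries pressure in component [i]; summed over [i], these terms form the
     divergence. *)
  by rewrite -big_mkcond big_pred1_eq intZ//; exact: bmM bp (bx i i).
- move=> phi tphi; have [bphi [bt bx]] := tbm _ tphi.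
  rewrite (clipped (fun r t v z => r z * t z * dt_ phi z + \sum_i r z * t z * v i z * dx_ i phi z));
    last first.
  - by move=> r t v r' t' v' z -> -> hv; congr (_ + _); apply: eq_bigr => i _; rewrite hv.
  - move=> r t v mr mt mv; apply: measurable_funD.
      by apply: measurable_funM; [exact: measurable_funM|exact: bm_meas].
    apply: measurable_sum => i; apply: measurable_funM; last exact: bm_meas.
    by apply: measurable_funM (mv _); exact: measurable_funM.
  rewrite (initial (fun r t _ x => r x * t x * phi (0, x))); last first.
  - by move=> r t v r' t' v' x -> ->.
  - move=> r t v mr mt _; apply: measurable_funM; last exact: bm_meas.
    exact: measurable_funM.
  rewrite -temp// intD//; [|exact: bmM (bmM brho' btheta') bt|
    by apply: bm_sum => i; exact: bmM (bmM (bmM brho' btheta') (bu' i)) (bx i)].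
  by rewrite int_sum// => i; exact: bmM (bmM (bmM brho' btheta') (bu' i)) (bx i).
Qed.
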